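(* Let $(p,u,U)$ be a smooth solution of the incompressible Navier-Stokes equations on $\mathbb T^3$ existing on $[0,T_0]$ with $T_0\in(0,\infty]$, and write $(p_0,u_0,U_0)=(p,u,U)(0,\cdot)$. Let $(u^{\epsilon,\delta},p^{\epsilon,\delta},U^{\epsilon,\delta})$ be the solutions of the hyperbolic relaxation system on $[0,T_{\epsilon,\delta})\times\mathbb T^3$ with smooth initial data $(u^{\epsilon,\delta}_0,p^{\epsilon,\delta}_0,U^{\epsilon,\delta}_0)$, indexed by small $\epsilon,\delta>0$ (see context). Assume that there exist constants $a\in[0,1)$ and $C_0>0$, both independent of $\epsilon$ and $\delta$, such that $$\delta\le C_0\sqrt\epsilon,$$ $$\|u^{\epsilon,\delta}_0-u_0\|_{H^1(\mathbb T^3)}+\sqrt\epsilon\,\|p^{\epsilon,\delta}_0-p_0\|_{H^1(\mathbb T^3)}+\sqrt\delta\,\|U^{\epsilon,\delta}_0-U_0\|_{H^1(\mathbb T^3)}\le C_0(\epsilon+\delta),$$ $$\|\nabla\operatorname{div}u^{\epsilon,\delta}_0\|_{L^2(\mathbb T^3)}+\delta\left(\|\nabla^2p^{\epsilon,\delta}_0\|_{L^2(\mathbb T^3)}+\|\nabla\operatorname{div}U^{\epsilon,\delta}_0\|_{L^2(\mathbb T^3)}\right)\le C_0(\epsilon+\delta),$$ $$\left\|\nabla^2\left(u^{\epsilon,\delta}_0,\sqrt\epsilon\,p^{\epsilon,\delta}_0,\sqrt\delta\,U^{\epsilon,\delta}_0\right)\right\|_{L^2(\mathbb T^3)}\le C_0(\epsilon+\delta)^{-a}.$$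 Then, for any $T>0$ such that both $u^{\epsilon,\delta}$ and $u$ exist on $[0,T]$, $$\sup_{t\in[0,T]}\left(\|u^{\epsilon,\delta}(t,\cdot)-u(t,\cdot)\|_{H^1(\mathbb T^3)}+\sqrt\epsilon\,\|p^{\epsilon,\delta}(t,\cdot)-p(t,\cdot)\|_{H^1(\mathbb T^3)}\right)\le C_T(\epsilon+\delta)$$ for $\epsilon+\delta\ll1$, where $C_T$ depends only on $C_0$, $a$, $T$ and the smooth solution $(p,u,U)$. In particular, if $\delta=o(\sqrt\epsilon)$ (that is, $\delta/\sqrt\epsilon\to0$ as $\epsilon\to0$), then $$\sup_{t\in[0,T]}\|p^{\epsilon,\delta}(t,\cdot)-p(t,\cdot)\|_{H^1(\mathbb T^3)}\to0\quad\text{as }\epsilon\to0.$$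
   Context: Here $\mathbb T^d=\mathbb R^d/\mathbb Z^d$ (in this statement $d=3$). Incompressible Navier-Stokes equations (unit viscosity): $\nabla\cdot u=0$, $\partial_t u+\nabla\cdot(u\otimes u)=-\nabla p+\Delta u$, $u(0,\cdot)=u_0$, for $u(t,x)\in\mathbb R^d$, $p(t,x)\in\mathbb R$, with the normalization $\int_{\mathbb T^d}p(t,x)\,dx=0$ for all $t$. One sets $U=u\otimes u-\nabla u\in\mathbb R^{d\times d}$, so that $\partial_t u+\nabla\cdot U+\nabla p=0$. $(p,u,U)$ is a fixed smooth solution on $[0,T_0]\times\mathbb T^d$ (on $[0,\infty)\times\mathbb T^d$ if $T_0=\infty$). Relaxation system with parameters $\epsilon,\delta>0$, for $(p^{\epsilon,\delta},u^{\epsilon,\delta},U^{\epsilon,\delta})\in\mathbb R\times\mathbb R^d\times\mathbb R^{d\times d}$: $$\epsilon\,\partial_t p^{\epsilon,\delta}+\nabla\cdot u^{\epsilon,\delta}=0,\qquad \partial_t u^{\epsilon,\delta}+\nabla\cdot U^{\epsilon,\delta}+\nabla p^{\epsilon,\delta}=0,\qquad \delta\,\partial_t U^{\epsilon,\delta}+\nabla u^{\epsilon,\delta}=u^{\epsilon,\delta}\otimes u^{\epsilon,\delta}-U^{\epsilon,\delta},$$ with smooth initial data $(p^{\epsilon,\delta},u^{\epsilon,\delta},U^{\epsilon,\delta})(0,\cdot)=(p^{\epsilon,\delta}_0,u^{\epsilon,\delta}_0,U^{\epsilon,\delta}_0)$ on $\mathbb T^d$. $T_{\epsilon,\delta}\in(0,\infty]$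 denotes the lifespan (maximal existence time) of its solution. Conventions: $(\nabla u)_{ij}=\partial_{x_j}u_i$; $\operatorname{div}u=\nabla\cdot u=\sum_i\partial_{x_i}u_i$ for vector fields and $(\operatorname{div}U)_i=(\nabla\cdot U)_i=\sum_j\partial_{x_j}U_{ij}$ for matrix fields (so $\nabla\cdot\nabla u=\Delta u$); $\nabla^2$ denotes the tensor of all second-order spatial derivatives. Norms of tuples are the usual product norms. All constants are independent of $(\epsilon,\delta)$; the hypotheses are understood to hold for all members of the family indexed by $(\epsilon,\delta)$. *)

(* Defs.v *)
From HB Require Import structures.
From mathcomp Require Import all_boot all_order all_algebra.
From mathcomp Require Import all_classical all_reals all_analysis.

Set Implicit Arguments.
Unset Strict Implicit.
Unset Printing Implicit Defensive.

Import Order.TTheory GRing.Theory Num.Theory.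
Import numFieldNormedType.Exports.

Local Open Scope classical_set_scope.
Local Open Scope ring_scope.

(* Fields on the torus T^3 = R^3 / Z^3 are Z^3-periodic functions on 'rV[R]_3. *)

Definition periodic (R : realType) (V : Type) (f : 'rV[R]_3 -> V) : Prop :=
  forall (i : 'I_3) (x : 'rV[R]_3), f (x + delta_mx 0 i) = f x.

Definition torus_cell (R : realType) : set (R * R * R) :=
  (`[0, 1] `*` `[0, 1]) `*` `[0, 1].

Definition row_of_triple (R : realType) (z : R * R * R) : 'rV[R]_3 :=
  \row_(i < 3) nth 0 [:: z.1.1; z.1.2; z.2] i.

Definition torus_int (R : realType) (f : 'rV[R]_3 -> R) : R :=
  Rintegral ((@lebesgue_measure R \x @lebesgue_measure R) \x @lebesgue_measure R)%E
    (@torus_cell R) (fun z => f (row_of_triple z)).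

Definition pd (R : realType) (j : 'I_3) (f : 'rV[R]_3 -> R) (x : 'rV[R]_3) : R :=
  derive f x (delta_mx 0 j).

Definition grad (R : realType) (f : 'rV[R]_3 -> R) (x : 'rV[R]_3) : 'rV[R]_3 :=
  \row_j pd j f x.

Definition jac (R : realType) (v : 'rV[R]_3 -> 'rV[R]_3) (x : 'rV[R]_3) : 'M[R]_3 :=
  \matrix_(i, j) pd j (fun y => v y 0 i) x.

Definition divv (R : realType) (v : 'rV[R]_3 -> 'rV[R]_3) (x : 'rV[R]_3) : R :=
  \sum_j pd j (fun y => v y 0 j) x.

Definition divm (R : realType) (M : 'rV[R]_3 -> 'M[R]_3) (x : 'rV[R]_3) : 'rV[R]_3 :=
  \row_i \sum_j pd j (fun y => M y i j) x.

Definition lapl (R : realType) (v : 'rV[R]_3 -> 'rV[R]_3) (x : 'rV[R]_3) : 'rV[R]_3 :=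
  \row_i \sum_j pd j (pd j (fun y => v y 0 i)) x.

Definition outer (R : realType) (v w : 'rV[R]_3) : 'M[R]_3 :=
  \matrix_(i, j) (v 0 i * w 0 j).

(* A tensor field with (finitely many) components indexed by J, in the form in
   which Sobolev norms are taken; the norm on tuples of components is the
   Euclidean one. *)

Definition tensor (R : realType) (J : finType) := J -> 'rV[R]_3 -> R.

Definition tscal (R : realType) (f : 'rV[R]_3 -> R) : tensor R unit :=
  fun=> f.

Definition tvec (R : realType) (v : 'rV[R]_3 -> 'rV[R]_3) : tensor R 'I_3 :=
  fun i x => v x 0 i.

Definition tmat (R : realType) (M : 'rV[R]_3 -> 'M[R]_3) :
    tensor R ('I_3 * 'I_3)%type :=
  fun k x => M x k.1 k.2.

Definition tpair (R : realType) (J K : finType) (f : tensor R J) (g : tensor R K) :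
    tensor R (J + K)%type :=
  fun k => match k with inl i => f i | inr j => g j end.

Definition tgrad (R : realType) (J : finType) (f : tensor R J) :
    tensor R (J * 'I_3)%type :=
  fun k => pd k.2 (f k.1).

Definition L2norm (R : realType) (J : finType) (f : tensor R J) : R :=
  Num.sqrt (\sum_(k : J) torus_int (fun x => f k x ^+ 2)).

Definition H1norm (R : realType) (J : finType) (f : tensor R J) : R :=
  Num.sqrt (L2norm f ^+ 2 + L2norm (tgrad f) ^+ 2).

(* Derivative relative to a time interval I: one-sided at endpoints of I. *)

Definition dquot (R : realType) (f : R -> R) (t s : R) : R := (f s - f t) / (s - t).

Definition derivable_in (R : realType) (I : set R) (f : R -> R) (t : R) : Prop :=
  cvg (dquot f t s @[s --> within I t^']).

Definition dt (R : realType) (I : set R) (f : R -> R) (t : R) : R :=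
  lim (dquot f t s @[s --> within I t^']).

(* Ck I n f: all mixed partial derivatives in (t, x) of order at most n exist
   and are jointly continuous on I x R^3. *)

Fixpoint Ck (R : realType) (I : set R) (n : nat) (f : R -> 'rV[R]_3 -> R) : Prop :=
  {within I `*` setT, continuous (fun z : R * 'rV[R]_3 => f z.1 z.2)} /\
  if n is m.+1 then
    [/\ forall t x, I t -> derivable_in I (f ^~ x) t,
        forall t x (j : 'I_3), I t -> derivable (f t) x (delta_mx 0 j),
        Ck I m (fun t x => dt I (f ^~ x) t)
      & forall j : 'I_3, Ck I m (fun t => pd j (f t))]
  else True.

Definition smooth (R : realType) (I : set R) (f : R -> 'rV[R]_3 -> R) : Prop :=
  forall n, Ck I n f.

Definition smooth_fields (R : realType) (I : set R) (p : R -> 'rV[R]_3 -> R)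
    (u : R -> 'rV[R]_3 -> 'rV[R]_3) (U : R -> 'rV[R]_3 -> 'M[R]_3) : Prop :=
  [/\ forall t, I t -> [/\ periodic (p t), periodic (u t) & periodic (U t)],
      smooth I p,
      forall i, smooth I (fun t x => u t x 0 i)
    & forall i j, smooth I (fun t x => U t x i j)].

(* [0, T], resp. [0, oo) if T = +oo. *)
Definition time_upto (R : realType) (T : \bar R) : set R :=
  [set t | 0 <= t /\ (t%:E <= T)%E].

Definition time_before (R : realType) (T : \bar R) : set R :=
  [set t | 0 <= t /\ (t%:E < T)%E].

Definition navier_stokes (R : realType) (T0 : \bar R) (p : R -> 'rV[R]_3 -> R)
    (u : R -> 'rV[R]_3 -> 'rV[R]_3) (U : R -> 'rV[R]_3 -> 'M[R]_3) : Prop :=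
  let I := time_upto T0 in
  [/\ smooth_fields I p u U,
      forall t x, I t -> divv (u t) x = 0,
      forall t x i, I t ->
        dt I (fun s => u s x 0 i) t
          + divm (fun y => outer (u t y) (u t y)) x 0 i
        = - grad (p t) x 0 i + lapl (u t) x 0 i,
      forall t, I t -> torus_int (p t) = 0
    & forall t x, I t -> U t x = outer (u t x) (u t x) - jac (u t) x].

Definition relaxation_solution (R : realType) (eps delta : R)
    (p0 : 'rV[R]_3 -> R) (u0 : 'rV[R]_3 -> 'rV[R]_3) (U0 : 'rV[R]_3 -> 'M[R]_3)
    (T1 : \bar R) (p : R -> 'rV[R]_3 -> R)
    (u : R -> 'rV[R]_3 -> 'rV[R]_3) (U : R -> 'rV[R]_3 -> 'M[R]_3) : Prop :=
  let I := time_before T1 in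
  [/\ smooth_fields I p u U,
      [/\ p 0 = p0, u 0 = u0 & U 0 = U0],
      forall t x, I t -> eps * dt I (fun s => p s x) t + divv (u t) x = 0,
      forall t x i, I t ->
        dt I (fun s => u s x 0 i) t + divm (U t) x 0 i + grad (p t) x 0 i = 0
    & forall t x i j, I t ->
        delta * dt I (fun s => U s x i j) t + jac (u t) x i j
        = outer (u t x) (u t x) i j - U t x i j].

Definition relaxation_lifespan (R : realType) (eps delta : R)
    (p0 : 'rV[R]_3 -> R) (u0 : 'rV[R]_3 -> 'rV[R]_3) (U0 : 'rV[R]_3 -> 'M[R]_3)
    (T1 : \bar R) : Prop :=
  forall (T2 : \bar R) p u U, (0 < T2)%E ->
    relaxation_solution eps delta p0 u0 U0 T2 p u U -> (T2 <= T1)%E.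

(* The filter "eps -> 0+ along the family indexed by E", for pairs (eps, delta);
   delta is not constrained otherwise. *)
Definition eps_to0 (R : realType) (E : set (R * R)) : set_system (R * R) :=
  within E (filter_prod (0 : R)^'+ (globally [set: R])).

(* Main.v *)
Require Import Defs.
From HB Require Import structures.
From mathcomp Require Import all_boot all_order all_algebra.
From mathcomp Require Import all_classical all_reals all_analysis.
From mathcomp Require Import ring lra.

(** Let (w, q, W) be the difference between the relaxed and the reference
    solution and sigma = eps + delta. It solves the relaxation system with
    source - eps d_t p in the first equation and
    w (x) w + u (x) w + w (x) u - delta d_t U in the last one
    ([solutions_perturbation]). In the energy
    |w|^2 + eps |q|^2 + delta |W|^2 the transport terms form a divergence, so
    its growth is governed by itself and the sources ([energy_derive]); the
    same holds for the derivatives of the system. The source of size eps in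
    the first equation would cost a factor eps instead of the desired sigma^2.
    At the first order it is removed by adding eps d_t p to the k-th component
    of the k-th derivative of w ([hs_shift]); at the second order the loss is
    harmless.

    There remains the quadratic source. Let Y1 and Y2 be the sums of the
    energies of the first and of the second derivatives, initially of orders
    sigma^2 and sigma^(-2a). Leibniz and the interpolation inequality
    [gagliardo_nirenberg] bound the square integrals of the derivatives of
    w (x) w of order one and two by multiples of M Y1 and M Y2, up to smaller
    terms, where M is the squared sup norm of w. For each lam <= 1, [agmon]
    bounds M by a multiple of Y1 / lam + lam Y2, again up to smaller terms.
    The choice lam = sigma^(1+a) makes both parts of
    Z = Y1 / lam + lam Y2 initially of order s = sigma^(1-a), and gives
    Z' <= C (1 + Z) (Z + s) ([logistic_rate]). As s tends to 0 with sigma, Z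
    exists up to time T and remains of order s ([logistic_bound]), so that Y1
    is at most of order lam s = sigma^2. Since the means of w and q are
    conserved, the Poincare inequality adds the norms of order zero
    ([H1_estimate]). Dividing the estimate for q by sqrt eps gives the last
    claim.

    Among the functional inequalities on the torus, Poincare follows by
    averaging one variable at a time; Hardy and Agmon come from integrating
    the divergence of f^2 s rho^(-1) and f^2 s rho^(-3/2), where s and rho are
    periodic versions of the radial field and of the regularised squared
    distance to a point. *)

Set Implicit Arguments.
Unset Strict Implicit.
Unset Printing Implicit Defensive.

Import Order.TTheory GRing.Theory Num.Theory.
Import numFieldNormedType.Exports.

Local Open Scope classical_set_scope.
Local Open Scope ring_scope.

(** * Continuity *)

Lemma sum_ord3 (V : nmodType) (F : 'I_3 -> V) :
  \sum_j F j = F ord0 + F (lift ord0 ord0) + F ord_max.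
Proof.
rewrite 3!big_ord_recl big_ord0 addr0 addrA; congr (_ + _ + F _); exact/val_inj.
Qed.

Section continuity_toolbox.
Variables (R : realType) (S : topologicalType).
Implicit Types f g : S -> R.

Lemma cont_cst (c : R) : continuous (fun _ : S => c).
Proof. by move=> x; exact: cvg_cst. Qed.

Lemma contD f g : continuous f -> continuous g -> continuous (fun x => f x + g x).
Proof. by move=> cf cg x; apply: continuousD; [exact: cf|exact: cg]. Qed.

Lemma contM f g : continuous f -> continuous g -> continuous (fun x => f x * g x).
Proof. by move=> cf cg x; apply: continuousM; [exact: cf|exact: cg]. Qed.

Lemma contN f : continuous f -> continuous (fun x => - f x).
Proof. by move=> cf x; apply: continuousN; exact: cf. Qed.

Lemma contX f n : continuous f -> continuous (fun x => f x ^+ n).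
Proof.
move=> cf; elim: n => [|n IH]; first exact: cont_cst.
by under eq_fun do rewrite exprS; exact: contM.
Qed.

Lemma contV f : (forall x, f x != 0) -> continuous f -> continuous (fun x => (f x)^-1).
Proof. by move=> f0 cf x; apply: cvgV; [exact: f0|exact: cf]. Qed.

Lemma cont_norm f : continuous f -> continuous (fun x => `|f x|).
Proof.
by move=> cf x; apply: (@continuous_comp _ _ _ f); [exact: cf|exact: norm_continuous].
Qed.

Lemma cont_sum (I : Type) (r : seq I) (F : I -> S -> R) :
  (forall i, continuous (F i)) -> continuous (fun x => \sum_(i <- r) F i x).
Proof.
move=> cF; elim: r => [|i r IH].
  by under eq_fun do rewrite big_nil; exact: cont_cst.
by under eq_fun do rewrite big_cons; exact: contD.
Qed.

Lemma continuous_mkpair (A B : topologicalType) (f : S -> A) (g : S -> B) :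
  continuous f -> continuous g -> continuous (fun s => (f s, g s)).
Proof.
move=> cf cg s.
exact: (@cvg_pair S A B (nbhs s) (nbhs (f s)) (nbhs (g s)) _ _ _ f g (cf s) (cg s)).
Qed.

End continuity_toolbox.

Ltac cont := repeat match goal with
  | |- forall x, continuous_at x (fun y => @?f y + @?g y) => apply: (@contD _ _ f g)
  | |- forall x, continuous_at x (fun y => @?f y * @?g y) => apply: (@contM _ _ f g)
  | |- forall x, continuous_at x (fun y => - @?f y) => apply: (@contN _ _ f)
  | |- forall x, continuous_at x (fun y => @?f y ^+ ?n) => apply: (@contX _ _ f n)
  | |- forall x, continuous_at x (fun y => `|@?f y|) => apply: (@cont_norm _ _ f)
  | |- forall x, continuous_at x (fun y => \sum_(i <- ?r) @?f y i) => apply: cont_sum => ?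
  | |- forall x, continuous_at x (fun _ => ?c) => exact: (@cont_cst _ _ c)
  | H : forall x, continuous_at x _ |- _ => exact H
  | H : forall i, forall x, continuous_at x _ |- _ => simple apply H
  | H : forall i j, forall x, continuous_at x _ |- _ => simple apply H
  end.

(* In arithmetic, every integral is an unknown. *)
Ltac gen_int := repeat match goal with
  | |- context [@torus_int ?R ?f] => let a := fresh "int" in generalize (@torus_int R f); intro a
  end.

(** * Integration over the torus *)

Lemma rat_itv_nbhs (R : realType) (x : R) (V : set R) : nbhs x V ->
  exists c : rat * rat, `](ratr c.1 : R), ratr c.2[%classic x /\
                        `](ratr c.1 : R), ratr c.2[ `<=` V.
Proof.
move=> /nbhs_ballP [e /= e0 eV].
have [a] := @rat_in_itvoo R (x - e) x ltac:(by rewrite ltrBlDr ltrDl).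
have [b] := @rat_in_itvoo R x (x + e) ltac:(by rewrite ltrDl).
rewrite !in_itv /= => /andP[xb be] /andP[ea ax].
exists (a, b); split=> [|y] /=; rewrite in_itv /=; first by rewrite ax xb.
move=> /andP[ay yb]; apply: eV; rewrite /ball /= ltr_norml; lra.
Qed.

(** An open set is the union of the rational boxes that it contains, and these
    are countably many. *)
Lemma open_measurable3 (R : realType) (U : set (R * R * R)) :
  open U -> measurable U.
Proof.
move=> oU.
pose J (c : rat * rat) : set R := `](ratr c.1 : R), ratr c.2[%classic.
pose B (c : (rat * rat) * (rat * rat) * (rat * rat)) : set (R * R * R) :=
  (J c.1.1 `*` J c.1.2) `*` J c.2.
have -> : U = \bigcup_c (if `[< B c `<=` U >] then B c else set0).
  apply/seteqP; split => [[[x y] z] Uxyz|z [c _]]; last first.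
    by case: asboolP => // /[apply].
  have [[V W] /= [[[V1 V2] /= [nV1 nV2] V12] nW] VWU] : nbhs (x, y, z) U.
    exact: open_nbhs_nbhs.
  have [c1 [c1x c1V]] := rat_itv_nbhs nV1.
  have [c2 [c2y c2V]] := rat_itv_nbhs nV2.
  have [c3 [c3z c3V]] := rat_itv_nbhs nW.
  exists (c1, c2, c3) => //; case: asboolP => // -[].
  move=> [[x' y'] z'] [[/= Jx Jy] Jz]; apply: VWU; split => /=.
    by apply: V12; split => /=; [exact: c1V|exact: c2V].
  exact: c3V.
apply: countable_bigcupT_measurable => // c; case: asboolP => // _.
by apply: measurableX; [apply: measurableX|]; exact: measurable_itv.
Qed.

Lemma continuous_measurable3 (R : realType) (g : R * R * R -> R) :
  continuous g -> measurable_fun [set: R * R * R] g.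
Proof.
move=> /continuousP cg; apply: (measurability _ (measurable_realfun.RGenOpens.measurableE R)).
move=> _ [_ [a [b ->] <-]]; rewrite setTI; apply: open_measurable3.
exact/cg/interval_open.
Qed.

Lemma Rintegral_fubini d1 d2 (T1 : measurableType d1) (T2 : measurableType d2)
  (R : realType) (m1 : {sigma_finite_measure set T1 -> \bar R})
  (m2 : {sigma_finite_measure set T2 -> \bar R}) (A : set T1) (B : set T2)
  (g : T1 * T2 -> R) : measurable A -> measurable B ->
  (m1 \x m2)%E.-integrable (A `*` B) (EFin \o g) ->
  (forall x, A x -> m2.-integrable B (fun y => (g (x, y))%:E)) ->
  (forall y, B y -> m1.-integrable A (fun x => (g (x, y))%:E)) ->
  Rintegral (m1 \x m2)%E (A `*` B) g =
    Rintegral m1 A (fun x => Rintegral m2 B (fun y => g (x, y))) /\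
  Rintegral (m1 \x m2)%E (A `*` B) g =
    Rintegral m2 B (fun y => Rintegral m1 A (fun x => g (x, y))).
Proof.
move=> mA mB ig igB igA.
have mAB : measurable (A `*` B) by exact: measurableX.
pose h : T1 * T2 -> \bar R := (EFin \o g) \_ (A `*` B).
have ih : (m1 \x m2)%E.-integrable setT h by rewrite -integrable_mkcond.
have E : (\int[(m1 \x m2)%E]_(z in A `*` B) (g z)%:E)%E = (\int[(m1 \x m2)%E]_z h z)%E.
  by rewrite integral_mkcond.
split; rewrite [LHS]/Rintegral E.
- rewrite -integral12_prod_meas1// Rintegral_mkcond /Rintegral; congr fine.
  apply: eq_integral => x _; rewrite patchE; case: ifPn => xA.
    rewrite fineK; last by apply: integrable_fin_num => //; apply: igB; rewrite -inE.
    rewrite [RHS]integral_mkcond; apply: eq_integral => y _.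
    by rewrite /h !patchE in_setX xA.
  by rewrite /= -[RHS](@integral0_eq _ _ _ m2 setT (fun y => h (x, y)))// => y _; rewrite /h patchE in_setX (negbTE xA).
- rewrite -integral21_prod_meas1// Rintegral_mkcond /Rintegral; congr fine.
  apply: eq_integral => y _; rewrite patchE; case: ifPn => yB.
    rewrite fineK; last by apply: integrable_fin_num => //; apply: igA; rewrite -inE.
    rewrite [RHS]integral_mkcond; apply: eq_integral => x _.
    by rewrite /h !patchE in_setX yB andbT.
  by rewrite /= -[RHS](@integral0_eq _ _ _ m1 setT (fun x => h (x, y)))// => x _; rewrite /h patchE in_setX (negbTE yB) andbF.
Qed.

Lemma continuous_to_rV (R : realType) (S : topologicalType) n (g : S -> 'rV[R]_n) :
  (forall j, continuous (fun s => g s 0 j)) -> continuous g.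
Proof.
move=> cg s A [P Ps PA].
have : \forall s' \near s, forall k : 'I_1 * 'I_n, P k.1 k.2 (g s' k.1 k.2).
  apply: filter_forall => -[i j] /=; rewrite (ord1 i); apply: (cg j s).
  by have := Ps i j; rewrite (ord1 i).
by apply: filterS => s' Ps'; apply: PA => i j; exact: (Ps' (i, j)).
Qed.

Lemma continuous_row_of_triple (R : realType) : continuous (@row_of_triple R).
Proof.
apply: continuous_to_rV => j.
have E : (fun z : R * R * R => row_of_triple z 0 j) =
         (fun z => nth 0 [:: z.1.1; z.1.2; z.2] j).
  by apply/funext => z; rewrite mxE.
rewrite E => z.
case: j {E} => -[|[|[|//]]] /= _.
- by apply: cvg_comp; [exact: cvg_fst|exact: cvg_fst].
- by apply: cvg_comp; [exact: cvg_fst|exact: cvg_snd].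
- exact: cvg_snd.
Qed.

Section torus_int_basic.
Variable R : realType.
Local Notation X := 'rV[R]_3.
Local Notation mu := (@lebesgue_measure R).
Local Notation mu3 := ((mu \x mu) \x mu)%E.
Implicit Types f g : X -> R.

Lemma measurable_torus_cell : measurable (@torus_cell R).
Proof. by apply: measurableX; [apply: measurableX|]; exact: measurable_itv. Qed.

Lemma lebesgue_measure01 : mu `[0, 1]%classic = 1%E.
Proof. by rewrite lebesgue_measure_itv /= lte_fin ltr01 -EFinB subr0. Qed.

Lemma torus_cell_measure1 : mu3 (@torus_cell R) = 1%E.
Proof.
have m01 : measurable (`[0, 1]%classic : set R) by exact: measurable_itv.
rewrite /torus_cell.
have := @product_measure1E _ _ _ _ R (mu \x mu)%E mu (`[0, 1] `*` `[0, 1]) `[0, 1]%classic ltac:(exact: measurableX) m01.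
move=> ->; have := @product_measure1E _ _ _ _ R mu mu `[0, 1]%classic `[0, 1]%classic m01 m01.
by move=> /= ->; rewrite lebesgue_measure01 !mul1e.
Qed.

Lemma compact_torus_cell : compact (@torus_cell R).
Proof.
by apply: compact_setX; [apply: compact_setX|]; exact: segment_compact.
Qed.

Lemma compact_bounded (S : topologicalType) (A : set S) (g : S -> R) :
  compact A -> continuous g -> exists2 M, 0 < M & forall s, A s -> `|g s| <= M.
Proof.
move=> cA cg; have [->|/set0P A0] := eqVneq A set0; first by exists 1.
have [c Ac cmax] : exists2 c, c \in A & forall t, t \in A -> `|g t| <= `|g c|.
  apply: compact_EVT_max => //; apply: continuous_subspaceT => s.
  by apply: continuous_comp; [exact: cg|exact: norm_continuous].
exists (`|g c| + 1) => [|s As]; first by rewrite ltr_wpDl.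
by rewrite (le_trans (cmax s _)) ?inE// lerDl.
Qed.

Lemma integrable_torus f : continuous f ->
  mu3.-integrable (@torus_cell R) (EFin \o (f \o @row_of_triple R)).
Proof.
move=> cf; apply: measurable_bounded_integrable.
- exact: measurable_torus_cell.
- by rewrite [ltLHS]torus_cell_measure1 ltry.
- apply: measurable_funTS; apply: continuous_measurable3 => z.
  by apply: continuous_comp; [exact: continuous_row_of_triple|exact: cf].
- have [M M0 fM] := @compact_bounded _ _ (f \o @row_of_triple R) compact_torus_cell
    ltac:(move=> z; apply: continuous_comp; [exact: continuous_row_of_triple|exact: cf]).
  exists M; split; first exact: num_real.
  by move=> r Mr z cz /=; rewrite (le_trans (fM z cz))// ltW.
Qed.

Lemma eq_torus_int f g : f =1 g -> torus_int f = torus_int g.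
Proof. by move=> /funext ->. Qed.

Lemma torus_intD f g : continuous f -> continuous g ->
  torus_int (fun x => f x + g x) = torus_int f + torus_int g.
Proof.
move=> cf cg; rewrite /torus_int RintegralD//; first exact: measurable_torus_cell.
- exact: integrable_torus.
- exact: integrable_torus.
Qed.

Lemma torus_intZ k f : continuous f ->
  torus_int (fun x => k * f x) = k * torus_int f.
Proof.
move=> cf; rewrite /torus_int RintegralZl//; first exact: measurable_torus_cell.
exact: integrable_torus.
Qed.

Lemma torus_intN f : continuous f -> torus_int (fun x => - f x) = - torus_int f.
Proof.
by move=> cf; rewrite -mulN1r -torus_intZ//; apply: eq_torus_int => x; rewrite mulN1r.
Qed.

Lemma torus_intB f g : continuous f -> continuous g ->
  torus_int (fun x => f x - g x) = torus_int f - torus_int g.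
Proof.
move=> cf cg; rewrite torus_intD ?torus_intN// => x.
exact/continuousN/cg.
Qed.

Lemma torus_int_cst k : torus_int (fun _ : X => k) = k.
Proof.
rewrite /torus_int Rintegral_cst; last exact: measurable_torus_cell.
by rewrite [X in fine X]torus_cell_measure1 mulr1.
Qed.

Lemma torus_int_sum (I : Type) (r : seq I) (F : I -> X -> R) :
  (forall i, continuous (F i)) ->
  torus_int (fun x => \sum_(i <- r) F i x) = \sum_(i <- r) torus_int (F i).
Proof.
move=> cF; elim: r => [|i r IH].
  by rewrite big_nil -[RHS](torus_int_cst 0); apply: eq_torus_int => x; rewrite big_nil.
rewrite big_cons -IH -torus_intD//.
  by apply: eq_torus_int => x; rewrite big_cons.
exact: cont_sum.
Qed.

Definition in_cell (x : X) := forall j, 0 <= x 0 j <= 1.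

Lemma row_of_triple_cell z : @torus_cell R z -> in_cell (row_of_triple z).
Proof.
move=> [[/= z1 z2] z3] j; rewrite mxE; case: j => -[|[|[|//]]] /= _.
- by move: z1; rewrite in_itv.
- by move: z2; rewrite in_itv.
- by move: z3; rewrite in_itv.
Qed.

Lemma row_of_tripleP x : in_cell x -> exists2 z, @torus_cell R z & x = row_of_triple z.
Proof.
move=> cx; exists ((x 0 (inord 0), x 0 (inord 1)), x 0 (inord 2)).
  by split; [split|]; rewrite /= in_itv; exact: cx.
apply/rowP => j; rewrite mxE; case: j => -[|[|[|//]]] j3 /=; congr (x 0 _);
  by apply/val_inj; rewrite /= inordK.
Qed.

Lemma le_torus_int_cell f g : continuous f -> continuous g ->
  (forall x, in_cell x -> f x <= g x) -> torus_int f <= torus_int g.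
Proof.
move=> cf cg fg; apply: le_Rintegral; first exact: measurable_torus_cell.
- exact: integrable_torus.
- exact: integrable_torus.
- by move=> z cz; apply: fg; exact: row_of_triple_cell.
Qed.

Lemma le_torus_int f g : continuous f -> continuous g ->
  (forall x, f x <= g x) -> torus_int f <= torus_int g.
Proof. by move=> cf cg fg; apply: le_torus_int_cell. Qed.

Lemma torus_int_ge0 f : (forall x, 0 <= f x) -> 0 <= torus_int f.
Proof. by move=> f0; apply: Rintegral_ge0. Qed.

End torus_int_basic.

(** * Averages in one variable *)

Lemma uniform_on_compact (R : realType) (S Y : topologicalType) (K : set Y)
  (g : S * Y -> R) (s0 : S) (e : R) : compact K -> continuous g -> 0 < e ->
  \forall s \near s0, forall y, K y -> `|g (s, y) - g (s0, y)| < e.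
Proof.
move=> /compact_near_coveringP cK cg e0.
have := cK S (nbhs s0) (fun s y => `|g (s, y) - g (s0, y)| < e).
apply => y Ky.
have c1 : continuous (fun z : S * Y => g z - g (s0, z.2)).
  move=> z; apply: cvgB; first exact: cg.
  apply: (@continuous_comp _ _ _ (fun z : S * Y => (s0, z.2)) g); last exact: cg.
  by apply: cvg_pair; [exact: cvg_cst|exact: cvg_snd].
have := c1 (s0, y); rewrite /continuous_at /= subrr => /cvgr0_norm_lt -/(_ e e0).
have : forall (P : S * Y -> Prop) , nbhs (s0, y) P -> \forall x' \near y & i \near s0, P (i, x').
  move=> P [[A B] /= [nA nB] AB]; exists (B, A) => // -[y' s'] /= [By As]; exact: AB.
by apply.
Qed.

(** Near s0 the integrand is uniformly close to its value at s0, by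
    compactness of the domain. *)
Lemma continuous_param_Rintegral d (Y' : measurableType d) (R : realType)
  (S Y : topologicalType) (q : Y' -> Y) (m : {measure set Y' -> \bar R})
  (K' : set Y') (K : set Y) (g : S * Y -> R) :
  compact K -> continuous g -> (forall y, K' y -> K (q y)) ->
  measurable K' -> m K' = 1%E ->
  (forall s, m.-integrable K' (EFin \o (fun y => g (s, q y)))) ->
  continuous (fun s => Rintegral m K' (fun y => g (s, q y))).
Proof.
move=> cK cg qK mK mK1 ig s0; apply/cvgrPdist_le => e e0.
have := @uniform_on_compact R S Y K g s0 e cK cg e0.
apply: filterS => s sP.
rewrite distrC -RintegralB//.
have iB : m.-integrable K' (EFin \o (fun y => g (s, q y) - g (s0, q y))).
  have := integrableB mK (ig s) (ig s0); apply: eq_integrable => //.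
rewrite (le_trans (le_normr_Rintegral mK iB))//.
have -> : e = Rintegral m K' (fun=> e) by rewrite Rintegral_cst// mK1 mulr1.
apply: le_Rintegral => //.
- exact: integrable_norm.
- apply: measurable_bounded_integrable => //; last exact: bounded_cst.
  by rewrite mK1 ltry.
- by move=> y Ky; apply/ltW/sP/qK.
Qed.

Section averages.
Variable R : realType.
Local Notation X := 'rV[R]_3.
Local Notation mu := (@lebesgue_measure R).
Implicit Types (f g : X -> R) (j : 'I_3).

Definition upd (x : X) j (s : R) : X := \row_i (if i == j then s else x 0 i).

Lemma upd_upd x j s s' : upd (upd x j s) j s' = upd x j s'.
Proof. by apply/rowP => i; rewrite !mxE; case: eqP. Qed.

Lemma upd_id x j : upd x j (x 0 j) = x.
Proof. by apply/rowP => i; rewrite mxE; case: (eqVneq i j) => [->|]. Qed.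

Lemma updC x j k s r : j != k -> upd (upd x j s) k r = upd (upd x k r) j s.
Proof.
move=> jk; apply/rowP => i; rewrite !mxE.
case: (eqVneq i k) => [->|//]; by rewrite eq_sym (negbTE jk).
Qed.

Lemma upd_shift x j s h : upd x j (h + s) = h *: delta_mx 0 j + upd x j s.
Proof.
apply/rowP => i; rewrite !mxE eqxx /=.
by case: (eqVneq i j) => [_|ij]; rewrite ?mulr1 ?mulr0 ?add0r.
Qed.

Lemma continuous_upd j : continuous (fun z : X * R => upd z.1 j z.2).
Proof.
apply: continuous_to_rV => i; have [->|ij] := eqVneq i j.
  by under eq_fun do rewrite mxE eqxx; move=> z; exact: cvg_snd.
under eq_fun do rewrite mxE (negbTE ij).
move=> z; apply: (@continuous_comp _ _ _ fst (fun x : X => x 0 i)); first exact: cvg_fst.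
exact: coord_continuous.
Qed.

Lemma continuous_upd_comp f j : continuous f ->
  continuous (fun z : X * R => f (upd z.1 j z.2)).
Proof.
move=> cf z; apply: (@continuous_comp _ _ _ (fun z : X * R => upd z.1 j z.2) f).
  exact: continuous_upd.
exact: cf.
Qed.

Lemma continuous_slice f x j : continuous f -> continuous (fun s => f (upd x j s)).
Proof.
move=> cf s; apply: (@continuous_comp _ _ _ (fun s => (x, s)) (fun z : X * R => f (upd z.1 j z.2))).
  exact: (@cvg_pair R X R (nbhs s) (nbhs x) (nbhs s) _ _ _ (fun=> x) id (cvg_cst x) cvg_id).
exact: continuous_upd_comp.
Qed.

Lemma integrable01 (h : R -> R) : continuous h ->
  mu.-integrable `[0, 1] (EFin \o h).
Proof.
move=> ch; apply: continuous_compact_integrable; first exact: segment_compact.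
exact: continuous_subspaceT.
Qed.

(** Integrating out one coordinate at a time, as a function that still depends
    (trivially) on all three, avoids lower-dimensional tori. *)
Definition avg j f (x : X) : R := Rintegral mu `[0, 1] (fun s => f (upd x j s)).

Lemma avg_cst j f x k : (forall s, 0 <= s <= 1 -> f (upd x j s) = k) -> avg j f x = k.
Proof.
move=> fk; rewrite /avg (@eq_Rintegral _ _ _ _ _ (fun=> k)).
  by rewrite Rintegral_cst ?measurable_itv// [X in fine X]lebesgue_measure01 mulr1.
by move=> s; rewrite inE /= in_itv /= => /fk.
Qed.

Lemma continuous_avg j f : continuous f -> continuous (avg j f).
Proof.
move=> cf.
have := @continuous_param_Rintegral _ (measurableTypeR R) R X R (fun s : R => s) mu `[0,1]%classic
  `[0,1]%classic (fun z : X * R => f (upd z.1 j z.2)); apply => //.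
- exact: segment_compact.
- exact: continuous_upd_comp.
- exact: lebesgue_measure01.
- by move=> x; apply: integrable01; exact: continuous_slice.
Qed.

Lemma avg_upd j f x s : avg j f (upd x j s) = avg j f x.
Proof. by rewrite /avg; under eq_Rintegral do rewrite upd_upd. Qed.

Lemma le_avg j f g x : continuous f -> continuous g ->
  (forall s, 0 <= s <= 1 -> f (upd x j s) <= g (upd x j s)) -> avg j f x <= avg j g x.
Proof.
move=> cf cg fg; apply: le_Rintegral; first exact: measurable_itv.
- by apply: integrable01; exact: continuous_slice.
- by apply: integrable01; exact: continuous_slice.
- by move=> s; rewrite /= in_itv /= => /fg.
Qed.

Lemma avgD j f g x : continuous f -> continuous g ->
  avg j (fun x => f x + g x) x = avg j f x + avg j g x.
Proof.
move=> cf cg; apply: RintegralD; first exact: measurable_itv.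
- by apply: integrable01; exact: continuous_slice.
- by apply: integrable01; exact: continuous_slice.
Qed.

Lemma avgZ j k f x : continuous f -> avg j (fun x => k * f x) x = k * avg j f x.
Proof.
move=> cf; apply: RintegralZl; first exact: measurable_itv.
by apply: integrable01; exact: continuous_slice.
Qed.

Lemma is_derive_slice f x j s : derivable f (upd x j s) (delta_mx 0 j) ->
  is_derive s 1 (fun s => f (upd x j s)) (pd j f (upd x j s)).
Proof.
move=> df.
have E : (fun h : R => h^-1 *: (f (upd x j (h *: (1 : R) + s)) - f (upd x j s))) =
  (fun h : R => h^-1 *: (f (h *: delta_mx 0 j + upd x j s) - f (upd x j s))).
  by apply/funext => h; rewrite -upd_shift [_%:A]mulr1.
split; first by rewrite /derivable [X in cvg (X @ _)]E; exact: df.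
by rewrite /pd /derive [X in lim (X @ _)]E.
Qed.

Lemma slice_FTC f x j (a b : R) : a < b ->
  (forall x, derivable f x (delta_mx 0 j)) -> continuous (pd j f) ->
  Rintegral mu `[a, b] (fun s => pd j f (upd x j s)) = f (upd x j b) - f (upd x j a).
Proof.
move=> ab df cdf.
rewrite /Rintegral (@continuous_FTC2 _ _ (fun s => f (upd x j s)))//.
- by apply: continuous_subspaceT; exact: continuous_slice.
- have dd s : derivable (fun s => f (upd x j s)) s 1.
    by have [] := is_derive_slice (df (upd x j s)).
  have cc s : {for s, continuous (fun s => f (upd x j s))}.
    by apply: differentiable_continuous; exact/derivable1_diffP.
  split=> //.
  + by apply: cvg_at_right_filter; exact: cc.
  + by apply: cvg_at_left_filter; exact: cc.
- move=> s _; rewrite derive1E.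
  by have [_ <-] := is_derive_slice (df (upd x j s)).
Qed.

End averages.

(** * Iterated integrals over the torus *)

Section area.
Variable R : realType.
Local Notation mu := (@lebesgue_measure R).

(** A name for the plane Lebesgue measure, under which it is registered as
    sigma-finite: Fubini with a third factor asks for it. *)
Definition area : set (measurableTypeR R * measurableTypeR R) -> \bar R :=
  (mu \x mu)%E.

HB.instance Definition _ := Measure.on area.

Let area_sigma_finite : sigma_finite setT area.
Proof.
have /sigma_finiteP[F [TF ndF Foo]] := sigma_finiteT mu.
exists (fun n => F n `*` F n).
  apply/seteqP; split => // -[x y] _.
  have := (I : [set: measurableTypeR R] x); rewrite TF => -[n _ Fnx].
  have := (I : [set: measurableTypeR R] y); rewrite TF => -[k _ Fky].
  exists (maxn n k) => //; split => /=.
    by move: Fnx; exact/subsetPset/ndF/leq_maxl.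
  by move: Fky; exact/subsetPset/ndF/leq_maxr.
move=> k; have [mF Fk] := Foo k; split; first exact: measurableX.
have := @product_measure1E _ _ _ _ R mu mu (F k) (F k) mF mF.
by rewrite /area => ->; rewrite lte_mul_pinfty// ge0_fin_numE.
Qed.

HB.instance Definition _ := Measure_isSigmaFinite.Build _ _ _ area
  area_sigma_finite.

End area.

Section torus_fubini.
Variable R : realType.
Local Notation X := 'rV[R]_3.
Local Notation mu := (@lebesgue_measure R).
Local Notation mu3 := ((mu \x mu) \x mu)%E.
Implicit Types (f g : X -> R) (j : 'I_3).

Let I01 : set R := `[0, 1]%classic.
Let mI : measurable I01. Proof. exact: measurable_itv. Qed.
Let mII : measurable (I01 `*` I01). Proof. exact: measurableX. Qed.

Let rt (x y z : R) : X := row_of_triple (x, y, z).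

Let cont_rt f : continuous f -> continuous (f \o @row_of_triple R).
Proof.
move=> cf z; apply: continuous_comp; [exact: continuous_row_of_triple|exact: cf].
Qed.

Let bnd f : continuous f -> exists2 M, 0 < M & forall z, @torus_cell R z -> `|f (row_of_triple z)| <= M.
Proof. by move=> cf; apply: compact_bounded (@compact_torus_cell R) (cont_rt cf). Qed.

Lemma integrable_pair f z : continuous f -> I01 z ->
  (mu \x mu)%E.-integrable (I01 `*` I01) (EFin \o (fun xy => f (rt xy.1 xy.2 z))).
Proof.
move=> cf z01; apply: measurable_bounded_integrable => //.
- rewrite [ltLHS](_ : _ = 1%E) ?ltry//.
  by rewrite [LHS]product_measure1E//= !lebesgue_measure01 mule1.
- apply: measurable_funTS.
  have mf := continuous_measurable3 (cont_rt cf).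
  apply: (measurableT_comp mf (g := fun xy : measurableTypeR R * measurableTypeR R => (xy.1, xy.2, z))).
  by apply: measurable_fun_pair => //; apply: measurable_fun_pair.
- have [M M0 fM] := bnd cf.
  exists M; split; first exact: num_real.
  move=> r Mr [x y] /= [/= x01 y01] /=. by rewrite (le_trans (fM (x, y, z) _))// ltW.
Qed.

Lemma cont_rt1 f y z : continuous f -> continuous (fun x => f (rt x y z)).
Proof.
move=> cf x; apply: (@continuous_comp _ _ _ (fun x => (x, y, z)) (f \o @row_of_triple R)); last exact: cont_rt.
by apply: continuous_mkpair; [apply: continuous_mkpair|]; move=> ?; [exact: cvg_id|exact: cvg_cst..].
Qed.

Lemma cont_rt2 f x z : continuous f -> continuous (fun y => f (rt x y z)).
Proof.
move=> cf y; apply: (@continuous_comp _ _ _ (fun y => (x, y, z)) (f \o @row_of_triple R)); last exact: cont_rt.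
by apply: continuous_mkpair; [apply: continuous_mkpair|]; move=> ?; [exact: cvg_cst|exact: cvg_id|exact: cvg_cst].
Qed.

Lemma cont_rt3 f x y : continuous f -> continuous (fun z => f (rt x y z)).
Proof.
move=> cf z; apply: (@continuous_comp _ _ _ (fun z => (x, y, z)) (f \o @row_of_triple R)); last exact: cont_rt.
by apply: continuous_mkpair; move=> ?; [exact: cvg_cst|exact: cvg_id].
Qed.

Lemma torus_int_iter f : continuous f ->
  [/\ torus_int f = Rintegral (mu \x mu)%E (I01 `*` I01)
        (fun xy => Rintegral mu I01 (fun z => f (rt xy.1 xy.2 z))),
      torus_int f = Rintegral mu I01 (fun z => Rintegral mu I01 (fun x =>
        Rintegral mu I01 (fun y => f (rt x y z)))) &
      torus_int f = Rintegral mu I01 (fun z => Rintegral mu I01 (fun y =>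
        Rintegral mu I01 (fun x => f (rt x y z))))].
Proof.
move=> cf.
have [E1 E2] := @Rintegral_fubini _ _ (measurableTypeR R * measurableTypeR R)%type (measurableTypeR R) R (@area R) mu (I01 `*` I01) I01
  (f \o @row_of_triple R) mII mI (integrable_torus cf)
  (fun xy _ => integrable01 (@cont_rt3 f xy.1 xy.2 cf))
  (fun z z01 => integrable_pair cf z01).
have E3 z : I01 z -> _ := fun z01 => @Rintegral_fubini _ _ (measurableTypeR R) (measurableTypeR R) R mu mu I01 I01
  (fun xy => f (rt xy.1 xy.2 z)) mI mI (integrable_pair cf z01)
  (fun x _ => integrable01 (@cont_rt2 f x z cf))
  (fun y _ => integrable01 (@cont_rt1 f y z cf)).
split.
- exact: E1.
- apply: (etrans E2); apply: eq_Rintegral => z; rewrite inE => /E3 [E _].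
  exact: E.
- apply: (etrans E2); apply: eq_Rintegral => z; rewrite inE => /E3 [_ E].
  exact: E.
Qed.

(** Choose the order of integration in which the variable j comes innermost.
    *)
Lemma torus_int_avg j f : continuous f -> torus_int (avg j f) = torus_int f.
Proof.
move=> cf; have [A1 A2 A3] := torus_int_iter (continuous_avg (j := j) cf).
have [B1 B2 B3] := torus_int_iter cf.
have cst k : Rintegral mu I01 (fun=> k) = k.
  by rewrite Rintegral_cst// [X in fine X]lebesgue_measure01 mulr1.
have E0 x y z s : upd (rt x y z) ord0 s = rt s y z.
  by apply/rowP => -[[|[|[|//]]] i3]; rewrite !mxE.
have E1 x y z s : upd (rt x y z) (lift ord0 ord0) s = rt x s z.
  by apply/rowP => -[[|[|[|//]]] i3]; rewrite !mxE.
have E2 x y z s : upd (rt x y z) ord_max s = rt x y s.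
  by apply/rowP => -[[|[|[|//]]] i3]; rewrite !mxE.
have [->|[->|->]] : j = ord0 \/ j = lift ord0 ord0 \/ j = ord_max.
  case: j {A1 A2 A3} => -[|[|[|//]]] i3; [left|right; left|right; right];
  exact/val_inj.
- have [_ _ ->] := torus_int_iter (continuous_avg (j := ord0) cf); rewrite B3.
  apply: eq_Rintegral => z _; apply: eq_Rintegral => y _.
  rewrite -[RHS]cst; apply: eq_Rintegral => x _.
  by rewrite /avg; apply: eq_Rintegral => s _; rewrite E0.
- have [_ -> _] := torus_int_iter (continuous_avg (j := lift ord0 ord0) cf); rewrite B2.
  apply: eq_Rintegral => z _; apply: eq_Rintegral => x _.
  rewrite -[RHS]cst; apply: eq_Rintegral => y _.
  by rewrite /avg; apply: eq_Rintegral => s _; rewrite E1.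
- have [-> _ _] := torus_int_iter (continuous_avg (j := ord_max) cf); rewrite B1.
  apply: eq_Rintegral => xy _.
  rewrite -[RHS]cst; apply: eq_Rintegral => z _.
  by rewrite /avg; apply: eq_Rintegral => s _; rewrite E2.
Qed.

(** Along each line in direction j, f returns to its value after one period.
    *)
Lemma torus_int_pd j f : Defs.periodic f -> (forall x, derivable f x (delta_mx 0 j)) ->
  continuous (pd j f) -> torus_int (pd j f) = 0.
Proof.
move=> pf df cdf; rewrite -(torus_int_avg j)// -[RHS](torus_int_cst 0).
apply: eq_torus_int => x; rewrite /avg slice_FTC//.
have -> : upd x j 1 = upd x j 0 + delta_mx 0 j.
  by rewrite -{1}[1]addr0 upd_shift scale1r addrC.
by rewrite pf subrr.
Qed.

End torus_fubini.

(** * The Poincare inequality *)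

Section poincare.
Variable R : realType.
Local Notation X := 'rV[R]_3.
Local Notation mu := (@lebesgue_measure R).
Implicit Types (f g Psi : X -> R) (j k : 'I_3).

Lemma sqr_avg_le j f x : continuous f ->
  avg j f x ^+ 2 <= avg j (fun y => f y ^+ 2) x.
Proof.
move=> cf; set m := avg j f x.
have h0 : 0 <= avg j (fun y => (f y ^+ 2 + (- 2 * m) * f y) + m ^+ 2) x.
  rewrite -[leLHS](@avg_cst R j (fun=> 0) x 0)//.
  apply: le_avg => // [||s _]; [by cont..|].
  by have := sqr_ge0 (f (upd x j s) - m); congr (_ <= _); ring.
move: h0; rewrite !avgD; [|by cont..].
rewrite avgZ// -/m (@avg_cst R j (fun=> m ^+ 2) x (m ^+ 2))// expr2; nra.
Qed.

(** Unlike a bound on the derivative, a bound on the oscillation passes to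
    averages over the other variables ([osc_le_avg]) without differentiating
    under the integral. *)
Definition osc_le j g Psi := forall x s r, 0 <= s <= 1 -> 0 <= r <= 1 ->
  (g (upd x j s) - g (upd x j r)) ^+ 2 <= Psi x.

(** The average over both points of the squared difference is twice the
    variance. *)
Lemma osc_le_avg_sqr j g Psi x : continuous g -> osc_le j g Psi ->
  avg j (fun y => g y ^+ 2) x <= avg j g x ^+ 2 + Psi x.
Proof.
move=> cg osc; set m := avg j g x; set q := avg j _ x.
have H s : 0 <= s <= 1 -> g (upd x j s) ^+ 2 + (- 2 * m) * g (upd x j s) + q <= Psi x.
  move=> s01; pose c := g (upd x j s).
  have : avg j (fun y => g y ^+ 2 + (- 2 * c) * g y + c ^+ 2) x <= avg j (fun=> Psi x) x.
    apply: le_avg => [||r r01]; [by cont..|].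
    apply: le_trans (osc x s r s01 r01).
    by rewrite le_eqVlt; apply/orP; left; apply/eqP; rewrite /c; ring.
  rewrite !avgD; [|by cont..].
  rewrite (avgZ j (- 2 * c) x cg) -/m -/q (@avg_cst R j (fun=> Psi x) x (Psi x))//.
  rewrite (@avg_cst R j (fun=> c ^+ 2) x (c ^+ 2))// -/c; nra.
have : avg j (fun y => g y ^+ 2 + (- 2 * m) * g y + q) x <= avg j (fun=> Psi x) x.
  by apply: le_avg => [||r r01]; [by cont..|exact: H].
rewrite !avgD; [|by cont..].
rewrite (avgZ j (- 2 * m) x cg) -/m -/q (@avg_cst R j (fun=> Psi x) x (Psi x))//.
rewrite (@avg_cst R j (fun=> q) x q)// expr2.
have : m ^+ 2 <= q by exact: sqr_avg_le.
rewrite expr2; nra.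
Qed.

Lemma osc_le_torus_int j g Psi : continuous g -> continuous Psi -> osc_le j g Psi ->
  torus_int (fun x => g x ^+ 2) <=
  torus_int (fun x => avg j g x ^+ 2) + torus_int Psi.
Proof.
move=> cg cP osc; have ca := continuous_avg (j := j) cg.
rewrite -(torus_int_avg j (f := fun x => g x ^+ 2)); last by cont.
rewrite -torus_intD; [|by cont..].
apply: le_torus_int; [|by cont|by move=> x; exact: osc_le_avg_sqr].
by apply: continuous_avg; cont.
Qed.

Lemma osc_le_avg j k g Psi : j != k -> continuous g -> continuous Psi ->
  osc_le j g Psi -> osc_le j (avg k g) (avg k Psi).
Proof.
move=> jk cg cP osc x s r s01 r01.
have cu t : continuous (fun y => g (upd y j t)).
  move=> y; apply: (@continuous_comp _ _ _ (fun y => (y, t)) (fun z : X * R => g (upd z.1 j z.2))).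
    by apply: continuous_mkpair => [y'|]; [exact: cvg_id|exact: cont_cst].
  exact: continuous_upd_comp.
have E t : avg k g (upd x j t) = avg k (fun y => g (upd y j t)) x.
  by rewrite /avg; apply: eq_Rintegral => z _; rewrite updC.
rewrite !E.
have -> : avg k (fun y => g (upd y j s)) x - avg k (fun y => g (upd y j r)) x =
   avg k (fun y => g (upd y j s) + (-1) * g (upd y j r)) x.
  by rewrite avgD ?avgZ//; [rewrite mulN1r|cont].
apply: le_trans (@sqr_avg_le k _ x _) _; first by cont.
apply: le_avg => [||t t01]; [by cont..|].
by rewrite mulN1r; exact: osc.
Qed.

(** Write the increment as the integral of the derivative and apply Jensen. *)
Lemma osc_le_pd j f : continuous f -> (forall x, derivable f x (delta_mx 0 j)) ->
  continuous (pd j f) -> osc_le j f (avg j (fun x => pd j f x ^+ 2)).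
Proof.
move=> cf df cdf.
suff H x s r : 0 <= s -> s < r -> r <= 1 ->
    (f (upd x j r) - f (upd x j s)) ^+ 2 <= avg j (fun x => pd j f x ^+ 2) x.
  move=> x s r /andP[s0 s1] /andP[r0 r1].
  have [sr|rs|->] := ltgtP s r; last first.
  - rewrite subrr expr0n /= -[leLHS](@avg_cst R j (fun=> 0) x 0)//.
    by apply: le_avg => [||t _]; [by cont..|exact: sqr_ge0].
  - exact: H.
  - by rewrite -sqrrN opprB; exact: H.
move=> s0 sr r1; rewrite -slice_FTC//.
set h := fun t => pd j f (upd x j t).
have ch : continuous h by exact: continuous_slice.
have ih : mu.-integrable `[0, 1] (EFin \o h) by exact: integrable01.
have sub : `[s, r]%classic `<=` `[0, 1]%classic.
  move=> t /=; rewrite !in_itv /= => /andP[st tr].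
  by rewrite (le_trans s0)//= (le_trans tr).
have ih' : mu.-integrable `[s, r] (EFin \o h).
  by apply: integrableS ih => //; exact: measurable_itv.
have N1 : `|Rintegral mu `[s, r] h| <= avg j (fun y => `|pd j f y|) x.
  apply: le_trans (le_normr_Rintegral _ ih') _; first exact: measurable_itv.
  rewrite /avg /Rintegral fine_le//.
  - apply: integrable_fin_num; first exact: measurable_itv.
    exact: (integrable_norm ih').
  - apply: integrable_fin_num; first exact: measurable_itv.
    exact: (integrable_norm ih).
  apply: ge0_subset_integral => //; try exact: measurable_itv.
  apply/measurable_realfun.measurable_EFinP/measurable_funTS; apply: measurable_realfun.continuous_measurable_fun.
  by cont.
rewrite -real_normK ?num_real//.
have c1 : continuous (fun y => `|pd j f y|) by cont.
apply: le_trans (_ : avg j (fun y => `|pd j f y|) x ^+ 2 <= _).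
  by rewrite ler_sqr ?nnegrE// (le_trans _ N1).
apply: le_trans (sqr_avg_le j x c1) _.
rewrite le_eqVlt; apply/orP; left; apply/eqP; congr (avg j _ x).
by apply/funext => y; rewrite real_normK ?num_real.
Qed.

Lemma avg_inv j k g : j != k -> (forall x s, g (upd x k s) = g x) ->
  forall x s, avg j g (upd x k s) = avg j g x.
Proof.
move=> jk gk x s; rewrite /avg; apply: eq_Rintegral => t _.
by rewrite -updC// gk.
Qed.

(** Average out the three variables in turn. Each step loses the square
    integral of one partial derivative, and the final average is the mean. *)
Theorem poincare f : continuous f ->
  (forall j x, derivable f x (delta_mx 0 j)) -> (forall j, continuous (pd j f)) ->
  torus_int (fun x => f x ^+ 2) <=
  torus_int f ^+ 2 + \sum_j torus_int (fun x => pd j f x ^+ 2).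
Proof.
move=> cf df cdf.
pose i0 : 'I_3 := ord0; pose i1 : 'I_3 := lift ord0 ord0; pose i2 : 'I_3 := ord_max.
pose P j : X -> R := avg j (fun x => pd j f x ^+ 2).
have cP j : continuous (P j) by apply: continuous_avg; cont.
have TP j : torus_int (P j) = torus_int (fun x => pd j f x ^+ 2).
  by rewrite torus_int_avg; cont.
have oP j : osc_le j f (P j) by exact: osc_le_pd.
have cf2 : continuous (avg i2 f) by exact: continuous_avg.
have cf1 : continuous (avg i1 (avg i2 f)) by exact: continuous_avg.
have o1 : osc_le i1 (avg i2 f) (avg i2 (P i1)).
  exact: (@osc_le_avg i1 i2 f (P i1) isT cf (cP i1) (oP i1)).
have cP0 : continuous (avg i2 (P i0)) by exact: continuous_avg.
have o0' : osc_le i0 (avg i2 f) (avg i2 (P i0)).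
  exact: (@osc_le_avg i0 i2 f (P i0) isT cf (cP i0) (oP i0)).
have o0 : osc_le i0 (avg i1 (avg i2 f)) (avg i1 (avg i2 (P i0))).
  exact: (@osc_le_avg i0 i1 _ _ isT cf2 cP0 o0').
pose m := avg i0 (avg i1 (avg i2 f)).
have mE x : m x = torus_int f.
  have m0 y s : m (upd y i0 s) = m y by exact: avg_upd.
  have m1 y s : m (upd y i1 s) = m y by apply: (@avg_inv i0 i1) => [//|z t]; exact: avg_upd.
  have m2 y s : m (upd y i2 s) = m y.
    by apply: (@avg_inv i0 i2) => [//|z t]; apply: (@avg_inv i1 i2) => [//|z' t']; exact: avg_upd.
  have mx y : m y = m x.
    rewrite -(m0 y (x 0 i0)) -(m1 _ (x 0 i1)) -(m2 _ (x 0 i2)); congr m.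
    by apply/rowP => -[[|[|[|//]]] i3]; rewrite !mxE /=; congr (x 0 _); exact/val_inj.
  have <- : torus_int m = torus_int f.
    by rewrite (torus_int_avg i0 cf1) (torus_int_avg i1 cf2) (torus_int_avg i2 cf).
  by rewrite -[LHS](@torus_int_cst R); apply: eq_torus_int => y; rewrite mx.
rewrite sum_ord3.
have H2 := osc_le_torus_int cf (cP i2) (oP i2).
have H1 := osc_le_torus_int cf2 (continuous_avg (j := i2) (cP i1)) o1.
have H0 := osc_le_torus_int cf1 (continuous_avg (j := i1) (continuous_avg (j := i2) (cP i0))) o0.
rewrite TP in H2.
rewrite (torus_int_avg i2 (cP i1)) TP in H1.
rewrite (torus_int_avg i1 cP0) (torus_int_avg i2 (cP i0)) TP in H0.
have E : torus_int (fun x => avg i0 (avg i1 (avg i2 f)) x ^+ 2) = torus_int f ^+ 2.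
  by rewrite -[RHS](@torus_int_cst R); apply: eq_torus_int => x; rewrite -/(m x) mE.
rewrite E in H0; move: H0 H1 H2; rewrite /i0 /i1 /i2; gen_int; lra.
Qed.

End poincare.

(** * Spatial derivatives *)

Section directional_derivatives.
Variables (R : realType) (V : normedModType R).
Implicit Types (f g : V -> R).

Lemma is_derive_chain (h : R -> R) f x v (a b : R) :
  is_derive (f x) 1 h a -> is_derive x v f b -> is_derive x v (fun y => h (f y)) (a * b).
Proof.
move=> dh df.
have [fd <-] := df.
pose g (t : R) := f (t *: v + x).
have g0 : g 0 = f x by rewrite /g scale0r add0r.
have dg : is_derive (0 : R) (1 : R) g ('D_v f x).
  split; first by have := (derivable1P f x v).1 fd.
  have E : (fun t : R => t^-1 *: (g (t *: (1 : R) + 0) - g 0)) =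
           (fun t : R => t^-1 *: (f (t *: v + x) - f x)).
    by apply/funext => t; rewrite g0 /g addr0 [_%:A]mulr1.
  by rewrite /derive [X in lim (X @ _)]E.
have dh' : is_derive (g 0) (1 : R) h a by rewrite g0.
have [d1 d2] := @is_derive1_comp _ h g 0 _ _ dh' dg.
have E : (fun t : R => t^-1 *: ((h \o g) (t *: (1 : R) + 0) - (h \o g) 0)) =
         (fun t : R => t^-1 *: (h (f (t *: v + x)) - h (f x))).
  by apply/funext => t; rewrite /= g0 /g addr0 [_%:A]mulr1.
split.
- by move: d1; rewrite /derivable /= E.
- by move: d2; rewrite /derive /= E.
Qed.

Lemma is_deriveD_fun f g x v a b : is_derive x v f a -> is_derive x v g b ->
  is_derive x v (fun y => f y + g y) (a + b).
Proof. exact: is_deriveD. Qed.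

Lemma is_deriveM_fun f g x v a b : is_derive x v f a -> is_derive x v g b ->
  is_derive x v (fun y => f y * g y) (f x * b + g x * a).
Proof. exact: is_deriveM. Qed.

Lemma is_deriveN_fun f x v a : is_derive x v f a -> is_derive x v (fun y => - f y) (- a).
Proof. exact: is_deriveN. Qed.

Lemma is_derive_cst_fun (c : R) (x v : V) : is_derive x v (fun=> c) 0.
Proof. exact: is_derive_cst. Qed.

Lemma is_derive_sum_fun (I : Type) (r : seq I) (F : I -> V -> R) (dF : I -> R) x v :
  (forall i, is_derive x v (F i) (dF i)) ->
  is_derive x v (fun y => \sum_(i <- r) F i y) (\sum_(i <- r) dF i).
Proof.
move=> H; elim: r => [|i r IH].
  by rewrite big_nil; under eq_fun do rewrite big_nil; exact: is_derive_cst_fun.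
by rewrite big_cons; under eq_fun do rewrite big_cons; exact: is_deriveD_fun.
Qed.

End directional_derivatives.

Section partial_derivatives.
Variable R : realType.
Local Notation X := 'rV[R]_3.
Local Notation "'e_ j" := (@delta_mx R 1 3 0 j) (at level 8, j at level 2, format "''e_' j").
Implicit Types (f g : X -> R) (j k : 'I_3).

Definition pdable f := forall j x, derivable f x 'e_j.

Lemma is_derive_pd f j x : derivable f x 'e_j -> is_derive x 'e_j f (pd j f x).
Proof. exact: derivableP. Qed.

Lemma pd_val f j x a : is_derive x 'e_j f a -> pd j f x = a.
Proof. by move=> H; rewrite /pd derive_val. Qed.

Lemma is_derive_coord (h : R -> R) (c a : R) (i j : 'I_3) (x : X) :
  is_derive (x 0 i - c) (1 : R) h a ->
  is_derive x 'e_j (fun y => h (y 0 i - c)) (if i == j then a else 0).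
Proof.
move=> dh.
have dc : is_derive x 'e_j (fun y : X => y 0 i - c) (i == j)%:R.
  have E : (fun t : R => t^-1 *: ((t *: 'e_j + x) 0 i - c - (x 0 i - c))) =
     (fun t : R => t^-1 * (t * (i == j)%:R)).
    by apply/funext => t; rewrite !mxE eqxx /= opprB addrA subrK addrK.
  have C : (fun t : R => t^-1 * (t * (i == j)%:R)) t @[t --> 0^'] --> ((i == j)%:R : R).
    apply: cvg_near_cst; near=> t; rewrite mulrA mulVf ?mul1r//.
    near: t; exact: nbhs_dnbhs_neq.
  split; first by rewrite /derivable [X in cvg (X @ _)]E; apply/cvg_ex; exists (i == j)%:R.
  by rewrite /derive [X in lim (X @ _)]E; exact/cvg_lim.
have H := @is_derive_chain R X h (fun y : X => y 0 i - c) x _ _ _ dh dc.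
by apply: (is_derive_eq H); case: eqP => _; rewrite ?mulr1 ?mulr0.
Unshelve. all: by end_near. Qed.

(** The class C^n. *)
Fixpoint Cs n f : Prop := continuous f /\
  if n is m.+1 then pdable f /\ (forall j, Cs m (pd j f)) else True.

Lemma Cs_cont n f : Cs n f -> continuous f.
Proof. by case: n => [|n] [cf _]. Qed.

Lemma Cs_pdable n f : Cs n.+1 f -> pdable f.
Proof. by case=> _ []. Qed.

Lemma Cs_pd n f j : Cs n.+1 f -> Cs n (pd j f).
Proof. by case=> _ [_]; exact. Qed.

Lemma Cs_pd_cont n f j : Cs n.+1 f -> continuous (pd j f).
Proof. by move=> /(@Cs_pd _ _ j)/Cs_cont. Qed.

Lemma CsW n f : Cs n.+1 f -> Cs n f.
Proof.
elim: n f => [|n IH] f; first by case.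
by case=> cf [df Cf]; split => //; split => // j; exact: IH.
Qed.

Lemma pdD f g : pdable f -> pdable g -> forall j,
  pd j (fun x => f x + g x) = (fun x => pd j f x + pd j g x).
Proof.
move=> df dg j; apply/funext => x; apply: pd_val.
by apply: is_deriveD_fun; apply: is_derive_pd; [exact: df|exact: dg].
Qed.

Lemma pdM f g : pdable f -> pdable g -> forall j,
  pd j (fun x => f x * g x) = (fun x => f x * pd j g x + g x * pd j f x).
Proof.
move=> df dg j; apply/funext => x; apply: pd_val.
by apply: is_deriveM_fun; apply: is_derive_pd; [exact: df|exact: dg].
Qed.

Lemma pdN f : pdable f -> forall j, pd j (fun x => - f x) = (fun x => - pd j f x).
Proof.
move=> df j; apply/funext => x; apply: pd_val.
by apply: is_deriveN_fun; apply: is_derive_pd; exact: df.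
Qed.

Lemma pd_cst (c : R) j : pd j (fun=> c) = (fun=> 0).
Proof. by apply/funext => x; apply: pd_val; exact: is_derive_cst_fun. Qed.

Lemma pdable_cst (c : R) : pdable (fun=> c).
Proof. by move=> j x; exact: derivable_cst. Qed.

Lemma pdableD f g : pdable f -> pdable g -> pdable (fun x => f x + g x).
Proof. by move=> df dg j x; exact: derivableD. Qed.

Lemma pdableM f g : pdable f -> pdable g -> pdable (fun x => f x * g x).
Proof. by move=> df dg j x; exact: derivableM. Qed.

Lemma pdableN f : pdable f -> pdable (fun x => - f x).
Proof. by move=> df j x; exact: derivableN. Qed.

Lemma pdZ (c : R) f : pdable f -> forall j,
  pd j (fun x => c * f x) = (fun x => c * pd j f x).
Proof.
move=> df j; rewrite (pdM (@pdable_cst c) df).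
by apply/funext => x; rewrite pd_cst mulr0 addr0.
Qed.

Lemma pdableZ (c : R) f : pdable f -> pdable (fun x => c * f x).
Proof. by move=> df; exact: pdableM (@pdable_cst c) df. Qed.

Lemma pd_sum (I : Type) (r : seq I) (F : I -> X -> R) : (forall i, pdable (F i)) ->
  forall j, pd j (fun x => \sum_(i <- r) F i x) = (fun x => \sum_(i <- r) pd j (F i) x).
Proof.
move=> dF j; apply/funext => x; apply: pd_val.
by apply: is_derive_sum_fun => i; apply: is_derive_pd; exact: dF.
Qed.

Lemma pdable_sum (I : Type) (r : seq I) (F : I -> X -> R) : (forall i, pdable (F i)) ->
  pdable (fun x => \sum_(i <- r) F i x).
Proof.
move=> dF j x.
by have [] := @is_derive_sum_fun R X I r F (fun i => pd j (F i) x) x 'e_j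
  (fun i => is_derive_pd (dF i j x)).
Qed.

Lemma Cs_cst n (c : R) : Cs n (fun=> c).
Proof.
elim: n c => [|n IH] c; split => //; try exact: cont_cst.
by split => [|j]; [exact: pdable_cst|rewrite pd_cst; exact: IH].
Qed.

Lemma CsD n f g : Cs n f -> Cs n g -> Cs n (fun x => f x + g x).
Proof.
elim: n f g => [|n IH] f g Cf Cg.
  by split => //; apply: contD; [exact: Cs_cont Cf|exact: Cs_cont Cg].
split; first by apply: contD; [exact: Cs_cont Cf|exact: Cs_cont Cg].
have [df dg] := (Cs_pdable Cf, Cs_pdable Cg).
split => [|j]; first exact: pdableD.
by rewrite pdD//; apply: IH; exact: Cs_pd.
Qed.

Lemma CsM n f g : Cs n f -> Cs n g -> Cs n (fun x => f x * g x).
Proof.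
elim: n f g => [|n IH] f g Cf Cg.
  by split => //; apply: contM; [exact: Cs_cont Cf|exact: Cs_cont Cg].
split; first by apply: contM; [exact: Cs_cont Cf|exact: Cs_cont Cg].
have [df dg] := (Cs_pdable Cf, Cs_pdable Cg).
split => [|j]; first exact: pdableM.
rewrite pdM//; apply: CsD; apply: IH.
- exact: CsW.
- exact: Cs_pd.
- exact: CsW.
- exact: Cs_pd.
Qed.

Lemma CsX n f m : Cs n f -> Cs n (fun x => f x ^+ m).
Proof.
move=> Cf; elim: m => [|m IH]; first exact: Cs_cst.
by rewrite (_ : (fun x => f x ^+ m.+1) = (fun x => f x * f x ^+ m)); [exact: CsM|
   apply/funext => x; rewrite exprS].
Qed.

Lemma periodic_pd f j : Defs.periodic f -> Defs.periodic (pd j f).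
Proof.
move=> pf i x.
have E : (fun t : R => t^-1 *: (f (t *: 'e_j + (x + 'e_i)) - f (x + 'e_i))) =
         (fun t : R => t^-1 *: (f (t *: 'e_j + x) - f x)).
  by apply/funext => t; rewrite addrA !pf.
by rewrite /pd /derive [X in lim (X @ _)]E.
Qed.

Lemma torus_int_div f j : Defs.periodic f -> Cs 1 f -> torus_int (pd j f) = 0.
Proof.
move=> pf Cf; apply: torus_int_pd => //; last exact: Cs_pd_cont Cf.
exact: (Cs_pdable Cf).
Qed.

End partial_derivatives.

(** * Periodic weights *)

Section periodic_kernels.
Variable R : realType.
Local Notation X := 'rV[R]_3.
Local Notation pi := (@pi R).
Implicit Types (f : X -> R) (j : 'I_3).

(** Periodic substitutes for y^2 and y: the derivative of rk is 2 sk and that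
    of sk is 1 up to a multiple of rk, so that computations with |x|^2 and the
    radial field x carry over to the torus with harmless corrections. *)
Definition rk (y : R) := (sin (pi * y) / pi) ^+ 2.
Definition sk (y : R) := sin (pi * y) * cos (pi * y) / pi.

Let pi0 : pi != 0. Proof. by rewrite gt_eqF ?pi_gt0. Qed.

Lemma rk_ge0 y : 0 <= rk y. Proof. exact: sqr_ge0. Qed.

Lemma rk_le1 y : rk y <= 1.
Proof.
rewrite /rk expr_div_n ler_pdivrMr ?exprn_gt0 ?pi_gt0// mul1r.
have s1 : sin (pi * y) ^+ 2 <= 1 by rewrite sin2cos2; have := sqr_ge0 (cos (pi * y)); lra.
rewrite (le_trans s1)// expr_ge1 ?pi_ge0//.
by have := @pi_ge2 R; lra.
Qed.

Lemma sk_sqr y : sk y ^+ 2 = rk y * (1 - pi ^+ 2 * rk y).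
Proof.
rewrite /sk /rk !expr_div_n exprMn (sin2cos2 (pi * y)); move: (cos _) => c.
by move: pi pi0 => p p0; field.
Qed.

Lemma is_derive_sinpi y : is_derive y (1 : R) (fun y => sin (pi * y)) (pi * cos (pi * y)).
Proof.
have H : is_derive y (1 : R) (fun y : R => pi * y) (pi * 1 + y * 0).
  exact: is_deriveM_fun.
apply: (is_derive_eq (is_derive_chain (is_derive_sin (pi * y)) H)).
by move: pi => p; ring.
Qed.

Lemma is_derive_cospi y : is_derive y (1 : R) (fun y => cos (pi * y)) (- pi * sin (pi * y)).
Proof.
have H : is_derive y (1 : R) (fun y : R => pi * y) (pi * 1 + y * 0).
  exact: is_deriveM_fun.
apply: (is_derive_eq (is_derive_chain (is_derive_cos (pi * y)) H)).
by move: pi => p; ring.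
Qed.

Lemma is_derive_rk y : is_derive y (1 : R) rk (2 * sk y).
Proof.
have H1 := is_deriveM_fun (is_derive_sinpi y) (is_derive_cst_fun pi^-1 y 1).
apply: (is_derive_eq (is_deriveM_fun H1 H1)).
by rewrite /sk; move: pi pi0 (sin _) (cos _) => p p0 s c; field.
Qed.

Lemma is_derive_sk y : is_derive y (1 : R) sk (1 - 2 * pi ^+ 2 * rk y).
Proof.
have H1 := is_deriveM_fun (is_deriveM_fun (is_derive_sinpi y) (is_derive_cospi y))
  (is_derive_cst_fun pi^-1 y 1).
apply: (is_derive_eq H1).
rewrite /rk; have := cos2sin2 (pi * y); move: pi pi0 (sin _) (cos _) => p p0 s c H.
by transitivity (c ^+ 2 - s ^+ 2); [field|rewrite H; field].
Qed.

Lemma rk1 y : rk (y + 1) = rk y.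
Proof. by rewrite /rk mulrDr mulr1 sinDpi !expr_div_n sqrrN. Qed.

Lemma sk1 y : sk (y + 1) = sk y.
Proof. by rewrite /sk mulrDr mulr1 sinDpi cosDpi mulrNN. Qed.

Lemma norm_sin_le (y : R) : `|sin y| <= `|y|.
Proof.
wlog y0 : y / 0 <= y.
  move=> H; have [/H//|y0] := leP 0 y.
  by rewrite -[`|y|]normrN -[`|sin y|]normrN -sinN H// oppr_ge0 ltW.
have cs : {within `[0, y], continuous (@sin R)}.
  by apply: continuous_subspaceT; exact: continuous_sin.
have [c _] := MVT_segment y0 (fun x _ => is_derive_sin x) cs.
rewrite sin0 !subr0 => ->; rewrite normrM -[leRHS]mul1r ler_wpM2r//.
exact: cos_max.
Qed.

Lemma rk_le_sqr y : rk y <= y ^+ 2.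
Proof.
rewrite /rk -[X in X <= _]real_normK ?num_real// -[X in _ <= X]real_normK ?num_real//.
rewrite ler_sqr ?nnegrE// normf_div ler_pdivrMr ?normr_gt0//.
by rewrite (le_trans (norm_sin_le _))// normrM mulrC.
Qed.

Lemma continuous_rk : continuous rk.
Proof.
move=> y; apply: differentiable_continuous; apply/derivable1_diffP.
by have [] := is_derive_rk y.
Qed.

Lemma continuous_sk : continuous sk.
Proof.
move=> y; apply: differentiable_continuous; apply/derivable1_diffP.
by have [] := is_derive_sk y.
Qed.

End periodic_kernels.

Section hardy_agmon.
Variable R : realType.
Local Notation X := 'rV[R]_3.
Local Notation pi := (@pi R).
Local Notation "'e_ j" := (@delta_mx R 1 3 0 j) (at level 8, j at level 2, format "''e_' j").
Implicit Types (f : X -> R) (j : 'I_3).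
Variables (c : X) (eta : R).
Hypothesis eta_gt0 : 0 < eta.

Definition rc j (x : X) := rk (x 0 j - c 0 j).
Definition sc j (x : X) := sk (x 0 j - c 0 j).
(** Substitute for |x - c|^2, regularised at scale eta. *)
Definition rho (x : X) := eta ^+ 2 + \sum_j rc j x.

Lemma rho_gt0 x : 0 < rho x.
Proof.
by rewrite /rho ltr_wpDr ?exprn_gt0// sumr_ge0// => j _; exact: rk_ge0.
Qed.

Let rho_neq0 x : rho x != 0. Proof. by rewrite gt_eqF ?rho_gt0. Qed.

Lemma cont_coord (h : R -> R) j : continuous h -> continuous (fun x : X => h (x 0 j - c 0 j)).
Proof.
move=> ch x; apply: (@continuous_comp _ _ _ (fun x : X => x 0 j - c 0 j) h); last exact: ch.
apply: (@contD R X (fun x => x 0 j) (fun=> - c 0 j)); last exact: cont_cst.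
exact: coord_continuous.
Qed.

Lemma cont_rc j : continuous (rc j). Proof. exact/cont_coord/continuous_rk. Qed.
Lemma cont_sc j : continuous (sc j). Proof. exact/cont_coord/continuous_sk. Qed.

Lemma cont_rho : continuous rho.
Proof. by apply: contD; [exact: cont_cst|apply: cont_sum => j; exact: cont_rc]. Qed.

Lemma periodic_coord (h : R -> R) j : (forall y, h (y + 1) = h y) ->
  Defs.periodic (fun x : X => h (x 0 j - c 0 j)).
Proof.
move=> h1 i x; rewrite !mxE eqxx /= addrAC.
by case: eqP => _; rewrite ?h1 ?addr0.
Qed.

Lemma periodic_rc j : Defs.periodic (rc j). Proof. exact/periodic_coord/rk1. Qed.
Lemma periodic_sc j : Defs.periodic (sc j). Proof. exact/periodic_coord/sk1. Qed.
Lemma periodic_rho : Defs.periodic rho.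
Proof.
move=> i x; rewrite /rho; congr (_ + _); apply: eq_bigr => j _; exact: periodic_rc.
Qed.

Lemma is_derive_rc i j x : is_derive x 'e_j (rc i) (if i == j then 2 * sc i x else 0).
Proof. exact: is_derive_coord (is_derive_rk _). Qed.

Lemma is_derive_sc i j x :
  is_derive x 'e_j (sc i) (if i == j then 1 - 2 * pi ^+ 2 * rc i x else 0).
Proof. exact: is_derive_coord (is_derive_sk _). Qed.

Lemma is_derive_rho j x : is_derive x 'e_j rho (2 * sc j x).
Proof.
have H := is_deriveD_fun (is_derive_cst_fun (eta ^+ 2) x 'e_j)
  (is_derive_sum_fun (index_enum 'I_3) (fun i => is_derive_rc i j x)).
apply: (is_derive_eq H); rewrite add0r (bigD1 j)//= eqxx big1 ?addr0// => i /negbTE ->//.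
Qed.

Lemma is_derive_rhoV j x : is_derive x 'e_j (fun x => (rho x)^-1) (- (2 * sc j x) / rho x ^+ 2).
Proof.
have [Hd Hv] := is_derive_rho j x; have n0 := rho_neq0 x.
apply: DeriveDef; first exact: (@derivableV _ _ rho x 'e_j n0 Hd).
rewrite (@deriveV _ _ rho x 'e_j n0 Hd) Hv /GRing.scale /=.
by rewrite mulrC mulrN mulNr.
Qed.

Definition srho x := Num.sqrt (rho x).

Lemma srho_gt0 x : 0 < srho x. Proof. by rewrite sqrtr_gt0 rho_gt0. Qed.
Lemma srho_sqr x : srho x ^+ 2 = rho x.
Proof. by rewrite sqr_sqrtr// ltW// rho_gt0. Qed.
Lemma cont_srho : continuous srho.
Proof.
move=> x; apply: (@continuous_comp _ _ _ rho Num.sqrt); first exact: cont_rho.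
exact: sqrt_continuous.
Qed.

Lemma is_derive_srho j x : is_derive x 'e_j srho (sc j x / srho x).
Proof.
apply: (is_derive_eq (is_derive_chain (is_derive1_sqrt (rho_gt0 x)) (is_derive_rho j x))).
have := srho_gt0 x; rewrite /srho; move: (Num.sqrt _) (sc j x) => r s r0.
by field; rewrite gt_eqF.
Qed.

(** The weight rho^(-3/2). In R^3 the divergence of x (|x|^2 + eta^2)^(-3/2)
    is 3 eta^2 (|x|^2 + eta^2)^(-5/2), an approximate Dirac mass at the
    origin. *)
Definition kap x := (rho x * srho x)^-1.

Lemma rho_srho_gt0 x : 0 < rho x * srho x.
Proof. by rewrite mulr_gt0 ?rho_gt0 ?srho_gt0. Qed.

Lemma is_derive_kap j x : is_derive x 'e_j kap (- 3 * sc j x * kap x / rho x).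
Proof.
have H := is_deriveM_fun (is_derive_rho j x) (is_derive_srho j x).
have n0 : rho x * srho x != 0 by rewrite gt_eqF ?rho_srho_gt0.
pose F := fun y : X => rho y * srho y.
have Hd : derivable F x 'e_j by have [] := H.
have Hv : 'D_('e_j) F x = rho x * (sc j x / srho x) + srho x * (2 * sc j x) by have [] := H.
have -> : kap = fun y => (F y)^-1 by [].
apply: DeriveDef; first exact: (@derivableV _ _ F x 'e_j n0 Hd).
rewrite (@deriveV _ _ F x 'e_j n0 Hd) Hv /F /GRing.scale /=.
have := srho_gt0 x; have := srho_sqr x.
move: (rho x) (srho x) (sc j x) => q r s <- r0.
by field; rewrite gt_eqF.
Qed.

End hardy_agmon.

(** * The Hardy inequality *)

(** Complete the squares (a s_j q + 2 g_j)^2 in the cross terms. *)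
Lemma hardy_algebra (K : realFieldType) (a q p : K) (s g r : 'I_3 -> K) :
  a ^+ 2 * (3 * q - 2 * p * ((\sum_j r j) * q) - 2 * ((\sum_j s j ^+ 2) * q) * q)
  - 2^-1 * a ^+ 2 * ((\sum_j s j ^+ 2) * q) * q - 2 * \sum_j g j ^+ 2 <=
  \sum_j (a ^+ 2 * ((1 - 2 * p * r j) * q + s j * (- (2 * s j) * q ^+ 2))
          + 2 * a * g j * s j * q).
Proof.
rewrite !sum_ord3.
move: (s ord0) (s (lift ord0 ord0)) (s ord_max) => s1 s2 s3.
move: (g ord0) (g (lift ord0 ord0)) (g ord_max) => g1 g2 g3.
move: (r ord0) (r (lift ord0 ord0)) (r ord_max) => r1 r2 r3.
have := sqr_ge0 (a * s1 * q + 2 * g1); have := sqr_ge0 (a * s2 * q + 2 * g2).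
have := sqr_ge0 (a * s3 * q + 2 * g3).
lra.
Qed.

Section hardy_agmon_inequalities.
Variable R : realType.
Local Notation X := 'rV[R]_3.
Local Notation pi := (@pi R).
Local Notation "'e_ j" := (@delta_mx R 1 3 0 j) (at level 8, j at level 2, format "''e_' j").
Implicit Types (f : X -> R) (j : 'I_3).

Section weighted.
Variables (c : X) (eta : R).
Hypothesis eta_gt0 : 0 < eta.
Local Notation rc := (rc c). Local Notation sc := (sc c).
Local Notation rho := (rho c eta). Local Notation srho := (srho c eta).
Local Notation kap := (kap c eta).

Lemma continuous_rhoV : continuous (fun x => (rho x)^-1).
Proof.
by apply: contV; [move=> x; rewrite gt_eqF ?rho_gt0|exact: cont_rho].
Qed.

Lemma continuous_kap : continuous kap.
Proof.
apply: contV; first by move=> x; rewrite gt_eqF ?rho_srho_gt0.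
by apply: contM; [exact: cont_rho|exact: cont_srho].
Qed.

Lemma periodic_kap : Defs.periodic kap.
Proof. by move=> i x; rewrite /kap /srho periodic_rho. Qed.

(** The summands are the d_j (f^2 s_j om). Both the Hardy and the Agmon
    inequality test this identity, with weights rho^(-1) and rho^(-3/2). *)
Lemma torus_int_flux f (om : X -> R) (dom : 'I_3 -> X -> R) :
  Cs 1 f -> Defs.periodic f -> continuous om -> Defs.periodic om ->
  (forall j, continuous (dom j)) -> (forall j x, is_derive x 'e_j om (dom j x)) ->
  let div x := \sum_j (f x ^+ 2 * ((1 - 2 * pi ^+ 2 * rc j x) * om x + sc j x * dom j x)
                       + 2 * f x * pd j f x * sc j x * om x) in
  continuous div /\ torus_int div = 0.
Proof.
move=> Cf pf com pom cdom Hom div.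
have cf := Cs_cont Cf; have df := Cs_pdable Cf.
have cpd j := Cs_pd_cont (j := j) Cf.
have crc := @cont_rc R c; have csc := @cont_sc R c.
pose V j x := f x ^+ 2 * (sc j x * om x).
have HV j x : is_derive x 'e_j (V j) (f x ^+ 2 *
    ((1 - 2 * pi ^+ 2 * rc j x) * om x + sc j x * dom j x)
     + 2 * f x * pd j f x * sc j x * om x).
  have H1 := is_derive_pd (df j x).
  have H2 := is_deriveM_fun H1 H1.
  have H3 := is_deriveM_fun (is_derive_sc c j j x) (Hom j x).
  have H4 := is_deriveM_fun H2 H3.
  apply: (is_derive_eq H4); rewrite eqxx; move: (f x) (pd j f x) (sc j x) (om x) (dom j x) (rc j x) pi.
  by move=> a b s o d r p; ring.
have E j : pd j (V j) = fun x => f x ^+ 2 *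
    ((1 - 2 * pi ^+ 2 * rc j x) * om x + sc j x * dom j x)
     + 2 * f x * pd j f x * sc j x * om x.
  by apply/funext => x; exact: pd_val.
have cE j : continuous (pd j (V j)) by rewrite E; cont.
have -> : div = fun x => \sum_j pd j (V j) x.
  by apply/funext => x; apply: eq_bigr => j _; rewrite E.
split; first by cont.
rewrite (torus_int_sum _ cE) big1// => j _; apply: torus_int_pd (cE j).
- by move=> i x; rewrite /V pf pom periodic_sc.
- by move=> x; have [] := HV j x.
Qed.

Lemma sc_sqr_le j x : sc j x ^+ 2 <= rc j x.
Proof.
rewrite /sc /rc sk_sqr.
have := rk_ge0 (x 0 j - c 0 j); have := sqr_ge0 pi.
move: (rk _) (pi ^+ 2) => r p p0 r0.
have := mulr_ge0 p0 (mulr_ge0 r0 r0); lra.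
Qed.

(** In R^3 the divergence of x / |x|^2 is 1 / |x|^2. The corrections of the
    periodic version are bounded and go to the term without weight. The bound
    is uniform in eta. *)
Lemma hardy f : Cs 1 f -> Defs.periodic f ->
  torus_int (fun x => f x ^+ 2 / rho x) <=
  4 * pi ^+ 2 * torus_int (fun x => f x ^+ 2) + 4 * \sum_j torus_int (fun x => pd j f x ^+ 2).
Proof.
move=> Cf pf.
have cf := Cs_cont Cf; have cpd j := Cs_pd_cont (j := j) Cf.
have crV := continuous_rhoV; have csc := @cont_sc R c.
have [] := @torus_int_flux f (fun x => (rho x)^-1)
  (fun j x => - (2 * sc j x) / rho x ^+ 2) Cf pf crV.
- by move=> i x; rewrite periodic_rho.
- move=> j /=.
  have -> : (fun x => - (2 * sc j x) / rho x ^+ 2) = (fun x => - (2 * sc j x) * (rho x)^-1 ^+ 2).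
    by apply/funext => x; rewrite exprVn.
  by cont.
- by move=> j x; exact: is_derive_rhoV.
set div := (X in continuous X -> _) => cdiv Idiv.
have P x : f x ^+ 2 / rho x - 4 * pi ^+ 2 * f x ^+ 2 - 4 * \sum_j pd j f x ^+ 2 <= 2 * div x.
  have r0 := rho_gt0 c eta_gt0 x.
  set q := (rho x)^-1; have q0 : 0 < q by rewrite invr_gt0.
  have Sr : (\sum_j rc j x) * q <= 1.
    rewrite ler_pdivrMr// mul1r /rho lerDr exprn_ge0//; exact: ltW.
  have SS : (\sum_j sc j x ^+ 2) * q <= 1.
    apply: le_trans Sr; rewrite ler_wpM2r ?(ltW q0)//.
    by apply: ler_sum => j _; exact: sc_sqr_le.
  have D : div x >= f x ^+ 2 * (3 * q - 2 * pi ^+ 2 * ((\sum_j rc j x) * q)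
      - 2 * ((\sum_j sc j x ^+ 2) * q) * q)
      - 2^-1 * f x ^+ 2 * ((\sum_j sc j x ^+ 2) * q) * q - 2 * \sum_j pd j f x ^+ 2.
    rewrite /div -exprVn -/q.
    exact: (hardy_algebra (f x) q (pi ^+ 2) (sc^~ x) (fun j => pd j f x) (rc^~ x)).
  move: D Sr SS; move: (div x) (\sum_j rc j x) (\sum_j sc j x ^+ 2) => d Sr Ss D Sr1 Ss1.
  have a0 := sqr_ge0 (f x); have p0 := sqr_ge0 pi.
  move: D a0 p0; move: (f x ^+ 2) (pi ^+ 2) (\sum_j _) => A p G D a0 p0.
  have H1 : A * (2 * p * (Sr * q)) <= A * (2 * p).
    by rewrite ler_wpM2l// ler_piMr// mulr_ge0.
  have H2 : A * (2 * (Ss * q) * q) <= A * (2 * q).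
    by rewrite ler_wpM2l// ler_wpM2r ?(ltW q0)// ler_piMr.
  have H3 : 2^-1 * A * (Ss * q) * q <= 2^-1 * A * q.
    by rewrite ler_wpM2r ?(ltW q0)// ler_piMr// mulr_ge0.
  nra.
have cL : continuous (fun x => f x ^+ 2 / rho x) by cont.
have cR : continuous (fun x => 2 * div x + 4 * pi ^+ 2 * f x ^+ 2 + 4 * \sum_j pd j f x ^+ 2).
  by cont.
apply: le_trans (le_torus_int cL cR _) _ => [x|].
  by have := P x; move: (\sum_j _) (div x) (f x ^+ 2) => *; lra.
rewrite !torus_intD; [|by cont..].
rewrite !torus_intZ; [|by cont..].
rewrite Idiv torus_int_sum; last by move=> j; cont.
by rewrite mulr0 add0r.
Qed.

End weighted.
End hardy_agmon_inequalities.

(** * The Agmon inequality *)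

(** Pointwise form of [agmon_pointwise]: k is the weight rho^(-3/2) and q is 1
    / rho. The cross terms are split by Young with parameter la. *)
Lemma agmon_algebra (K : realFieldType) (a q p la k rh et : K) (s g r : 'I_3 -> K) :
  0 < q -> 0 <= p -> 0 < la -> 0 < k -> rh * q = 1 -> \sum_j r j = rh - et ->
  rh * k <= 2 * q -> 0 <= et -> (forall j, s j ^+ 2 <= r j) -> (forall j, `|s j| * k <= q) ->
  3 * et * a ^+ 2 * k * q <=
  \sum_j (a ^+ 2 * ((1 - 2 * p * r j) * k + s j * (- 3 * s j * k * q))
          + 2 * a * g j * s j * k)
  + (4 * p + 3 * la^-1) * (a ^+ 2 * q) + la * ((\sum_j g j ^+ 2) * q).
Proof.
move=> q0 p0 la0 k0 rhq Sr rk2 et0 sr sk.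
have T j : 2 * a * g j * s j * k >= - (la^-1 * a ^+ 2 + la * g j ^+ 2) * q.
  have H1 : `|2 * a * g j * (s j * k)| <= `|2 * a * g j| * q.
    by rewrite normrM ler_wpM2l// normrM (ger0_norm (ltW k0)).
  have H2 : `|2 * a * g j| <= la^-1 * a ^+ 2 + la * g j ^+ 2.
    have E : (la^-1 * a ^+ 2 + la * g j ^+ 2) - 2 * `|a| * `|g j| = la^-1 * (`|a| - la * `|g j|) ^+ 2.
      rewrite -(real_normK (num_real a)) -(real_normK (num_real (g j))).
      by field; rewrite gt_eqF.
    rewrite 2!normrM ger0_norm// -subr_ge0 E mulr_ge0 ?sqr_ge0// invr_ge0 ltW//.
  have H3 := le_trans H1 (ler_wpM2r (ltW q0) H2).
  by move: H3; rewrite ler_norml => /andP[]; rewrite -mulNr mulrA.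
have S : \sum_j (a ^+ 2 * ((1 - 2 * p * r j) * k + s j * (- 3 * s j * k * q))
    - (la^-1 * a ^+ 2 + la * g j ^+ 2) * q) <=
  \sum_j (a ^+ 2 * ((1 - 2 * p * r j) * k + s j * (- 3 * s j * k * q))
          + 2 * a * g j * s j * k).
  by apply: ler_sum => j _; rewrite lerD2l -mulNr.
have Ss : \sum_j s j ^+ 2 <= rh - et by rewrite -Sr; apply: ler_sum.
have E : \sum_j (a ^+ 2 * ((1 - 2 * p * r j) * k + s j * (- 3 * s j * k * q))
    - (la^-1 * a ^+ 2 + la * g j ^+ 2) * q) =
  a ^+ 2 * k * 3 - 2 * p * (a ^+ 2 * k) * (\sum_j r j) - 3 * (a ^+ 2 * k * q) * (\sum_j s j ^+ 2)
  - 3 * la^-1 * (a ^+ 2 * q) - la * ((\sum_j g j ^+ 2) * q).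
  by rewrite !sum_ord3; ring.
have a2k : 0 <= a ^+ 2 * k by rewrite mulr_ge0 ?sqr_ge0 ?ltW.
have F1 : (a ^+ 2 * k * q) * (\sum_j s j ^+ 2) <= a ^+ 2 * k - a ^+ 2 * k * q * et.
  have := ler_wpM2l (mulr_ge0 a2k (ltW q0)) Ss.
  have -> : a ^+ 2 * k * q * (rh - et) = a ^+ 2 * k * (rh * q) - a ^+ 2 * k * q * et by ring.
  by rewrite rhq mulr1.
have F2 : p * (a ^+ 2 * k) * (\sum_j r j) <= p * (2 * (a ^+ 2 * q)).
  rewrite -mulrA ler_wpM2l// Sr.
  have H := ler_wpM2l (sqr_ge0 a) rk2.
  have := mulr_ge0 a2k et0; lra.
rewrite -2!lerBlDr; apply: le_trans S; rewrite E; move: F1 F2.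
move: (\sum_j r j) (\sum_j s j ^+ 2) (\sum_j g j ^+ 2) => W Y Z F1 F2.
lra.
Qed.

Section box.
Variable R : realType.
Local Notation X := 'rV[R]_3.
Local Notation mu := (@lebesgue_measure R).
Implicit Types (f : X -> R) (j : 'I_3).

(** Extracts pointwise information from an integral. *)
Lemma torus_int_box f (b : X) (h m : R) : 0 < h -> continuous f -> (forall x, 0 <= f x) ->
  (forall j, 0 <= b 0 j) -> (forall j, b 0 j + h <= 1) -> 0 <= m ->
  (forall x : X, (forall j, b 0 j <= x 0 j <= b 0 j + h) -> m <= f x) ->
  m * h ^+ 3 <= torus_int f.
Proof.
move=> h0 cf f0 b0 b1 m0 fm.
pose J j : set R := `[b 0 j, b 0 j + h]%classic.
pose i0 : 'I_3 := ord0; pose i1 : 'I_3 := lift ord0 ord0; pose i2 : 'I_3 := ord_max.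
pose Q : set (R * R * R) := (J i0 `*` J i1) `*` J i2.
have mJ j : measurable (J j) by exact: measurable_itv.
have mQ : measurable Q by apply: measurableX => //; exact: measurableX.
have muJ j : mu (J j) = h%:E.
  by rewrite /J lebesgue_measure_itv /= lte_fin ltrDl h0 -EFinB addrAC subrr add0r.
have muQ : ((mu \x mu) \x mu)%E Q = (h ^+ 3)%:E.
  have := @product_measure1E _ _ _ _ R (mu \x mu)%E mu (J i0 `*` J i1) (J i2) (measurableX (mJ i0) (mJ i1)) (mJ i2).
  move=> ->; have := @product_measure1E _ _ _ _ R mu mu (J i0) (J i1) (mJ i0) (mJ i1).
  by move=> /= ->; rewrite !muJ -!EFinM !exprS expr0 mulr1 mulrA.
have JI j y : J j y -> 0 <= y <= 1.
  rewrite /J /= in_itv /= => /andP[y0 y1].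
  by rewrite (le_trans (b0 j) y0) (le_trans y1).
have sQ : Q `<=` @torus_cell R.
  by move=> [[y1 y2] y3] [[/= /JI J1 /JI J2] /JI J3]; split; [split|]; rewrite /= in_itv.
have ic := integrable_torus cf.
have iQ : ((mu \x mu) \x mu)%E.-integrable Q (EFin \o (f \o @row_of_triple R)).
  by apply: integrableS ic => //; exact: measurable_torus_cell.
have -> : m * h ^+ 3 = Rintegral ((mu \x mu) \x mu)%E Q (fun=> m).
  by rewrite Rintegral_cst// [X in fine X]muQ.
apply: (@le_trans _ _ (Rintegral ((mu \x mu) \x mu)%E Q (f \o @row_of_triple R))).
  apply: le_Rintegral => //.
    apply: measurable_bounded_integrable => //; last exact: bounded_cst.
    by rewrite [ltLHS]muQ ltry.
  move=> [[y1 y2] y3] [[/= J1 J2] J3]; apply: fm => j; rewrite mxE.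
  have -> : j = i0 \/ j = i1 \/ j = i2 -> b 0 j <= nth 0 [:: y1; y2; y3] j <= b 0 j + h = true.
    by move=> [->|[->|->]] /=; [move: J1|move: J2|move: J3]; rewrite /J /= in_itv.
  by [].
  case: j => -[|[|[|//]]] j3; [left|right; left|right; right]; exact/val_inj.
rewrite /torus_int /Rintegral fine_le//.
- by apply: integrable_fin_num.
- apply: integrable_fin_num => //; exact: measurable_torus_cell.
have [mfc _] := integrableP _ _ _ ic.
apply: ge0_subset_integral => //.
all: try exact: measurable_torus_cell.
all: try exact: mfc.
all: move=> z _; rewrite lee_fin; exact: f0.
Qed.

End box.

Section agmon.
Variable R : realType.
Local Notation X := 'rV[R]_3.
Local Notation pi := (@pi R).
Local Notation "'e_ j" := (@delta_mx R 1 3 0 j) (at level 8, j at level 2, format "''e_' j").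
Implicit Types (f : X -> R) (j k : 'I_3).

(** Testing f^2 against the divergence of s rho^(-3/2) puts an approximate
    Dirac mass at c on the left-hand side; the other terms carry the weight 1
    / rho, which [hardy] removes. *)
Lemma agmon_pointwise (c : X) (eta la : R) f : 0 < eta -> eta <= 1 -> 0 < la ->
  Cs 1 f -> Defs.periodic f ->
  torus_int (fun x => 3 * eta ^+ 2 * f x ^+ 2 * kap c eta x * (rho c eta x)^-1) <=
  (4 * pi ^+ 2 + 3 * la^-1) * torus_int (fun x => f x ^+ 2 / rho c eta x)
  + la * \sum_j torus_int (fun x => pd j f x ^+ 2 / rho c eta x).
Proof.
move=> eta0 eta1 la0 Cf pf.
have cf := Cs_cont Cf; have cpd j := Cs_pd_cont (j := j) Cf.
have crV := @continuous_rhoV R c eta eta0; have csc := @cont_sc R c.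
have ck := @continuous_kap R c eta eta0.
have [] := @torus_int_flux R c f (kap c eta)
  (fun j x => - 3 * sc c j x * kap c eta x * (rho c eta x)^-1) Cf pf ck.
- exact: periodic_kap.
- by move=> j /=; cont.
- by move=> j x; exact: is_derive_kap.
set div := (X in continuous X -> _) => cdiv Idiv.
have P x : 3 * eta ^+ 2 * f x ^+ 2 * kap c eta x * (rho c eta x)^-1 <=
   div x + (4 * pi ^+ 2 + 3 * la^-1) * (f x ^+ 2 / rho c eta x)
   + la * ((\sum_j pd j f x ^+ 2) / rho c eta x).
  have r0 := rho_gt0 c eta0 x.
  have s0 := srho_gt0 c eta0 x.
  have srE := srho_sqr c eta0 x.
  have s2 : srho c eta x <= 2.
    rewrite -ler_sqr ?nnegrE ?(ltW s0)// srE /rho.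
    have : \sum_j rc c j x <= \sum_(j < 3) 1 by apply: ler_sum => j _; exact: rk_le1.
    rewrite sumr_const card_ord -mulr_natr mul1r => H.
    have : eta ^+ 2 <= 1 by rewrite expr_le1// ltW.
    move: H; move: (\sum_j _) (eta ^+ 2) => A B; rewrite expr2; lra.
  apply: (@agmon_algebra R (f x) (rho c eta x)^-1 (pi ^+ 2) la (kap c eta x)
    (rho c eta x) (eta ^+ 2) (sc c ^~ x) (fun j => pd j f x) (rc c ^~ x)) => //.
  - by rewrite invr_gt0.
  - exact: sqr_ge0.
  - by rewrite invr_gt0 rho_srho_gt0.
  - by rewrite mulfV ?gt_eqF.
  - by rewrite /rho addrAC subrr add0r.
  - rewrite /kap invfM mulrA mulfV ?gt_eqF// mul1r -srE.
    rewrite -subr_ge0.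
    have -> : 2 * (srho c eta x ^+ 2)^-1 - (srho c eta x)^-1 =
      (2 - srho c eta x) * (srho c eta x ^+ 2)^-1 by move: s0 => s0; field; rewrite gt_eqF.
    by rewrite mulr_ge0 ?subr_ge0// invr_ge0 exprn_ge0 ?ltW.
  - by rewrite sqr_ge0.
  - by move=> j; exact: sc_sqr_le.
  - move=> j.
    have sj : `|sc c j x| <= srho c eta x.
      rewrite -ler_sqr ?nnegrE ?(ltW s0)// real_normK ?num_real// srE.
      rewrite (le_trans (sc_sqr_le c j x))// /rho (bigD1 j)//=.
      have := sqr_ge0 eta; have : 0 <= \sum_(i | i != j) rc c i x.
        by rewrite sumr_ge0// => i _; exact: rk_ge0.
      by move: (\sum_(i | _) _) (rc c j x) (eta ^+ 2) => A B C; lra.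
    apply: le_trans (ler_wpM2r _ sj) _; first by rewrite ltW// invr_gt0 rho_srho_gt0.
    by rewrite /kap invfM mulrCA mulfV ?gt_eqF// mulr1.
have cL : continuous (fun x => 3 * eta ^+ 2 * f x ^+ 2 * kap c eta x * (rho c eta x)^-1) by cont.
have cR : continuous (fun x => div x + (4 * pi ^+ 2 + 3 * la^-1) * (f x ^+ 2 / rho c eta x)
   + la * (\sum_j (pd j f x ^+ 2 / rho c eta x))) by cont.
apply: le_trans (le_torus_int cL cR _) _ => [x|].
  by apply: le_trans (P x) _; rewrite mulr_suml.
rewrite !torus_intD; [|by cont..].
rewrite !torus_intZ; [|by cont..].
rewrite Idiv torus_int_sum; last by move=> j; cont.
by rewrite add0r.
Qed.

Definition agmon_const : R := 22 * ((4 * pi ^+ 2 + 3) * (4 * pi ^+ 2 + 4)).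

Lemma agmon_const_gt0 : 0 < agmon_const.
Proof.
rewrite /agmon_const; have := sqr_ge0 pi; move: (pi ^+ 2) => p p0.
by rewrite mulr_gt0// mulr_gt0//; lra.
Qed.

Definition l2sq f := torus_int (fun x => f x ^+ 2).
Definition d1sq f := \sum_j l2sq (pd j f).
Definition d2sq f := \sum_j \sum_k l2sq (pd k (pd j f)).

Lemma l2sq_ge0 f : 0 <= l2sq f.
Proof. by apply: torus_int_ge0 => x; exact: sqr_ge0. Qed.

Lemma d1sq_ge0 f : 0 <= d1sq f.
Proof. by apply: sumr_ge0 => j _; exact: l2sq_ge0. Qed.

Lemma d2sq_ge0 f : 0 <= d2sq f.
Proof. by apply: sumr_ge0 => j _; apply: sumr_ge0 => k _; exact: l2sq_ge0. Qed.

(** Apply [agmon_pointwise] at a scale eta so small that f^2 is at least half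
    its value at c on a cube of side eta; there the approximate Dirac mass has
    a definite amount of mass. [hardy], applied to f and to its derivatives,
    bounds the right-hand side uniformly in eta. *)
Theorem agmon f (la : R) (c : X) : Cs 2 f -> Defs.periodic f -> 0 < la -> la <= 1 ->
  in_cell c ->
  f c ^+ 2 <= agmon_const * (la^-1 * (l2sq f + d1sq f) + la * (d1sq f + d2sq f)).
Proof.
move=> Cf pf la0 la1 cc.
have Cf1 := CsW Cf.
have cf := Cs_cont Cf.
set A0 := l2sq f; set A1 := d1sq f; set A2 := d2sq f.
have A00 : 0 <= A0 := l2sq_ge0 f.
have A10 : 0 <= A1 := d1sq_ge0 f.
have A20 : 0 <= A2 := d2sq_ge0 f.
have la10 : 0 < la^-1 by rewrite invr_gt0.
have la11 : 1 <= la^-1 by rewrite invf_ge1.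
have RHS0 : 0 <= la^-1 * (A0 + A1) + la * (A1 + A2).
  by rewrite addr_ge0// mulr_ge0 ?addr_ge0// ltW.
have [fc0|fc0] := eqVneq (f c ^+ 2) 0.
  by rewrite fc0 mulr_ge0// ltW// agmon_const_gt0.
have v0 : 0 < f c ^+ 2 by rewrite lt_neqAle eq_sym fc0 sqr_ge0.
set v := f c ^+ 2 in v0 *.
have cf2 : continuous (fun x => f x ^+ 2) by cont.
have [e e0 He] : exists2 e, 0 < e & forall x : X, (forall j, `|x 0 j - c 0 j| < e) -> v / 2 <= f x ^+ 2.
  have /cvgrPdist_lt -/(_ (v / 2)) := cf2 c.
  have v20 : 0 < v / 2 by rewrite divr_gt0.
  move=> /(_ v20) /nbhs_ballP [e /= e0 He]; exists e => // x xe.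
  have /He : ball c e x.
    by split => // i j; rewrite (ord1 i) /ball /= distrC.
  by rewrite /= -/v ltr_norml => /andP[_]; lra.
have [eta [eta0 etae eta2]] : exists eta : R, [/\ 0 < eta, eta < e & eta <= 2^-1].
  exists (Num.min (e / 2) 2^-1); split.
  - by rewrite lt_min divr_gt0//= invr_gt0.
  - by rewrite gt_min; apply/orP; left; rewrite ltr_pdivrMr// mulr_natr mulr2n ltrDl.
  - by rewrite ge_min lexx orbT.
have eta1 : eta <= 1 by lra.
(* a cube of side eta that lies in the cell and has c as a vertex *)
pose b : X := \row_j (if c 0 j <= 2^-1 then c 0 j else c 0 j - eta).
have b0 j : 0 <= b 0 j.
  by rewrite mxE; have /andP[] := cc j; case: (leP (c 0 j) 2^-1) => ? ? ?; lra.
have b1 j : b 0 j + eta <= 1.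
  by rewrite mxE; have /andP[] := cc j; case: (leP (c 0 j) 2^-1) => ? ? ?; lra.
have ck := @continuous_kap R c eta eta0; have crV := @continuous_rhoV R c eta eta0.
pose g x := 3 * eta ^+ 2 * f x ^+ 2 * kap c eta x * (rho c eta x)^-1.
have L : 3 * v / (64 * eta ^+ 3) * eta ^+ 3 <= torus_int g.
  apply: (torus_int_box (b := b)) => //.
  - by rewrite /g; cont.
  - move=> x; have r0 := rho_gt0 c eta0 x; have s0 := rho_srho_gt0 c eta0 x.
    have k0 : 0 <= kap c eta x by rewrite /kap invr_ge0 ltW.
    by rewrite /g mulr_ge0 ?invr_ge0 ?(ltW r0)// mulr_ge0// mulr_ge0 ?sqr_ge0// mulr_ge0 ?sqr_ge0.
  - by rewrite divr_ge0// mulr_ge0 ?(ltW v0) ?exprn_ge0 ?(ltW eta0).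
  - move=> x xb.
    have xc j : `|x 0 j - c 0 j| <= eta.
      have := xb j; rewrite mxE ler_norml; case: (leP (c 0 j) 2^-1) => _ /andP[? ?]; apply/andP; split; lra.
    have fx : v / 2 <= f x ^+ 2 by apply: He => j; exact: le_lt_trans (xc j) etae.
    have r0 := rho_gt0 c eta0 x; have s0 := srho_gt0 c eta0 x.
    have rle : rho c eta x <= 4 * eta ^+ 2.
      have : \sum_j rc c j x <= \sum_(j < 3) eta ^+ 2.
        apply: ler_sum => j _; apply: le_trans (rk_le_sqr _) _.
        by rewrite -real_normK ?num_real// ler_sqr ?nnegrE// ltW.
      rewrite sumr_const card_ord -mulr_natr /rho; move: (\sum_j _) (eta ^+ 2) => A B; lra.
    have sle : srho c eta x <= 2 * eta.
      rewrite -ler_sqr ?nnegrE ?mulr_ge0 ?(ltW s0) ?(ltW eta0)// srho_sqr//.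
      by apply: le_trans rle _; rewrite exprMn; lra.
    have K : (32 * eta ^+ 5)^-1 <= kap c eta x * (rho c eta x)^-1.
      rewrite /kap -invfM lef_pV2 ?posrE ?mulr_gt0 ?exprn_gt0//.
      have -> : 32 * eta ^+ 5 = (4 * eta ^+ 2) * (2 * eta) * (4 * eta ^+ 2) by ring.
      apply: ler_pM; [by rewrite mulr_ge0 ?ltW|exact: ltW| |exact: rle].
      by apply: ler_pM; [exact: ltW|exact: ltW|exact: rle|exact: sle].
    have -> : 3 * v / (64 * eta ^+ 3) = 3 * eta ^+ 2 * (v / 2) * (32 * eta ^+ 5)^-1.
      by field; rewrite gt_eqF.
    rewrite /g -[leRHS]mulrA; apply: ler_pM => //.
    + have q1 : 0 <= v / 2 by lra. have q2 := sqr_ge0 eta. apply: mulr_ge0 => //; apply: mulr_ge0 => //.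
    + by rewrite invr_ge0 mulr_ge0 ?exprn_ge0 ?(ltW eta0).
    + by rewrite ler_wpM2l// mulr_ge0 ?sqr_ge0.
have L2 := agmon_pointwise c eta0 eta1 la0 Cf1 pf.
have H0 := @hardy R c eta eta0 f Cf1 pf.
have H1 j := @hardy R c eta eta0 (pd j f) (Cs_pd j Cf) (periodic_pd j pf).
have H1s : \sum_j torus_int (fun x => pd j f x ^+ 2 / rho c eta x) <= 4 * pi ^+ 2 * A1 + 4 * A2.
  by rewrite /A1 /A2 /d1sq /d2sq !mulr_sumr -big_split; apply: ler_sum => j _ /=; exact: H1.
have {L} L : 3 * v / 64 <= torus_int g.
  by apply: le_trans _ L; rewrite le_eqVlt; apply/orP; left; apply/eqP; field; rewrite gt_eqF.
rewrite -/g in L2; rewrite -/(l2sq f) -/(d1sq f) -/A0 -/A1 in H0.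
move: L L2 H0 H1s; gen_int => L L2 H0 H1s.
move: (\sum_j _) L2 H1s => S L2 H1s.
have p0 := sqr_ge0 pi; rewrite /agmon_const; move: (pi ^+ 2) p0 H0 H1s L2 => p p0 H0 H1s L2.
have F1 : (4 * p + 3 * la^-1) * int0 <= ((4 * p + 3) * la^-1) * ((4 * p + 4) * (A0 + A1)).
  have c0 : 0 <= 4 * p + 3 * la^-1 by lra.
  have c1 : 4 * p + 3 * la^-1 <= (4 * p + 3) * la^-1 by nra.
  apply: le_trans (ler_wpM2l c0 H0) _; apply: ler_pM => //; nra.
have F2 : la * S <= la * ((4 * p + 4) * (A1 + A2)).
  by rewrite ler_pM2l//; apply: le_trans H1s _; nra.
have F3 : la * ((4 * p + 4) * (A1 + A2)) <= (4 * p + 3) * (la * ((4 * p + 4) * (A1 + A2))).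
  rewrite ler_peMl//; last by lra.
  by rewrite mulr_ge0 ?(ltW la0)// mulr_ge0 ?addr_ge0//; lra.
have V : 3 * v / 64 <= ((4 * p + 3) * (4 * p + 4)) * (la^-1 * (A0 + A1) + la * (A1 + A2)).
  apply: le_trans L _; apply: le_trans L2 _.
  apply: le_trans (lerD F1 (le_trans F2 F3)) _.
  by rewrite le_eqVlt; apply/orP; left; apply/eqP; ring.
have W : 0 <= ((4 * p + 3) * (4 * p + 4)) * (la^-1 * (A0 + A1) + la * (A1 + A2)).
  by rewrite mulr_ge0// mulr_ge0//; lra.
move: V W; rewrite -[22 * _ * _]mulrA; move: (_ * (_ + _)) => Q V W.
lra.
Qed.

End agmon.

(** * An interpolation inequality for the gradient *)

Section gagliardo_nirenberg.
Variable R : realType.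
Local Notation X := 'rV[R]_3.
Implicit Types (f : X -> R) (j k : 'I_3).

(** Integrate d_k (f (d_k f)^3), then complete the square in (d_k f)^2 + 3 f
    d_k d_k f. *)
Lemma gagliardo_nirenberg f k (M : R) : Cs 2 f -> Defs.periodic f ->
  (forall x, in_cell x -> f x ^+ 2 <= M) ->
  torus_int (fun x => pd k f x ^+ 4) <= 9 * M * l2sq (pd k (pd k f)).
Proof.
move=> Cf pf fM.
have Cg := Cs_pd k Cf; have Ch := Cs_pd k Cg.
set g := pd k f in Cg Ch *; set h := pd k g in Ch *.
have [cf [cg ch]] := (Cs_cont Cf, (Cs_cont Cg, Cs_cont Ch)).
have Cfg : Cs 1 (fun x => f x * g x ^+ 3) by apply: CsM (CsW Cf) _; exact: CsX.
have pfg : Defs.periodic (fun x => f x * g x ^+ 3).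
  by move=> i x; rewrite pf /g (periodic_pd k pf).
have E : pd k (fun x => f x * g x ^+ 3) = fun x => g x ^+ 4 + 3 * f x * g x ^+ 2 * h x.
  have dg := Cs_pdable Cg.
  have dg3 : pdable (fun x => g x ^+ 3) by apply: (@Cs_pdable _ 0); exact: CsX.
  apply/funext => x; apply: pd_val.
  have H1 := is_derive_pd (dg k x).
  have df := Cs_pdable Cf.
  have H := is_deriveM_fun (is_derive_pd (df k x)) (is_deriveM_fun H1 (is_deriveM_fun H1 H1)).
  by apply: (is_derive_eq H); rewrite -/g -/h; move: (f x) (g x) (h x) => a b d; ring.
have := torus_int_div k pfg Cfg; rewrite E => I0.
have c1 : continuous (fun x => g x ^+ 4 + 3 * f x * g x ^+ 2 * h x) by cont.
have c2 : continuous (fun x => 2 * (g x ^+ 4 + 3 * f x * g x ^+ 2 * h x) + 9 * M * h x ^+ 2) by cont.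
have c3 : continuous (fun x => g x ^+ 4) by cont.
have := le_torus_int_cell c3 c2; rewrite torus_intD; [|by cont..].
rewrite torus_intZ// torus_intZ; last by cont.
rewrite I0 mulr0 add0r; apply => x cx.
have H := sqr_ge0 (g x ^+ 2 + 3 * f x * h x).
have F := ler_wpM2r (sqr_ge0 (h x)) (fM x cx).
move: H F; move: (f x) (g x) (h x) => a b d H F.
have -> : b ^+ 4 = (b ^+ 2) ^+ 2 by ring.
move: H F; move: (b ^+ 2) => q; rewrite sqrrD; lra.
Qed.

End gagliardo_nirenberg.

(** * Symmetry of mixed derivatives *)

Section clairaut.
Variable R : realType.

Lemma MVT_fwd (f df : R -> R) (a h : R) : 0 < h ->
  (forall x, a <= x <= a + h -> is_derive x (1 : R) f (df x)) ->
  exists2 c, a < c < a + h & f (a + h) - f a = df c * h.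
Proof.
move=> h0 Hf.
have ah : a < a + h by rewrite ltrDl.
have der x : x \in `]a, (a + h)[%R -> is_derive x (1 : R) f (df x).
  by rewrite in_itv /= => /andP[x1 x2]; apply: Hf; rewrite !ltW.
have cf : {within `[a, a + h], continuous f}.
  apply: derivable_within_continuous => x; rewrite in_itv /= => xi.
  by have [] := Hf x xi.
have [c] := MVT ah der cf.
by rewrite in_itv /= => ci ->; exists c => //; rewrite addrAC subrr add0r.
Qed.

Lemma ltr_dist_fwd (d h a x : R) : h < d -> a < x < a + h -> `|x - a| < d.
Proof. by move=> hd /andP[? ?]; rewrite ltr_norml; apply/andP; split; lra. Qed.

Lemma ltr_dist_fwd_le (d h a x : R) : h < d -> a <= x <= a + h -> `|x - a| < d.
Proof. by move=> hd /andP[? ?]; rewrite ltr_norml; apply/andP; split; lra. Qed.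

Lemma ler_dist_half (a b c eps : R) :
  `|a - c| < eps / 2 -> `|b - c| < eps / 2 -> `|a - b| <= eps.
Proof.
rewrite !ltr_norml ler_norml => /andP[? ?] /andP[? ?]; apply/andP; split; lra.
Qed.

(** The second difference of phi over a square of side h is h^2 times a value
    of either mixed derivative, by the mean value theorem twice; let h tend to
    0. *)
Lemma clairaut (phi phi1 phi2 : R -> R -> R) (c12 c21 : R * R -> R) (s0 r0 e : R) :
  0 < e -> {for (s0, r0), continuous c12} -> {for (s0, r0), continuous c21} ->
  (forall s r, `|s - s0| < e -> is_derive s (1 : R) (phi^~ r) (phi1 s r)) ->
  (forall s r, `|s - s0| < e -> is_derive r (1 : R) (phi s) (phi2 s r)) ->
  (forall s r, `|s - s0| < e -> is_derive r (1 : R) (phi1 s) (c12 (s, r))) ->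
  (forall s r, `|s - s0| < e -> is_derive s (1 : R) (phi2^~ r) (c21 (s, r))) ->
  c12 (s0, r0) = c21 (s0, r0).
Proof.
move=> e0 cc12 cc21 H1 H2 H12 H21.
apply/eqP; rewrite -subr_eq0 -normr_le0; apply/ler_addgt0Pr => eps eps0.
rewrite add0r.
have eps20 : 0 < eps / 2 by rewrite divr_gt0.
have box (c : R * R -> R) : {for (s0, r0), continuous c} ->
    exists2 d, 0 < d & forall s r, `|s - s0| < d -> `|r - r0| < d ->
      `|c (s0, r0) - c (s, r)| < eps / 2.
  move=> cc; have := (cvgrPdist_lt _ _).1 cc _ eps20.
  move=> [[A B] /= [/nbhs_ballP [d1 /= d10 dA] /nbhs_ballP [d2 /= d20 dB]] AB].
  exists (Num.min d1 d2); first by rewrite lt_min d10.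
  move=> s r; rewrite !lt_min => /andP[s1 _] /andP[_ r2].
  by apply: (AB (s, r)); split => /=; [apply: dA|apply: dB]; rewrite /ball /= distrC.
have [d1 d10 D1] := box _ cc12; have [d2 d20 D2] := box _ cc21.
have [h h0 [he [hd1 hd2]]] : exists2 h, 0 < h & h < e /\ h < d1 /\ h < d2.
  have : 0 < Num.min e (Num.min d1 d2) by rewrite !lt_min e0 d10.
  set m := Num.min _ _ => m0.
  have : m / 2 < m by rewrite ltr_pdivrMr// mulr_natr mulr2n ltrDl.
  rewrite {2}/m !lt_min => /and3P[l1 l2 l3].
  by exists (m / 2); rewrite ?divr_gt0.
have near_s s : s0 <= s <= s0 + h -> `|s - s0| < e.
  exact: ltr_dist_fwd_le.
pose Delta := phi (s0 + h) (r0 + h) - phi (s0 + h) r0 - (phi s0 (r0 + h) - phi s0 r0).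
have [xi xih E1] : exists2 c, s0 < c < s0 + h & Delta = (phi1 c (r0 + h) - phi1 c r0) * h.
  have [c ch E] := @MVT_fwd (fun s => phi s (r0 + h) - phi s r0)
    (fun s => phi1 s (r0 + h) - phi1 s r0) s0 h h0
    (fun s sh => is_deriveB (H1 s (r0 + h) (near_s s sh)) (H1 s r0 (near_s s sh))).
  by exists c => //; rewrite -E /Delta.
have xi1 : `|xi - s0| < e by apply: near_s; case/andP: xih => ? ?; rewrite !ltW.
have [ze zeh E2] := @MVT_fwd (phi1 xi) (fun r => c12 (xi, r)) r0 h h0 (fun r _ => H12 xi r xi1).
have sh1 : `|s0 + h - s0| < e by rewrite addrAC subrr add0r gtr0_norm.
have s01 : `|s0 - s0| < e by rewrite subrr normr0.
have [ze' zeh' E1'] : exists2 c, r0 < c < r0 + h & Delta = (phi2 (s0 + h) c - phi2 s0 c) * h.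
  have [c ch E] := @MVT_fwd (fun r => phi (s0 + h) r - phi s0 r)
    (fun r => phi2 (s0 + h) r - phi2 s0 r) r0 h h0
    (fun r _ => is_deriveB (H2 (s0 + h) r sh1) (H2 s0 r s01)).
  by exists c => //; rewrite -E /Delta; ring.
have [xi' xih' E2'] := @MVT_fwd (phi2^~ ze') (fun s => c21 (s, ze')) s0 h h0
  (fun s sh => H21 s ze' (near_s s sh)).
have EE : c12 (xi, ze) = c21 (xi', ze').
  have hn : h != 0 by rewrite gt_eqF.
  apply: (mulIf hn); apply: (mulIf hn).
  by rewrite -E2 -E1 -E2' -E1'.
have B1 := D1 xi ze (ltr_dist_fwd hd1 xih) (ltr_dist_fwd hd1 zeh).
have B2 := D2 xi' ze' (ltr_dist_fwd hd2 xih') (ltr_dist_fwd hd2 zeh').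
by rewrite EE in B1; exact: ler_dist_half B1 B2.
Qed.

Local Notation X := 'rV[R]_3.

Lemma is_derive_slice_pd (f : X -> R) (x : X) j s : pdable f ->
  is_derive s (1 : R) (fun s => f (upd x j s)) (pd j f (upd x j s)).
Proof. by move=> df; exact: is_derive_slice (df j _). Qed.

Lemma pd_comm (f : X -> R) j k : Cs 2 f -> pd j (pd k f) = pd k (pd j f).
Proof.
move=> Cf; have [->//|jk] := eqVneq j k.
have df := Cs_pdable Cf; have dfj i := Cs_pdable (Cs_pd i Cf).
have cc i l := Cs_cont (Cs_pd i (Cs_pd l Cf)).
apply/funext => x.
pose y (z : R * R) := upd (upd x j z.1) k z.2.
have cy : continuous y.
  move=> z; apply: (@continuous_comp _ _ _ (fun z => (upd x j z.1, z.2)) (fun z : X * R => upd z.1 k z.2)); last exact: continuous_upd.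
  apply: (@continuous_mkpair _ _ _ (fun z : R * R => upd x j z.1) (fun z => z.2)) => w; last exact: cvg_snd.
  apply: (@continuous_comp _ _ _ (fun z : R * R => (x, z.1)) (fun z : X * R => upd z.1 j z.2)); last exact: continuous_upd.
  by apply: continuous_mkpair => v; [exact: cvg_cst|exact: cvg_fst].
have yx : y (x 0 j, x 0 k) = x by rewrite /y !upd_id.
have yE s r : y (s, r) = upd (upd x k r) j s by rewrite /y /= updC.
have ccy i l : continuous (fun z => pd i (pd l f) (y z)).
  move=> z; apply: (@continuous_comp _ _ _ y (pd i (pd l f))); [exact: cy|exact: cc].
rewrite -yx; symmetry.
apply: (@clairaut (fun s r => f (y (s, r))) (fun s r => pd j f (y (s, r)))
  (fun s r => pd k f (y (s, r))) (fun z => pd k (pd j f) (y z))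
  (fun z => pd j (pd k f) (y z)) (x 0 j) (x 0 k) 1 ltr01).
- exact: ccy.
- exact: ccy.
- move=> s r _; rewrite yE; under eq_fun do rewrite yE.
  exact (is_derive_slice_pd (upd x k r) j s df).
- move=> s r _; exact (is_derive_slice_pd (upd x j s) k r df).
- move=> s r _; exact (is_derive_slice_pd (upd x j s) k r (dfj j)).
- move=> s r _; rewrite yE; under eq_fun do rewrite yE.
  exact (is_derive_slice_pd (upd x k r) j s (dfj k)).
Qed.

End clairaut.

(** * Time-dependent fields *)

Section time_dependent_fields.
Variables (R : realType) (T : R).
Hypothesis T_gt0 : 0 < T.
Local Notation X := 'rV[R]_3.
Implicit Types (F G : R -> X -> R) (j k : 'I_3).

(** Extending a field from [0, T] by its end values turns continuity on the
    closed interval into plain continuity. *)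
Definition clamp (t : R) : R := Num.max 0 (Num.min t T).

Lemma clamp_in t : 0 <= clamp t <= T.
Proof.
by rewrite /clamp le_max lexx /= ge_max (ltW T_gt0) ge_min lexx orbT.
Qed.

Lemma clamp_id t : 0 <= t <= T -> clamp t = t.
Proof. by move=> /andP[t0 tT]; rewrite /clamp min_l// max_r. Qed.

Lemma continuous_clamp : continuous clamp.
Proof.
move=> t.
apply: (@continuous_max R R (fun=> 0) (fun t => Num.min t T)); first exact: cvg_cst.
by apply: (@continuous_min R R id (fun=> T)); [exact: cvg_id|exact: cvg_cst].
Qed.

Record contK F : Prop := ContK {
  contKE : continuous (fun z : R * X => F (clamp z.1) z.2) }.

Lemma contK_cst (c : R) : contK (fun _ _ => c).
Proof. by split; exact: cont_cst. Qed.

Lemma contKD F G : contK F -> contK G -> contK (fun t x => F t x + G t x).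
Proof. by move=> [cF] [cG]; split; exact: contD. Qed.

Lemma contKM F G : contK F -> contK G -> contK (fun t x => F t x * G t x).
Proof. by move=> [cF] [cG]; split; exact: contM. Qed.

Lemma contKN F : contK F -> contK (fun t x => - F t x).
Proof. by move=> [cF]; split; exact: contN. Qed.

Lemma contKX F n : contK F -> contK (fun t x => F t x ^+ n).
Proof. by move=> [cF]; split; exact: contX. Qed.

Lemma contK_sum (I : Type) (r : seq I) (F : I -> R -> X -> R) :
  (forall i, contK (F i)) -> contK (fun t x => \sum_(i <- r) F i t x).
Proof. by move=> cF; split; apply: cont_sum => i; exact: (contKE (cF i)). Qed.

(** Ordinary derivatives inside the interval and continuity up to its ends are
    all that the energy method asks of a field. *)
Definition dtime F G := forall t x, 0 < t < T -> is_derive t (1 : R) (F^~ x) (G t x).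

(** The class C^n on [0, T] x R^3 in this sense, each derivative in time or
    space counting for one. *)
Fixpoint St n F : Prop := contK F /\
  if n is m.+1 then [/\ forall t, 0 <= t <= T -> pdable (F t),
    forall j, St m (fun t => pd j (F t)) & exists2 G, St m G & dtime F G] else True.

Lemma St_contK n F : St n F -> contK F.
Proof. by case: n => [|n] []. Qed.

Lemma St_pd n F j : St n.+1 F -> St n (fun t => pd j (F t)).
Proof. by case=> _ [_ H _]; exact: H. Qed.

Lemma St_pdable n F t : St n.+1 F -> 0 <= t <= T -> pdable (F t).
Proof. by case=> _ [H _ _]; exact: H. Qed.

Lemma St_dtime n F : St n.+1 F -> exists2 G, St n G & dtime F G.
Proof. by case=> _ [_ _]. Qed.

Lemma contK_cont F t : contK F -> 0 <= t <= T -> continuous (F t).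
Proof.
move=> cF tT x; rewrite -(clamp_id tT).
apply: (@continuous_comp _ _ _ (fun x => (t, x)) (fun z : R * X => F (clamp z.1) z.2)); last exact: (contKE cF).
by apply: continuous_mkpair => [|v]; [exact: cont_cst|exact: cvg_id].
Qed.

Lemma St_Cs n F t : St n F -> 0 <= t <= T -> Cs n (F t).
Proof.
elim: n F => [|n IH] F SF tT.
  by split => //; exact: contK_cont (St_contK SF) tT.
split; first exact: contK_cont (St_contK SF) tT.
split; first exact: St_pdable SF tT.
by move=> j; exact: (IH (fun t => pd j (F t)) (St_pd j SF) tT).
Qed.

Lemma contK_ext F F' : (forall t x, 0 <= t <= T -> F t x = F' t x) -> contK F -> contK F'.
Proof.
move=> FF [cF]; split; rewrite (_ : (fun z : R * X => F' (clamp z.1) z.2) =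
  (fun z : R * X => F (clamp z.1) z.2)); first exact: cF.
by apply/funext => z; rewrite FF// clamp_in.
Qed.

Lemma dtime_ext F F' G : (forall t x, 0 <= t <= T -> F t x = F' t x) -> dtime F G -> dtime F' G.
Proof.
move=> FF dF t x tT; apply: near_eq_is_derive (dF t x tT).
have : \forall s \near t, 0 < s < T.
  have [t0 t1] := andP tT; near=> s; apply/andP; split; near: s.
    exact: lt_nbhsr.
  exact: lt_nbhsl.
by apply: filterS => s /andP[s0 sT]; apply: FF; rewrite !ltW.
Unshelve. all: by end_near. Qed.

Lemma St_ext n F F' : (forall t x, 0 <= t <= T -> F t x = F' t x) -> St n F -> St n F'.
Proof.
elim: n F F' => [|n IH] F F' FF SF.
  by split => //; apply: contK_ext FF _; exact: St_contK SF.
split; first by apply: contK_ext FF _; exact: St_contK SF.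
have E t : 0 <= t <= T -> F t = F' t by move=> tT; apply/funext => x; exact: FF.
split.
- by move=> t tT; rewrite -E//; exact: St_pdable SF tT.
- move=> j; apply: (IH (fun t => pd j (F t))); last exact: St_pd.
  by move=> t x tT; rewrite E.
- by have [G SG dG] := St_dtime SF; exists G => //; exact: dtime_ext FF dG.
Qed.

Lemma StW n F : St n.+1 F -> St n F.
Proof.
elim: n F => [|n IH] F; first by case.
move=> [cF [pF sF [G SG dG]]]; split => //; split => //.
  by move=> j; exact: IH.
by exists G => //; exact: IH.
Qed.

Lemma St_cst n (c : R) : St n (fun _ _ => c).
Proof.
elim: n c => [|n IH] c; split => //; try exact: contK_cst.
split.
- by move=> t _; exact: pdable_cst.
- move=> j; apply: (@St_ext n (fun _ _ => 0)) (IH 0) => t x _.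
  by rewrite pd_cst.
- by exists (fun _ _ => 0) => // t x _; exact: is_derive_cst_fun.
Qed.

Lemma StD n F G : St n F -> St n G -> St n (fun t x => F t x + G t x).
Proof.
elim: n F G => [|n IH] F G SF SG.
  by split => //; apply: contKD; [exact: St_contK SF|exact: St_contK SG].
split; first by apply: contKD; [exact: St_contK SF|exact: St_contK SG].
split.
- by move=> t tT; apply: pdableD; [exact: St_pdable SF tT|exact: St_pdable SG tT].
- move=> j; apply: (@St_ext n (fun t x => pd j (F t) x + pd j (G t) x)).
    by move=> t x tT; rewrite pdD//; [exact: St_pdable SF tT|exact: St_pdable SG tT].
  by apply: IH; exact: St_pd.
- have [F1 SF1 dF1] := St_dtime SF; have [G1 SG1 dG1] := St_dtime SG.
  exists (fun t x => F1 t x + G1 t x); first exact: IH.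
  by move=> t x tT; exact: is_deriveD_fun (dF1 t x tT) (dG1 t x tT).
Qed.

Lemma StZ n (c : R) F : St n F -> St n (fun t x => c * F t x).
Proof.
elim: n F => [|n IH] F SF.
  by split => //; apply: contKM; [exact: contK_cst|exact: St_contK SF].
split; first by apply: contKM; [exact: contK_cst|exact: St_contK SF].
split.
- by move=> t tT; apply: pdableZ; exact: St_pdable SF tT.
- move=> j; apply: (@St_ext n (fun t x => c * pd j (F t) x)).
    by move=> t x tT; rewrite pdZ//; exact: St_pdable SF tT.
  by apply: IH; exact: St_pd.
- have [F1 SF1 dF1] := St_dtime SF.
  exists (fun t x => c * F1 t x); first exact: IH.
  move=> t x tT; apply: (is_derive_eq (is_deriveM_fun (is_derive_cst_fun c t 1) (dF1 t x tT))).
  by rewrite mulr0 addr0.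
Qed.

Lemma StB n F G : St n F -> St n G -> St n (fun t x => F t x - G t x).
Proof.
move=> SF SG; apply: (@St_ext n (fun t x => F t x + (-1) * G t x)).
  by move=> t x _; rewrite mulN1r.
by apply: StD => //; exact: StZ.
Qed.

Lemma StM n F G : St n F -> St n G -> St n (fun t x => F t x * G t x).
Proof.
elim: n F G => [|n IH] F G SF SG.
  by split => //; apply: contKM; [exact: St_contK SF|exact: St_contK SG].
split; first by apply: contKM; [exact: St_contK SF|exact: St_contK SG].
have [SF' SG'] := (StW SF, StW SG).
split.
- by move=> t tT; apply: pdableM; [exact: St_pdable SF tT|exact: St_pdable SG tT].
- move=> j; apply: (@St_ext n (fun t x => F t x * pd j (G t) x + G t x * pd j (F t) x)).
    by move=> t x tT; rewrite pdM//; [exact: St_pdable SF tT|exact: St_pdable SG tT].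
  by apply: StD; apply: IH => //; exact: St_pd.
- have [F1 SF1 dF1] := St_dtime SF; have [G1 SG1 dG1] := St_dtime SG.
  exists (fun t x => F t x * G1 t x + G t x * F1 t x); first by apply: StD; exact: IH.
  by move=> t x tT; exact: is_deriveM_fun (dF1 t x tT) (dG1 t x tT).
Qed.

Lemma St_sum n (I : Type) (r : seq I) (F : I -> R -> X -> R) :
  (forall i, St n (F i)) -> St n (fun t x => \sum_(i <- r) F i t x).
Proof.
move=> SF; elim: r => [|i r IH].
  by apply: St_ext (St_cst n 0) => t x _; rewrite big_nil.
by apply: St_ext (StD (SF i) IH) => t x _; rewrite big_cons.
Qed.

Lemma St_le m n F : (m <= n)%N -> St n F -> St m F.
Proof.
move=> /subnK <-; elim: (n - m)%N => [//|d IH]; rewrite addSn => /StW; exact: IH.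
Qed.

Lemma dtime_eq F G G' : (forall t x, 0 < t < T -> G t x = G' t x) ->
  dtime F G -> dtime F G'.
Proof. by move=> GG dF t x tT; rewrite -GG//; exact: dF. Qed.

Lemma dtimeD F G F' G' : dtime F F' -> dtime G G' ->
  dtime (fun t x => F t x + G t x) (fun t x => F' t x + G' t x).
Proof. by move=> dF dG t x tT; exact: is_deriveD_fun (dF t x tT) (dG t x tT). Qed.

Lemma dtimeZ (c : R) F F' : dtime F F' -> dtime (fun t x => c * F t x) (fun t x => c * F' t x).
Proof.
move=> dF t x tT; apply: (is_derive_eq (is_deriveM_fun (is_derive_cst_fun c t 1) (dF t x tT))).
by rewrite mulr0 addr0.
Qed.

(** [clairaut] in the plane of the variables t and x_k. *)
Lemma dtime_pd F G k : St 2 F -> St 1 G -> dtime F G ->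
  dtime (fun t => pd k (F t)) (fun t => pd k (G t)).
Proof.
move=> SF SG dG t x tT.
have SFk := St_pd k SF.
have [H SH dH] := St_dtime SFk.
apply: (is_derive_eq (dH t x tT)).
have [t0 t1] := andP tT.
pose e := Num.min t (T - t).
have e0 : 0 < e by rewrite lt_min t0 subr_gt0.
have eI s : `|s - t| < e -> 0 < s < T.
  rewrite lt_min !ltr_norml => /andP[/andP[? ?] /andP[? ?]]; apply/andP; split; lra.
have eI' s : `|s - t| < e -> 0 <= s <= T.
  by move=> /eI /andP[? ?]; rewrite !ltW.
pose y (z : R * R) : R * X := (z.1, upd x k z.2).
have cy : continuous y.
  apply: (@continuous_mkpair _ _ _ (fun z : R * R => z.1) (fun z => upd x k z.2)) => w; first exact: cvg_fst.
  apply: (@continuous_comp _ _ _ (fun z : R * R => (x, z.2)) (fun z : X * R => upd z.1 k z.2)); last exact: continuous_upd.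
  by apply: continuous_mkpair => v; [exact: cvg_cst|exact: cvg_snd].
have cc K : contK K -> continuous (fun z => K (clamp (y z).1) (y z).2).
  move=> cK z; apply: (@continuous_comp _ _ _ y (fun z : R * X => K (clamp z.1) z.2)); [exact: cy|exact: (contKE cK)].
have tT' : 0 <= t <= T by rewrite !ltW.
have := @clairaut R (fun s r => F s (upd x k r)) (fun s r => G s (upd x k r))
  (fun s r => pd k (F s) (upd x k r))
  (fun z => pd k (G (clamp z.1)) (upd x k z.2))
  (fun z => H (clamp z.1) (upd x k z.2)) t (x 0 k) e e0.
rewrite /= !clamp_id// upd_id => E; symmetry; apply: E.
- exact: (cc _ (St_contK (St_pd k SG))).
- exact: (cc _ (St_contK SH)).
- by move=> s r /eI sT; exact: dG.
- by move=> s r /eI' sT; exact (is_derive_slice_pd x k r (St_pdable SF sT)).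
- by move=> s r /eI' sT; rewrite clamp_id//; exact (is_derive_slice_pd x k r (St_pdable SG sT)).
- by move=> s r se; rewrite clamp_id ?eI'//; exact: (dH s _ (eI s se)).
Qed.

Lemma contK_bounded F : contK F ->
  exists2 M, 0 < M & forall t x, 0 <= t <= T -> in_cell x -> `|F t x| <= M.
Proof.
move=> cF.
pose g (z : R * (R * R * R)) := F (clamp z.1) (row_of_triple z.2).
have cg : continuous g.
  move=> z; apply: (@continuous_comp _ _ _ (fun z => (z.1, row_of_triple z.2)) (fun z : R * X => F (clamp z.1) z.2)); last exact: (contKE cF).
  apply: (@continuous_mkpair _ _ _ (fun z : R * (R * R * R) => z.1) (fun z => row_of_triple z.2)) => w; first exact: cvg_fst.
  apply: (@continuous_comp _ _ _ snd (@row_of_triple R)); [exact: cvg_snd|exact: continuous_row_of_triple].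
have cK : compact (`[0, T]%classic `*` @torus_cell R).
  by apply: compact_setX; [exact: segment_compact|exact: compact_torus_cell].
have [M M0 HM] := compact_bounded cK cg.
exists M => // t x tT /row_of_tripleP [z zc ->].
have := HM (t, z); rewrite /g /= clamp_id//; apply; split => //=.
Qed.

Lemma continuous_torus_int_clamp F : contK F ->
  continuous (fun t => torus_int (F (clamp t))).
Proof.
move=> cF.
pose g (z : R * (R * R * R)) := F (clamp z.1) (row_of_triple z.2).
have cg : continuous g.
  move=> z; apply: (@continuous_comp _ _ _ (fun z => (z.1, row_of_triple z.2)) (fun z : R * X => F (clamp z.1) z.2)); last exact: (contKE cF).
  apply: (@continuous_mkpair _ _ _ (fun z : R * (R * R * R) => z.1) (fun z => row_of_triple z.2)) => w; first exact: cvg_fst.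
  apply: (@continuous_comp _ _ _ snd (@row_of_triple R)); [exact: cvg_snd|exact: continuous_row_of_triple].
have := @continuous_param_Rintegral _
  (measurableTypeR R * measurableTypeR R * measurableTypeR R)%type R R
  (R * R * R)%type (fun z => z)
  ((@lebesgue_measure R \x @lebesgue_measure R) \x @lebesgue_measure R)%E
  (@torus_cell R) (@torus_cell R) g (@compact_torus_cell R) cg.
apply => //.
- exact: measurable_torus_cell.
- exact: torus_cell_measure1.
- by move=> s; have := integrable_torus (contK_cont cF (clamp_in s)).
Qed.

Lemma torus_int_dtime F G t : contK F -> contK G -> dtime F G -> 0 < t < T ->
  is_derive t (1 : R) (fun t => torus_int (F t)) (torus_int (G t)).
Proof.
move=> cF cG dFG tT.
have [M M0 GM] := contK_bounded cG.
have ci t' : 0 < t' < T -> 0 <= t' <= T by move=> /andP[? ?]; rewrite !ltW.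
pose mu3 := ((@lebesgue_measure R \x @lebesgue_measure R) \x @lebesgue_measure R)%E.
pose f (s : R) (z : R * R * R) := F s (row_of_triple z).
have It : `]0, T[%classic t by rewrite /= in_itv.
have intf s : `]0, T[%classic s -> mu3.-integrable (@torus_cell R) (EFin \o f s).
  rewrite /= in_itv /= => sT.
  by have := integrable_torus (contK_cont cF (ci _ sT)).
have der s z : `]0, T[%classic s -> @torus_cell R z -> derivable (f^~ z) s 1.
  rewrite /= in_itv /= => sT _.
  by have [] := dFG s (row_of_triple z) sT.
have d1E s z : 0 < s < T -> partial1of2 f s z = G s (row_of_triple z).
  move=> sT; rewrite partial1of2E.
  by have [_ <-] := dFG s (row_of_triple z) sT.
have ub s z : `]0, T[%classic s -> @torus_cell R z -> `|partial1of2 f s z| <= M.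
  rewrite /= in_itv /= => sT zc; rewrite d1E//; apply: GM; first exact: ci.
  exact: row_of_triple_cell.
have intM : mu3.-integrable (@torus_cell R) (EFin \o (fun=> M)).
  apply: measurable_bounded_integrable => //; last exact: bounded_cst.
    exact: measurable_torus_cell.
  by rewrite [ltLHS]torus_cell_measure1 ltry.
have dd := @derivable_under_integral R _ _ mu3 f (@torus_cell R) (@measurable_torus_cell R)
  t 0 T It intf der (fun=> M) (fun=> ltW M0) intM ub.
have vv := @differentiation_under_integral R _ _ mu3 f (@torus_cell R) (@measurable_torus_cell R)
  t 0 T It intf der (fun=> M) (fun=> ltW M0) intM ub.
apply: DeriveDef; first exact: dd.
rewrite -derive1E; apply: (etrans vv).
by apply: eq_Rintegral => z _; rewrite d1E.
Qed.

End time_dependent_fields.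

Ltac cont_t := cbv beta; repeat match goal with
  | |- contK _ (fun t x => @?f t x + @?g t x) => apply: (@contKD _ _ f g)
  | |- contK _ (fun t x => @?f t x * @?g t x) => apply: (@contKM _ _ f g)
  | |- contK _ (fun t x => - @?f t x) => apply: (@contKN _ _ f)
  | |- contK _ (fun t x => @?f t x ^+ ?n) => apply: (@contKX _ _ f n)
  | |- contK _ (fun t x => \sum_(i <- ?r) @?f t x i) =>
      apply: contK_sum => ?
  | |- contK _ (fun _ _ => ?c) => apply: (@contK_cst _ _ c)
  | H : contK _ _ |- _ => exact H
  | H : forall i, contK _ _ |- _ => simple apply H
  | H : forall i j, contK _ _ |- _ => simple apply H
  | H : forall i j k, contK _ _ |- _ => simple apply H
  end.

(** * Derivatives relative to a time interval *)

Section bridge.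
Variables (R : realType) (T : R).
Hypothesis T_gt0 : 0 < T.
Local Notation X := 'rV[R]_3.
Implicit Types (I : set R) (f : R -> X -> R).

Lemma is_derive_dt I (g : R -> R) (t : R) : nbhs t I -> derivable_in I g t ->
  is_derive t (1 : R) g (dt I g t).
Proof.
move=> It dg.
have H : (h^-1 *: (g (h *: (1 : R) + t) - g t)) @[h --> (0 : R)^'] --> dt I g t.
  have c : dquot g t s @[s --> within I t^'] --> dt I g t by exact: dg.
  have sh : (h + t) @[h --> (0 : R)^'] --> within I t^'.
    move=> P /nbhs_ballP [e /= e0 eP].
    have /nbhs_ballP [d /= d0 dI] := It.
    apply/nbhs_ballP; exists (Num.min e d) => /=; first by rewrite lt_min e0.
    move=> h; rewrite /ball /= sub0r normrN lt_min => /andP[he hd] h0.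
    apply: eP; rewrite /ball /=.
    - by rewrite opprD addrCA subrr addr0 normrN.
    - by apply/eqP => E; move/eqP: h0; apply; apply: (addIr t); rewrite add0r.
    - by apply: dI; rewrite /ball /= opprD addrCA subrr addr0 normrN.
  have cc := @cvg_comp _ _ _ (fun h : R => h + t) (dquot g t) _ _ _ sh c.
  apply: cvg_trans cc.
  apply: near_eq_cvg; near=> h.
  by rewrite /= /dquot addrK [_%:A]mulr1 mulrC.
by apply: DeriveDef; [apply/cvg_ex; exists (dt I g t)|exact/cvg_lim].
Unshelve. all: by end_near. Qed.

Lemma within_clamp I f : (forall t, 0 <= t <= T -> I t) ->
  {within I `*` setT, continuous (fun z : R * X => f z.1 z.2)} -> contK T f.
Proof.
move=> TI /subspace_continuousP cf; split=> z.
pose h (z : R * X) : R * X := (clamp T z.1, z.2).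
have Ih y : (I `*` setT) (h y) by split => //=; apply: TI; exact: clamp_in.
have ch : continuous h.
  apply: (@continuous_mkpair _ _ _ (fun z : R * X => clamp T z.1) (fun z => z.2)) => w; last exact: cvg_snd.
  by apply: (@continuous_comp _ _ _ fst (clamp T)); [exact: cvg_fst|exact: continuous_clamp].
have hw : h y @[y --> z] --> within (I `*` setT) (nbhs (h z)).
  move=> P HP; have hz := ch z _ (HP : nbhs (h z) (fun w => (I `*` setT) w -> P w)).
  change (nbhs z (h @^-1` P)).
  by apply: filterS (hz : nbhs z (h @^-1` _)) => y Py; exact: Py (Ih y).
exact: (@cvg_comp _ _ _ h (fun z : R * X => f z.1 z.2) _ _ _ hw (cf (h z) (Ih z))).
Qed.

Lemma interior_nbhs I t : (forall t, 0 <= t <= T -> I t) -> 0 < t < T -> nbhs t I.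
Proof.
move=> TI /andP[t0 tT]; near=> s; apply: TI; apply/andP; split; apply/ltW; near: s.
  exact: lt_nbhsr.
exact: lt_nbhsl.
Unshelve. all: by end_near. Qed.

Lemma Ck_dtime I n f : (forall t, 0 <= t <= T -> I t) -> Ck I n.+1 f ->
  dtime T f (fun t x => dt I (f^~ x) t).
Proof.
move=> TI [_ [dtf _ _ _]] t x tT; apply: is_derive_dt; first exact: interior_nbhs.
by apply: dtf; apply: TI; move: tT => /andP[? ?]; rewrite !ltW.
Qed.

Lemma Ck_St I n f : (forall t, 0 <= t <= T -> I t) -> Ck I n f -> St T n f.
Proof.
move=> TI; elim: n f => [|n IH] f.
  by move=> [cf _]; split => //; exact: within_clamp cf.
move=> C; split; first by case: C => cf _; exact: within_clamp cf.
have dF := Ck_dtime TI C.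
case: C => _ [_ df Cdt Cpd]; split.
- by move=> t tT j x; apply: df; exact: TI.
- by move=> j; apply: IH; exact: Cpd.
- by exists (fun t x => dt I (f^~ x) t) => //; exact: IH.
Qed.

End bridge.

(** * The energy of the linear relaxation system *)

(** Young on the sources, the damping term of D absorbing what its source
    produces. The last line collects the transport terms. *)
Lemma energy_algebra (K : realFieldType) (eps del : K) (a G Pb : 'I_3 -> K) (b F : K)
  (D H P Q : 'I_3 -> 'I_3 -> K) : 0 < eps -> 0 < del ->
  \sum_i (2 * a i * (G i - \sum_j P i j - Pb i))
  + eps * (2 * b * (eps^-1 * (F - \sum_j Q j j)))
  + del * \sum_i \sum_j (2 * D i j * (del^-1 * (H i j - D i j - Q i j))) <=
  \sum_i a i ^+ 2 + eps * b ^+ 2 + del * \sum_i \sum_j D i j ^+ 2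
  + \sum_i G i ^+ 2 + eps^-1 * F ^+ 2 + \sum_i \sum_j H i j ^+ 2
  + (-2) * (\sum_i \sum_j (a i * P i j + D i j * Q i j) + \sum_i (a i * Pb i + b * Q i i)).
Proof.
move=> eps0 del0.
have HaG i : 2 * a i * G i <= a i ^+ 2 + G i ^+ 2.
  have := sqr_ge0 (a i - G i); rewrite sqrrB; move: (a i) (G i) => x y; lra.
have HbF : 2 * b * F <= eps * b ^+ 2 + eps^-1 * F ^+ 2.
  have : 0 <= eps^-1 * (eps * b - F) ^+ 2 by rewrite mulr_ge0 ?sqr_ge0 ?invr_ge0 ?ltW.
  have -> : eps^-1 * (eps * b - F) ^+ 2 = eps * b ^+ 2 - 2 * b * F + eps^-1 * F ^+ 2.
    by field; rewrite gt_eqF.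
  lra.
have HDH i j : 2 * D i j * (H i j - D i j) <= H i j ^+ 2.
  have := sqr_ge0 (D i j - H i j); rewrite sqrrB; have := sqr_ge0 (D i j).
  move: (D i j) (H i j) => x y; rewrite mulrBr; lra.
have -> : eps * (2 * b * (eps^-1 * (F - \sum_j Q j j))) = 2 * b * F - 2 * b * \sum_j Q j j.
  by move: (\sum_j _) => q; field; rewrite gt_eqF.
have -> : del * \sum_i \sum_j (2 * D i j * (del^-1 * (H i j - D i j - Q i j))) =
  \sum_i \sum_j (2 * D i j * (H i j - D i j)) - 2 * \sum_i \sum_j D i j * Q i j.
  rewrite !mulr_sumr -sumrB; apply: eq_bigr => i _.
  rewrite !mulr_sumr -sumrB; apply: eq_bigr => j _.
  by move: (D i j) (H i j) (Q i j) => x y z; field; rewrite gt_eqF.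
have -> : \sum_i (2 * a i * (G i - \sum_j P i j - Pb i)) =
  \sum_i 2 * a i * G i - 2 * \sum_i \sum_j a i * P i j - 2 * \sum_i a i * Pb i.
  rewrite !mulr_sumr -!sumrB; apply: eq_bigr => i _.
  by rewrite -mulr_sumr; move: (\sum_j _) => q; ring.
have -> : \sum_i \sum_j (a i * P i j + D i j * Q i j) =
  \sum_i \sum_j a i * P i j + \sum_i \sum_j D i j * Q i j.
  by rewrite -big_split; apply: eq_bigr => i _; rewrite -big_split.
have -> : \sum_i (a i * Pb i + b * Q i i) = \sum_i a i * Pb i + b * \sum_i Q i i.
  by rewrite mulr_sumr -big_split.
have H1 : \sum_i 2 * a i * G i <= \sum_i a i ^+ 2 + \sum_i G i ^+ 2.
  by rewrite -big_split; apply: ler_sum => i _; exact: HaG.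
have H2 : \sum_i \sum_j (2 * D i j * (H i j - D i j)) <= \sum_i \sum_j H i j ^+ 2.
  by apply: ler_sum => i _; apply: ler_sum => j _; exact: HDH.
have H3 : 0 <= del * \sum_i \sum_j D i j ^+ 2.
  by rewrite mulr_ge0 ?(ltW del0)// sumr_ge0// => i _; rewrite sumr_ge0// => j _; exact: sqr_ge0.
move: H1 H2 H3 HbF.
move: (\sum_i 2 * a i * G i) (\sum_i a i ^+ 2) (\sum_i G i ^+ 2)
  (\sum_i \sum_j (2 * D i j * (H i j - D i j))) (\sum_i \sum_j H i j ^+ 2)
  (del * \sum_i \sum_j D i j ^+ 2) (\sum_i \sum_j a i * P i j)
  (\sum_i \sum_j D i j * Q i j) (\sum_i a i * Pb i) (\sum_i Q i i)
  (eps * b ^+ 2) (eps^-1 * F ^+ 2) => *.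
lra.
Qed.

Section energy.
Variables (R : realType) (T : R).
Hypothesis T_gt0 : 0 < T.
Local Notation X := 'rV[R]_3.
Variables (eps del : R).
Hypotheses (eps_gt0 : 0 < eps) (del_gt0 : 0 < del).
Implicit Types (b F : R -> X -> R) (a G : 'I_3 -> R -> X -> R)
  (D H : 'I_3 -> 'I_3 -> R -> X -> R).

Definition energy_density a b D (t : R) (x : X) : R :=
  \sum_i a i t x ^+ 2 + eps * b t x ^+ 2 + del * \sum_i \sum_j D i j t x ^+ 2.

Definition energy a b D (t : R) : R := torus_int (energy_density a b D t).

(** The relaxation system for (velocity, pressure, flux) = (a, b, D), with
    sources G, F and H. The order n counts the derivatives that can still be
    taken. *)
Record hyperbolic_system n a b D F G H : Prop := HyperbolicSystem {
  hs_a : forall i, St T n.+1 (a i);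
  hs_b : St T n.+1 b;
  hs_D : forall i j, St T n.+1 (D i j);
  hs_pa : forall i t, 0 <= t <= T -> Defs.periodic (a i t);
  hs_pb : forall t, 0 <= t <= T -> Defs.periodic (b t);
  hs_pD : forall i j t, 0 <= t <= T -> Defs.periodic (D i j t);
  hs_F : St T n F;
  hs_G : forall i, St T n (G i);
  hs_H : forall i j, St T n (H i j);
  hs_dta : forall i, dtime T (a i)
    (fun t x => G i t x - \sum_j pd j (D i j t) x - pd i (b t) x);
  hs_dtb : dtime T b (fun t x => eps^-1 * (F t x - \sum_j pd j (a j t) x));
  hs_dtD : forall i j, dtime T (D i j)
    (fun t x => del^-1 * (H i j t x - D i j t x - pd j (a i t) x)) }.

(** The transport terms add up to the divergence of a_i D_ij and a_i b, and
    integrate to zero. *)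
Lemma energy_derive a b D F G H t : hyperbolic_system 0 a b D F G H -> 0 < t < T ->
  exists2 de, is_derive t (1 : R) (energy a b D) de &
    de <= energy a b D t + \sum_i l2sq (G i t) + eps^-1 * l2sq (F t)
          + \sum_i \sum_j l2sq (H i j t).
Proof.
move=> S tT; have [Sa Sb SD pa pb pD] := S.
move=> SF SG SH dta dtb dtD.
have cF := St_contK SF. have cG i := St_contK (SG i). have cH i j := St_contK (SH i j).
have tT' : 0 <= t <= T by move: tT => /andP[? ?]; rewrite !ltW.
have ca i := St_contK (Sa i). have cb := St_contK Sb. have cD i j := St_contK (SD i j).
have cpa i j := St_contK (St_pd j (Sa i)).
have cpb j := St_contK (St_pd j Sb).
have cpD i j k := St_contK (St_pd k (SD i j)).
pose da i t x := G i t x - \sum_j pd j (D i j t) x - pd i (b t) x.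
pose db t x := eps^-1 * (F t x - \sum_j pd j (a j t) x).
pose dD i j t x := del^-1 * (H i j t x - D i j t x - pd j (a i t) x).
pose dens t x := \sum_i (2 * a i t x * da i t x) + eps * (2 * b t x * db t x)
  + del * \sum_i \sum_j (2 * D i j t x * dD i j t x).
have cda i : contK T (da i) by rewrite /da; cont_t.
have cdb : contK T db by rewrite /db; cont_t.
have cdD i j : contK T (dD i j) by rewrite /dD; cont_t.
have cdens : contK T dens by rewrite /dens; cont_t.
have ced : contK T (energy_density a b D) by rewrite /energy_density; cont_t.
have ddens : dtime T (energy_density a b D) dens.
  move=> s x sT.
  have sq (f : R -> R) (d : R) : is_derive s (1 : R) f d ->
      is_derive s (1 : R) (fun s => f s ^+ 2) (2 * f s * d).
    by move=> h; apply: (is_derive_eq (is_deriveM_fun h h)); ring.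
  apply: is_deriveD_fun; first apply: is_deriveD_fun.
  - by apply: is_derive_sum_fun => i; exact: (sq _ _ (dta i s x sT)).
  - apply: (is_derive_eq (is_deriveM_fun (is_derive_cst_fun eps s 1) (sq _ _ (dtb s x sT)))).
    by rewrite mulr0 addr0.
  - have h : is_derive s (1 : R) (fun s => \sum_i \sum_j D i j s x ^+ 2)
        (\sum_i \sum_j (2 * D i j s x * dD i j s x)).
      apply: is_derive_sum_fun => i; apply: is_derive_sum_fun => j.
      exact: (sq _ _ (dtD i j s x sT)).
    apply: (is_derive_eq (is_deriveM_fun (is_derive_cst_fun del s 1) h)).
    by rewrite mulr0 addr0.
exists (torus_int (dens t)); first exact: (torus_int_dtime ced cdens ddens tT).
(* the transport terms form a divergence *)
pose div x := \sum_i \sum_j pd j (fun x => a i t x * D i j t x) x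
              + \sum_i pd i (fun x => a i t x * b t x) x.
have Ca i := St_Cs (Sa i) tT'. have Cb := St_Cs Sb tT'. have CD i j := St_Cs (SD i j) tT'.
have CaD i j : Cs 1 (fun x => a i t x * D i j t x) by exact: CsM.
have Cab i : Cs 1 (fun x => a i t x * b t x) by exact: CsM.
have cdiv1 i j := Cs_pd_cont (j := j) (CaD i j).
have cdiv2 i := Cs_pd_cont (j := i) (Cab i).
have cdiv : continuous div by rewrite /div; cont.
have Idiv : torus_int div = 0.
  rewrite /div torus_intD; [|by cont..].
  rewrite torus_int_sum; last by move=> i; cont.
  rewrite torus_int_sum; last by move=> i; cont.
  rewrite !big1 ?addr0// => i _.
    by apply: torus_int_div => // k x; rewrite pa// pb.
  rewrite torus_int_sum; last by move=> j; cont.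
  by rewrite big1// => j _; apply: torus_int_div => // k x; rewrite pa// pD.
have cGt i := contK_cont (cG i) tT'. have cFt := contK_cont cF tT'.
have cHt i j := contK_cont (cH i j) tT'.
have cdenst := contK_cont cdens tT'. have cedt := contK_cont ced tT'.
pose rhs x := energy_density a b D t x + \sum_i G i t x ^+ 2 + eps^-1 * F t x ^+ 2
  + \sum_i \sum_j H i j t x ^+ 2 + (-2) * div x.
have crhs : continuous rhs by rewrite /rhs; cont.
have P x : dens t x <= rhs x.
  have E1 : \sum_i \sum_j pd j (fun x => a i t x * D i j t x) x =
      \sum_i \sum_j (a i t x * pd j (D i j t) x + D i j t x * pd j (a i t) x).
    apply: eq_bigr => i _; apply: eq_bigr => j _.
    by rewrite (pdM (Cs_pdable (Ca i)) (Cs_pdable (CD i j))).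
  have E2 : \sum_i pd i (fun x => a i t x * b t x) x =
      \sum_i (a i t x * pd i (b t) x + b t x * pd i (a i t) x).
    by apply: eq_bigr => i _; rewrite (pdM (Cs_pdable (Ca i)) (Cs_pdable Cb)).
  rewrite /rhs /div E1 E2 /dens /energy_density /da /db /dD {E1 E2}.
  exact: energy_algebra.
apply: le_trans (le_torus_int cdenst crhs P) _.
rewrite /rhs /energy; move: (energy_density a b D t) cedt => ed cedt.
rewrite !torus_intD; [|by cont..].
rewrite !torus_intZ; [|by cont..].
rewrite Idiv mulr0 addr0 /l2sq.
rewrite torus_int_sum; last by move=> i; cont.
rewrite torus_int_sum; last by move=> i; cont.
by rewrite lerD2l; apply: ler_sum => i _; rewrite torus_int_sum// => j; cont.
Qed.

Lemma continuous_energy a b D F G H : hyperbolic_system 0 a b D F G H ->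
  continuous (fun t => energy a b D (clamp T t)).
Proof.
move=> [Sa Sb SD _ _ _ _ _ _ _ _ _].
have ca i := St_contK (Sa i). have cb := St_contK Sb. have cD i j := St_contK (SD i j).
have ced : contK T (energy_density a b D) by rewrite /energy_density; cont_t.
exact: continuous_torus_int_clamp.
Qed.

End energy.

(** * Differentiating and shifting the system *)

(* From here on, partial derivatives are used only through their calculus. *)
Opaque pd.

Section derived_systems.
Variables (R : realType) (T : R).
Hypothesis T_gt0 : 0 < T.
Local Notation X := 'rV[R]_3.
Variables (eps del : R).
Hypotheses (eps_gt0 : 0 < eps) (del_gt0 : 0 < del).
Implicit Types (b F : R -> X -> R) (a G : 'I_3 -> R -> X -> R)
  (D H : 'I_3 -> 'I_3 -> R -> X -> R) (k : 'I_3).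
Local Notation dx k f := (fun t => pd k (f t)).

Lemma pdB (f g : X -> R) j : pdable f -> pdable g ->
  pd j (fun x => f x - g x) = (fun x => pd j f x - pd j g x).
Proof. by move=> df dg; rewrite (pdD df (pdableN dg)) pdN. Qed.

Lemma pdableB (f g : X -> R) : pdable f -> pdable g -> pdable (fun x => f x - g x).
Proof. by move=> df dg; exact: pdableD df (pdableN dg). Qed.

Lemma hs_pd n a b D F G H k : hyperbolic_system T eps del n.+1 a b D F G H ->
  hyperbolic_system T eps del n (fun i => dx k (a i)) (dx k b) (fun i j => dx k (D i j))
    (dx k F) (fun i => dx k (G i)) (fun i j => dx k (H i j)).
Proof.
move=> [Sa Sb SD pa pb pD SF SG SH dta dtb dtD].
have le2 : (2 <= n.+2)%N by [].
have le1 : (1 <= n.+1)%N by [].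
have inI t : 0 < t < T -> 0 <= t <= T by move=> /andP[? ?]; rewrite !ltW.
split.
- by move=> i; exact: St_pd.
- exact: St_pd.
- by move=> i j; exact: St_pd.
- by move=> i t tT; apply: periodic_pd; exact: pa.
- by move=> t tT; apply: periodic_pd; exact: pb.
- by move=> i j t tT; apply: periodic_pd; exact: pD.
- exact: St_pd.
- by move=> i; exact: St_pd.
- by move=> i j; exact: St_pd.
- move=> i.
  have SR : St T n.+1 (fun t x => G i t x - \sum_j pd j (D i j t) x - pd i (b t) x).
    apply: (StB T_gt0) (St_pd i Sb); apply: (StB T_gt0 (SG i)).
    by apply: (@St_sum _ _ T_gt0 n.+1 _ _ (fun j => dx j (D i j))) => j; exact: St_pd.
  apply: (dtime_eq _ (dtime_pd k (St_le le2 (Sa i)) (St_le le1 SR) (dta i))) => t x tT.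
  have tT' := inI t tT.
  have d1 := St_pdable (SG i) tT'.
  have d2 j := St_pdable (St_pd j (SD i j)) tT'.
  have d3 := St_pdable (St_pd i Sb) tT'.
  have ds := @pdable_sum R _ (index_enum 'I_3) _ d2.
  have C j := St_Cs (St_le le2 (SD i j)) tT'.
  have Cb := St_Cs (St_le le2 Sb) tT'.
  have E1 : pd k (fun x => G i t x - \sum_j pd j (D i j t) x - pd i (b t) x) x =
      pd k (G i t) x - \sum_j pd k (pd j (D i j t)) x - pd k (pd i (b t)) x.
    by rewrite (pdB k (pdableB d1 ds) d3) (pdB k d1 ds) (@pd_sum R _ (index_enum 'I_3) _ d2 k).
  have Es : \sum_j pd k (pd j (D i j t)) x = \sum_j pd j (pd k (D i j t)) x.
    by apply: eq_bigr => j _; rewrite (pd_comm k j (C j)).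
  have Eb : pd k (pd i (b t)) x = pd i (pd k (b t)) x by rewrite (pd_comm k i Cb).
  exact (etrans E1 (f_equal2 (fun u v => pd k (G i t) x - u - v) Es Eb)).
- have SR : St T n.+1 (fun t x => eps^-1 * (F t x - \sum_j pd j (a j t) x)).
    apply: (StZ T_gt0); apply: (StB T_gt0 SF).
    by apply: (@St_sum _ _ T_gt0 n.+1 _ _ (fun j => dx j (a j))) => j; exact: St_pd.
  apply: (dtime_eq _ (dtime_pd k (St_le le2 Sb) (St_le le1 SR) dtb)) => t x tT.
  have tT' := inI t tT.
  have d1 := St_pdable SF tT'.
  have d2 j := St_pdable (St_pd j (Sa j)) tT'.
  have ds := @pdable_sum R _ (index_enum 'I_3) _ d2.
  have C j := St_Cs (St_le le2 (Sa j)) tT'.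
  have E1 : pd k (fun x => eps^-1 * (F t x - \sum_j pd j (a j t) x)) x =
      eps^-1 * (pd k (F t) x - \sum_j pd k (pd j (a j t)) x).
    by rewrite (pdZ eps^-1 (pdableB d1 ds)) (pdB k d1 ds) (@pd_sum R _ (index_enum 'I_3) _ d2 k).
  have Es : \sum_j pd k (pd j (a j t)) x = \sum_j pd j (pd k (a j t)) x.
    by apply: eq_bigr => j _; rewrite (pd_comm k j (C j)).
  exact (etrans E1 (f_equal (fun u => eps^-1 * (pd k (F t) x - u)) Es)).
- move=> i j.
  have SR : St T n.+1 (fun t x => del^-1 * (H i j t x - D i j t x - pd j (a i t) x)).
    exact: (StZ T_gt0 _ (StB T_gt0 (StB T_gt0 (SH i j) (StW (SD i j))) (St_pd j (Sa i)))).
  apply: (dtime_eq _ (dtime_pd k (St_le le2 (SD i j)) (St_le le1 SR) (dtD i j))) => t x tT.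
  have tT' := inI t tT.
  have d1 := St_pdable (SH i j) tT'.
  have d2 := St_pdable (SD i j) tT'.
  have d3 := St_pdable (St_pd j (Sa i)) tT'.
  have C := St_Cs (St_le le2 (Sa i)) tT'.
  have E1 : pd k (fun x => del^-1 * (H i j t x - D i j t x - pd j (a i t) x)) x =
      del^-1 * (pd k (H i j t) x - pd k (D i j t) x - pd k (pd j (a i t)) x).
    by rewrite (pdZ del^-1 (pdableB (pdableB d1 d2) d3)) (pdB k (pdableB d1 d2) d3) (pdB k d1 d2).
  have Ea : pd k (pd j (a i t)) x = pd j (pd k (a i t)) x by rewrite (pd_comm k j C).
  exact (etrans E1 (f_equal (fun u => del^-1 * (pd k (H i j t) x - pd k (D i j t) x - u)) Ea)).
Qed.

(** A source of size eps in the first equation enters the energy estimate as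
    eps^-1 eps^2 = eps, which is too much. This one is minus the divergence of
    eps p1 e_k: adding that field to the velocity removes it and leaves
    sources of size eps in the other two equations, where they count as eps^2.
    *)
Lemma hs_shift a b D F G H k (p1 p2 : R -> X -> R) :
  hyperbolic_system T eps del 1 a b D F G H ->
  (forall t x, 0 < t < T -> F t x = - eps * pd k (p1 t) x) ->
  St T 2 p1 -> St T 1 p2 -> dtime T p1 p2 ->
  (forall t, 0 <= t <= T -> Defs.periodic (p1 t)) ->
  hyperbolic_system T eps del 0
    (fun i t x => a i t x + eps * (i == k)%:R * p1 t x) b D (fun _ _ => 0)
    (fun i t x => G i t x + eps * (i == k)%:R * p2 t x)
    (fun i j t x => H i j t x + eps * (i == k)%:R * pd j (p1 t) x).
Proof.
move=> [Sa Sb SD pa pb pD SF SG SH dta dtb dtD] FE Sp1 Sp2 dp pp.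
have inI t : 0 < t < T -> 0 <= t <= T by move=> /andP[? ?]; rewrite !ltW.
have E i j t x : 0 < t < T -> pd j (fun x => a i t x + eps * (i == k)%:R * p1 t x) x =
    pd j (a i t) x + eps * (i == k)%:R * pd j (p1 t) x.
  move=> /inI tT; have d1 := St_pdable (Sa i) tT; have d2 := St_pdable Sp1 tT.
  by rewrite (pdD d1 (@pdableZ R (eps * (i == k)%:R) _ d2)) (@pdZ R (eps * (i == k)%:R) _ d2).
split.
- by move=> i; exact: (StD T_gt0 (StW (Sa i)) (StZ T_gt0 _ (StW Sp1))).
- exact: StW.
- by move=> i j; exact: StW.
- by move=> i t tT j x; rewrite (pa i t tT) (pp t tT).
- exact: pb.
- exact: pD.
- exact: (St_cst T_gt0).
- by move=> i; exact: (StD T_gt0 (StW (SG i)) (StZ T_gt0 _ (StW Sp2))).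
- by move=> i j; exact: (StD T_gt0 (StW (SH i j)) (StZ T_gt0 _ (StW (St_pd j Sp1)))).
- move=> i; apply: (dtime_eq _ (dtimeD (dta i) (dtimeZ (eps * (i == k)%:R) dp))) => t x tT.
  by rewrite addrAC (addrAC _ _ (- \sum_j _)).
- apply: (dtime_eq _ dtb) => t x tT; congr (_ * _); rewrite FE//.
  under [in RHS]eq_bigr do rewrite E//.
  rewrite big_split /= [X in _ = 0 - (_ + X)](bigD1 k)//= eqxx mulr1.
  rewrite [X in _ + (_ + X)]big1 ?addr0; last first.
    by move=> j /negbTE ->; rewrite mulr0 mul0r.
  by rewrite sub0r opprD mulNr addrC.
- move=> i j; apply: (dtime_eq _ (dtD i j)) => t x tT; congr (_ * _).
  rewrite E//; move: (H i j t x) (D i j t x) (pd j (a i t) x) (pd j (p1 t) x) => h d e f.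
  ring.
Qed.

End derived_systems.

(** * Square-integral bounds for products *)

Section static_estimates.
Variable R : realType.
Local Notation X := 'rV[R]_3.
Implicit Types (f g : X -> R) (k l : 'I_3) (A B M : R).

Lemma l2sqD f g : continuous f -> continuous g ->
  l2sq (fun x => f x + g x) <= 2 * l2sq f + 2 * l2sq g.
Proof.
move=> cf cg; rewrite /l2sq.
rewrite -(torus_intZ 2 (f := fun x => f x ^+ 2)); last by cont.
rewrite -(torus_intZ 2 (f := fun x => g x ^+ 2)); last by cont.
rewrite -torus_intD; [|by cont..].
apply: le_torus_int => [||x]; [by cont..|].
have := sqr_ge0 (f x - g x); rewrite sqrrB sqrrD; move: (f x) (g x) => a b; lra.
Qed.

Lemma l2sqN f : l2sq (fun x => - f x) = l2sq f.
Proof. by apply: eq_torus_int => x; rewrite sqrrN. Qed.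

Lemma l2sqZ (c : R) f : continuous f -> l2sq (fun x => c * f x) = c ^+ 2 * l2sq f.
Proof.
move=> cf; rewrite /l2sq -torus_intZ; last by cont.
by apply: eq_torus_int => x; rewrite exprMn.
Qed.

Lemma l2sqM A f g : continuous f -> continuous g ->
  (forall x, in_cell x -> f x ^+ 2 <= A) -> l2sq (fun x => f x * g x) <= A * l2sq g.
Proof.
move=> cf cg fA; rewrite /l2sq -torus_intZ; last by cont.
apply: le_torus_int_cell => [||x xc]; [by cont..|].
by rewrite exprMn ler_wpM2r ?sqr_ge0// fA.
Qed.

Lemma l2sq_bounded A f : continuous f -> (forall x, in_cell x -> f x ^+ 2 <= A) ->
  l2sq f <= A.
Proof.
move=> cf fA; rewrite -[leRHS](torus_int_cst A).
by apply: le_torus_int_cell => [||x xc]; [cont|exact: cont_cst|exact: fA].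
Qed.

Lemma torus_int_sqr_le f : continuous f -> torus_int f ^+ 2 <= l2sq f.
Proof.
move=> cf; set m := torus_int f.
have : 0 <= torus_int (fun x => f x ^+ 2 + (- 2 * m) * f x + m ^+ 2).
  apply: torus_int_ge0 => x; have := sqr_ge0 (f x - m); rewrite sqrrB.
  move: (f x) m => a b; lra.
rewrite !torus_intD; [|by cont..].
rewrite torus_intZ// torus_int_cst -/(l2sq f) -/m; move: (l2sq f) m => a b; nra.
Qed.

Lemma term_le_sum (F : 'I_3 -> R) k : (forall j, 0 <= F j) -> F k <= \sum_j F j.
Proof. by move=> F0; rewrite (bigD1 k)//= lerDl sumr_ge0. Qed.

Lemma l2sq_le_d1sq f k : l2sq (pd k f) <= d1sq f.
Proof. exact (term_le_sum (F := fun j => l2sq (pd j f)) k (fun j => l2sq_ge0 _)). Qed.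

Lemma l2sq_le_d2sq f k l : l2sq (pd l (pd k f)) <= d2sq f.
Proof.
apply: le_trans (l2sq_le_d1sq (pd k f) l) _.
exact (term_le_sum (F := fun j => d1sq (pd j f)) k (fun j => d1sq_ge0 _)).
Qed.

Lemma l2sq_mul_quartic f g (Q : R) : continuous f -> continuous g ->
  torus_int (fun x => f x ^+ 4) <= Q -> torus_int (fun x => g x ^+ 4) <= Q ->
  l2sq (fun x => f x * g x) <= Q.
Proof.
move=> cf cg fQ gQ.
have : l2sq (fun x => f x * g x) <= torus_int (fun x => 2^-1 * f x ^+ 4 + 2^-1 * g x ^+ 4).
  apply: le_torus_int => [||x]; [by cont..|].
  move: (f x) (g x) => y z; have := sqr_ge0 (y ^+ 2 - z ^+ 2).
  have -> : (y ^+ 2 - z ^+ 2) ^+ 2 = y ^+ 4 - 2 * (y * z) ^+ 2 + z ^+ 4 by ring.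
  lra.
rewrite torus_intD; [|by cont..].
rewrite !torus_intZ; [|by cont..].
move: fQ gQ; gen_int; move: (l2sq _) => *; lra.
Qed.

Lemma l2sqE f : l2sq f = torus_int (fun x => f x ^+ 2). Proof. by []. Qed.
Lemma d1sqE f : d1sq f = \sum_j l2sq (pd j f). Proof. by []. Qed.
Lemma d2sqE f : d2sq f = \sum_j \sum_k l2sq (pd k (pd j f)). Proof. by []. Qed.

Lemma poincare_l2sq f : Cs 1 f -> l2sq f <= torus_int f ^+ 2 + d1sq f.
Proof.
move=> Cf; apply: poincare; [exact: Cs_cont Cf| |by move=> j; exact: Cs_pd_cont Cf].
exact: Cs_pdable Cf.
Qed.

(* From here on, integrals are used only through their properties. *)
Opaque torus_int l2sq d1sq d2sq.

Lemma l2sq_pdM f g k (F F' : R) : Cs 1 f -> Cs 1 g ->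
  l2sq (fun x => f x * pd k g x) <= F -> l2sq (fun x => g x * pd k f x) <= F' ->
  l2sq (pd k (fun x => f x * g x)) <= 2 * F + 2 * F'.
Proof.
move=> Cf Cg HF HF'.
rewrite (pdM (Cs_pdable Cf) (Cs_pdable Cg)).
have [cf cg] := (Cs_cont Cf, Cs_cont Cg).
have [cfk cgk] := (Cs_pd_cont (j := k) Cf, Cs_pd_cont (j := k) Cg).
have c1 : continuous (fun x => f x * pd k g x) by cont.
have c2 : continuous (fun x => g x * pd k f x) by cont.
apply: (le_trans (l2sqD c1 c2)).
have two : 0 <= 2 :> R by [].
exact (lerD (ler_wpM2l two HF) (ler_wpM2l two HF')).
Qed.

Lemma l2sq_pd_ww f g k M (a1 : R) : Cs 1 f -> Cs 1 g ->
  (forall x, in_cell x -> f x ^+ 2 <= M) -> (forall x, in_cell x -> g x ^+ 2 <= M) ->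
  0 <= M -> l2sq (pd k f) <= a1 -> l2sq (pd k g) <= a1 ->
  l2sq (pd k (fun x => f x * g x)) <= 4 * (M * a1).
Proof.
move=> Cf Cg fM gM M0 f1 g1.
have -> : 4 * (M * a1) = 2 * (M * a1) + 2 * (M * a1) by ring.
have [cf cg] := (Cs_cont Cf, Cs_cont Cg).
have [cfk cgk] := (Cs_pd_cont (j := k) Cf, Cs_pd_cont (j := k) Cg).
apply: (l2sq_pdM Cf Cg).
- exact (le_trans (l2sqM cf cgk fM) (ler_wpM2l M0 g1)).
- exact (le_trans (l2sqM cg cfk gM) (ler_wpM2l M0 f1)).
Qed.

Lemma l2sq_pd_uw f g k B (a0 a1 : R) : Cs 1 f -> Cs 1 g ->
  (forall x, in_cell x -> f x ^+ 2 <= B) -> (forall x, in_cell x -> pd k f x ^+ 2 <= B) ->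
  0 <= B -> l2sq g <= a0 -> l2sq (pd k g) <= a1 ->
  l2sq (pd k (fun x => f x * g x)) <= 2 * (B * (a0 + a1)).
Proof.
move=> Cf Cg fB fkB B0 g0 g1.
have -> : 2 * (B * (a0 + a1)) = 2 * (B * a1) + 2 * (B * a0) by ring.
have [cf cg] := (Cs_cont Cf, Cs_cont Cg).
have [cfk cgk] := (Cs_pd_cont (j := k) Cf, Cs_pd_cont (j := k) Cg).
apply: (l2sq_pdM Cf Cg).
- exact (le_trans (l2sqM cf cgk fB) (ler_wpM2l B0 g1)).
- have -> : (fun x => g x * pd k f x) = (fun x => pd k f x * g x).
    by apply/funext => x; rewrite mulrC.
  exact (le_trans (l2sqM cfk cg fkB) (ler_wpM2l B0 g0)).
Qed.

Lemma pd_pdM f g k l : Cs 2 f -> Cs 2 g ->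
  pd l (pd k (fun x => f x * g x)) =
  fun x => (f x * pd l (pd k g) x + pd k g x * pd l f x)
           + (g x * pd l (pd k f) x + pd k f x * pd l g x).
Proof.
move=> Cf Cg; rewrite (pdM (Cs_pdable Cf) (Cs_pdable Cg)).
have [df dg] := (Cs_pdable Cf, Cs_pdable Cg).
have [dfk dgk] := (Cs_pdable (Cs_pd k Cf), Cs_pdable (Cs_pd k Cg)).
by rewrite (pdD (pdableM df dgk) (pdableM dg dfk)) (pdM df dgk) (pdM dg dfk).
Qed.

Lemma l2sq_pd_pdM f g k l (F1 F2 F3 F4 : R) : Cs 2 f -> Cs 2 g ->
  l2sq (fun x => f x * pd l (pd k g) x) <= F1 ->
  l2sq (fun x => pd k g x * pd l f x) <= F2 ->
  l2sq (fun x => g x * pd l (pd k f) x) <= F3 ->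
  l2sq (fun x => pd k f x * pd l g x) <= F4 ->
  l2sq (pd l (pd k (fun x => f x * g x))) <= 4 * (F1 + F2 + F3 + F4).
Proof.
have ub (x y z X Y : R) : z <= 2 * x + 2 * y -> x <= X -> y <= Y -> z <= 2 * X + 2 * Y.
  by move=> ? ? ?; lra.
move=> Cf Cg H1 H2 H3 H4; rewrite (pd_pdM k l Cf Cg).
have [cf cg] := (Cs_cont Cf, Cs_cont Cg).
have cf1 i := Cs_pd_cont (j := i) Cf; have cg1 i := Cs_pd_cont (j := i) Cg.
have cf2 i j := Cs_pd_cont (j := i) (Cs_pd j Cf).
have cg2 i j := Cs_pd_cont (j := i) (Cs_pd j Cg).
have c1 : continuous (fun x => f x * pd l (pd k g) x) by cont.
have c2 : continuous (fun x => pd k g x * pd l f x) by cont.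
have c3 : continuous (fun x => g x * pd l (pd k f) x) by cont.
have c4 : continuous (fun x => pd k f x * pd l g x) by cont.
have E0 := l2sqD (contD c1 c2) (contD c3 c4).
have E1 := l2sqD c1 c2; have E2 := l2sqD c3 c4.
apply: (le_trans E0).
have -> : 4 * (F1 + F2 + F3 + F4) = 2 * (2 * F1 + 2 * F2) + 2 * (2 * F3 + 2 * F4) by ring.
have two : 0 <= 2 :> R by [].
exact (lerD (ler_wpM2l two (ub _ _ _ _ _ E1 H1 H2)) (ler_wpM2l two (ub _ _ _ _ _ E2 H3 H4))).
Qed.

(** The products of two first derivatives are controlled in L^4 by
    [gagliardo_nirenberg], so that the sup norm always comes with second
    derivatives. *)
Lemma l2sq_pd_pd_ww f g k l M (a2 : R) : Cs 2 f -> Cs 2 g ->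
  Defs.periodic f -> Defs.periodic g ->
  (forall x, in_cell x -> f x ^+ 2 <= M) -> (forall x, in_cell x -> g x ^+ 2 <= M) ->
  0 <= M -> d2sq f <= a2 -> d2sq g <= a2 ->
  l2sq (pd l (pd k (fun x => f x * g x))) <= 80 * (M * a2).
Proof.
move=> Cf Cg pf pg fM gM M0 f2 g2.
have [cf cg] := (Cs_cont Cf, Cs_cont Cg).
have cf1 i := Cs_pd_cont (j := i) Cf; have cg1 i := Cs_pd_cont (j := i) Cg.
have cf2 i j := Cs_pd_cont (j := i) (Cs_pd j Cf).
have cg2 i j := Cs_pd_cont (j := i) (Cs_pd j Cg).
have Qf i : torus_int (fun x => pd i f x ^+ 4) <= 9 * (M * a2).
  apply: le_trans (gagliardo_nirenberg i Cf pf fM) _.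
  rewrite -mulrA ler_pM2l// ler_wpM2l//; exact: le_trans (l2sq_le_d2sq f i i) f2.
have Qg i : torus_int (fun x => pd i g x ^+ 4) <= 9 * (M * a2).
  apply: le_trans (gagliardo_nirenberg i Cg pg gM) _.
  rewrite -mulrA ler_pM2l// ler_wpM2l//; exact: le_trans (l2sq_le_d2sq g i i) g2.
have -> : 80 * (M * a2) = 4 * (M * a2 + 9 * (M * a2) + M * a2 + 9 * (M * a2)) by ring.
apply: (l2sq_pd_pdM Cf Cg).
- exact (le_trans (l2sqM cf (cg2 l k) fM) (ler_wpM2l M0 (le_trans (l2sq_le_d2sq g k l) g2))).
- exact: l2sq_mul_quartic (cg1 k) (cf1 l) (Qg k) (Qf l).
- exact (le_trans (l2sqM cg (cf2 l k) gM) (ler_wpM2l M0 (le_trans (l2sq_le_d2sq f k l) f2))).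
- exact: l2sq_mul_quartic (cf1 k) (cg1 l) (Qf k) (Qg l).
Qed.

Lemma l2sq_pd_pd_uw f g k l B (a0 a1 a2 : R) : Cs 2 f -> Cs 2 g ->
  (forall x, in_cell x -> f x ^+ 2 <= B) ->
  (forall i x, in_cell x -> pd i f x ^+ 2 <= B) ->
  (forall i j x, in_cell x -> pd i (pd j f) x ^+ 2 <= B) ->
  0 <= B -> l2sq g <= a0 -> d1sq g <= a1 -> d2sq g <= a2 ->
  l2sq (pd l (pd k (fun x => f x * g x))) <= 4 * (B * (a0 + 2 * a1 + a2)).
Proof.
move=> Cf Cg fB f1B f2B B0 g0 g1 g2.
have [cf cg] := (Cs_cont Cf, Cs_cont Cg).
have cf1 i := Cs_pd_cont (j := i) Cf; have cg1 i := Cs_pd_cont (j := i) Cg.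
have cf2 i j := Cs_pd_cont (j := i) (Cs_pd j Cf).
have cg2 i j := Cs_pd_cont (j := i) (Cs_pd j Cg).
have -> : B * (a0 + 2 * a1 + a2) = B * a2 + B * a1 + B * a0 + B * a1 by ring.
apply: (l2sq_pd_pdM Cf Cg).
- exact (le_trans (l2sqM cf (cg2 l k) fB) (ler_wpM2l B0 (le_trans (l2sq_le_d2sq g k l) g2))).
- have -> : (fun x => pd k g x * pd l f x) = (fun x => pd l f x * pd k g x).
    by apply/funext => x; rewrite mulrC.
  exact (le_trans (l2sqM (cf1 l) (cg1 k) (f1B l)) (ler_wpM2l B0 (le_trans (l2sq_le_d1sq g k) g1))).
- have -> : (fun x => g x * pd l (pd k f) x) = (fun x => pd l (pd k f) x * g x).
    by apply/funext => x; rewrite mulrC.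
  exact (le_trans (l2sqM (cf2 l k) cg (f2B l k)) (ler_wpM2l B0 g0)).
- exact (le_trans (l2sqM (cf1 k) (cg1 l) (f1B k)) (ler_wpM2l B0 (le_trans (l2sq_le_d1sq g l) g1))).
Qed.

End static_estimates.

(** * Differential inequalities *)

Section gronwall.
Variables (R : realType) (T : R).
Hypothesis T_gt0 : 0 < T.

Lemma gronwall (g dg : R -> R) (C : R) : continuous (fun t => g (clamp T t)) ->
  (forall t, 0 < t < T -> is_derive t (1 : R) g (dg t)) ->
  (forall t, 0 < t < T -> dg t <= C * g t) ->
  forall t, 0 <= t <= T -> g t <= g 0 * expR (C * t).
Proof.
move=> cg Dg gC t tT.
pose e s : R := expR ((- C) * s).
have De s : is_derive s (1 : R) e (- C * e s).
  have dl : is_derive s (1 : R) (fun s => (- C) * s) (- C).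
    apply: (is_derive_eq (is_deriveM_fun (is_derive_cst_fun (- C) s 1) (is_derive_id s 1))).
    by rewrite mulr0 addr0 mulr1.
  apply: (is_derive_eq (is_derive_chain (is_derive_expR ((- C) * s)) dl)).
  by rewrite mulrC.
pose h s := g s * e s.
have Dh s : 0 < s < T -> is_derive s (1 : R) h (g s * (- C * e s) + e s * dg s).
  by move=> sT; exact: is_deriveM_fun (Dg s sT) (De s).
have ch : {within `[0, T], continuous h}.
  have ce s : {for s, continuous e}.
    by have [d _] := De s; apply/differentiable_continuous/derivable1_diffP.
  have c : {within `[0, T], continuous (fun s => g (clamp T s) * e s)}.
    by apply: continuous_subspaceT; exact: (contM cg ce).
  apply: subspace_eq_continuous c => s; rewrite inE/= in_itv/= => sT.
  by rewrite /from_subspace /= clamp_id.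
have : h t <= h 0.
  apply: (@ler0_derive1_nincr R h 0 T) => //; last 2 first.
  - by case/andP: tT.
  - by case/andP: tT.
  - move=> s; rewrite in_itv /= => sT; by have [] := Dh s sT.
  - move=> s; rewrite in_itv /= => sT; have D := Dh s sT; rewrite derive1E derive_val.
    have := gC s sT; have := expR_gt0 ((- C) * s); rewrite -/(e s) => e0 H.
    have -> : g s * (- C * e s) + e s * dg s = e s * (dg s - C * g s) by ring.
    by rewrite pmulr_rle0// subr_le0.
rewrite /h /e mulr0 expR0 mulr1 mulNr expRN ler_pdivrMr ?expR_gt0//.
Qed.

Lemma constant_of_derive0 (g : R -> R) : continuous (fun t => g (clamp T t)) ->
  (forall t, 0 < t < T -> is_derive t (1 : R) g 0) ->
  forall t, 0 <= t <= T -> g t = g 0.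
Proof.
move=> cg Dg t tT; apply/eqP; rewrite eq_le; apply/andP; split.
  have := gronwall (C := 0) cg Dg _ tT; rewrite mul0r expR0 mulr1; apply => s _.
  by rewrite mul0r.
have Dn s : 0 < s < T -> is_derive s (1 : R) (fun s => - g s) 0.
  by move=> sT; rewrite -[0]oppr0; exact: is_deriveN_fun (Dg s sT).
have := gronwall (C := 0) (contN cg) Dn _ tT; rewrite mul0r expR0 mulr1 lerN2; apply => s _.
by rewrite mul0r.
Qed.

(** Z may blow up in finite time, but the ratio (Z + s) / (1 + Z) grows at
    most exponentially, and it controls Z as long as it stays below 1/2. *)
Lemma logistic_bound (Z dZ : R -> R) (C s : R) : 0 <= C -> 0 <= s <= 1 ->
  continuous (fun t => Z (clamp T t)) ->
  (forall t, 0 < t < T -> is_derive t (1 : R) Z (dZ t)) ->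
  (forall t, 0 <= t <= T -> 0 <= Z t) ->
  (forall t, 0 < t < T -> dZ t <= C * ((1 + Z t) * (Z t + s))) ->
  (Z 0 + s) * expR (C * T) <= 2^-1 ->
  forall t, 0 <= t <= T -> Z t <= 2 * ((Z 0 + s) * expR (C * T)).
Proof.
move=> C0 /andP[s0 s1] cZ DZ Z0 dZC small t tT.
pose h t := 1 - (1 - s) * (1 + Z t)^-1.
have Z1 t' : 0 <= t' <= T -> 0 < 1 + Z t' by move=> /Z0; lra.
have hE t' : 0 <= t' <= T -> h t' = (Z t' + s) / (1 + Z t').
  by move=> /Z1 Zt; rewrite /h; field; rewrite gt_eqF.
have inT t' : 0 < t' < T -> 0 <= t' <= T by move=> /andP[? ?]; rewrite !ltW.
have H := @gronwall h (fun t => (1 - s) * (dZ t / (1 + Z t) ^+ 2)) C.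
have {}H : h t <= h 0 * expR (C * t).
  apply: H; last exact tT.
  - have cV : continuous (fun t => (1 + Z (clamp T t))^-1).
      apply: (contV _ (contD (@cont_cst _ _ 1) cZ)) => x.
      by rewrite gt_eqF// Z1// clamp_in.
    exact: (contD (@cont_cst _ _ 1) (contN (contM (@cont_cst _ _ (1 - s)) cV))).
  - move=> t' tT'; have Zt := Z1 _ (inT _ tT').
    have d1 : is_derive t' (1 : R) (fun t => 1 + Z t) (dZ t').
      apply: (is_derive_eq (is_deriveD_fun (is_derive_cst_fun 1 t' 1) (DZ t' tT'))).
      by rewrite add0r.
    have d2 : is_derive t' (1 : R) (fun t => (1 + Z t)^-1) (- (1 + Z t') ^- 2 * dZ t').
      have nz : 1 + Z t' != 0 by rewrite gt_eqF.
      exact: (is_deriveV (f := fun t => 1 + Z t) nz).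
    apply: (is_derive_eq (is_deriveD_fun (is_derive_cst_fun 1 t' 1)
      (is_deriveN_fun (is_deriveM_fun (is_derive_cst_fun (1 - s) t' 1) d2)))).
    by move: (dZ t') Zt => d Zt; field; rewrite gt_eqF.
  - move=> t' tT'; have tT2 := inT _ tT'; have Zt := Z1 _ tT2; rewrite hE//.
    have D := dZC _ tT'.
    have -> : C * ((Z t' + s) / (1 + Z t')) =
        C * ((1 + Z t') * (Z t' + s)) / (1 + Z t') ^+ 2 by field; rewrite gt_eqF.
    rewrite [leLHS]mulrA ler_pM2r ?invr_gt0 ?exprn_gt0//.
    have U : 0 <= C * ((1 + Z t') * (Z t' + s)).
      by rewrite mulr_ge0// mulr_ge0 ?(ltW Zt)// addr_ge0// Z0.
    have s1' : 0 <= 1 - s by lra.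
    apply: le_trans (ler_wpM2l s1' D) _; rewrite ler_piMl//; lra.
have O : 0 <= (0 : R) <= T by rewrite lexx ltW.
have hZ : h t * (1 + Z t) = Z t + s by rewrite hE// -mulrA mulVf ?mulr1// gt_eqF// Z1.
have h0 : h 0 <= Z 0 + s.
  rewrite hE// ler_pdivrMr ?Z1// ler_peMr//; first by rewrite addr_ge0// Z0.
  by have := Z0 _ O; lra.
have e0 : expR (C * t) <= expR (C * T).
  by rewrite ler_expR ler_wpM2l//; case/andP: tT.
set th := (Z 0 + s) * expR (C * T) in small *.
have hth : h t <= th.
  apply: le_trans H _; apply: le_trans (ler_wpM2r (expR_ge0 _) h0) _.
  by rewrite ler_wpM2l// addr_ge0// Z0.
have := ler_wpM2r (ltW (Z1 _ tT)) hth; rewrite hZ; have := Z0 _ tT.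
move: (Z t) th small s0 {hth h0 hZ e0 H} => z th small s0 z0 H.
nra.
Qed.

End gronwall.

(** Y1 and Y2 are the energies of orders one and two, al0, al1, al2 the square
    norms of the velocity and its derivatives, and M its squared sup norm,
    from [agmon]. In Z = Y1 / lam + lam Y2 the bound for M is linear, so that
    the terms M al1 / lam and lam M al2 are quadratic; the other sources
    contribute B sig2 / lam = B s and lam B <= B s. *)
Lemma logistic_rate (R : realFieldType) (KA B c0 K1 K2 : R) :
  0 <= KA -> 0 <= B -> 0 <= c0 -> 0 <= K1 -> 0 <= K2 ->
  exists2 C, 0 <= C & forall lam s sig2 Y1 Y2 D1 D2 al0 al1 al2 M : R,
    0 < lam -> lam <= s -> s <= 1 -> lam * s = sig2 ->
    0 <= al0 -> 0 <= al1 -> 0 <= al2 -> 0 <= Y1 -> 0 <= Y2 ->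
    al1 <= 2 * Y1 + 18 * B * sig2 -> al0 <= al1 + c0 * sig2 -> al2 <= Y2 ->
    M = KA * (lam^-1 * (al0 + al1) + lam * (al1 + al2)) ->
    D1 <= Y1 + K1 * (M * al1 + B * (al0 + al1) + B * sig2) ->
    D2 <= Y2 + K2 * (M * al2 + B * (al0 + 2 * al1 + al2) + B) ->
    lam^-1 * D1 + lam * D2 <=
      C * ((1 + (lam^-1 * Y1 + lam * Y2)) * ((lam^-1 * Y1 + lam * Y2) + s)).
Proof.
move=> KA0 B0 c00 K10 K20.
pose ka := 2 + 18 * B + c0.
pose mu := KA * (3 * ka + 1).
have ka0 : 0 <= ka by rewrite /ka; lra.
have mu0 : 0 <= mu by rewrite mulr_ge0//; lra.
have kB := mulr_ge0 ka0 B0. have kmu := mulr_ge0 mu0 ka0.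
exists (1 + K1 * (mu * ka + 2 * (ka * B) + B) + K2 * (mu + 3 * (ka * B) + 2 * B)).
  by rewrite !addr_ge0// mulr_ge0// !addr_ge0// mulr_ge0.
move=> lam s sig2 Y1 Y2 D1 D2 al0 al1 al2 M lam0 lams s1 lamsE a00 a10 a20 Y10 Y20 H1 H0 H2 ME HD1 HD2.
pose y1 := lam^-1 * Y1; pose y2 := lam * Y2.
pose b1 := lam^-1 * al1; pose b0 := lam^-1 * al0.
have lV0 : 0 < lam^-1 by rewrite invr_gt0.
have y10 : 0 <= y1 by rewrite mulr_ge0// ltW.
have y20 : 0 <= y2 by rewrite mulr_ge0// ltW.
have b10 : 0 <= b1 by rewrite mulr_ge0// ltW.
have b00 : 0 <= b0 by rewrite mulr_ge0// ltW.
have sE : lam^-1 * sig2 = s by rewrite -lamsE mulrA mulVf ?mul1r// gt_eqF.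
have s0 : 0 < s by lra.
have lam1 : lam <= 1 by lra.
have a1E : al1 = lam * b1 by rewrite /b1 mulrA mulfV ?mul1r// gt_eqF.
have a0E : al0 = lam * b0 by rewrite /b0 mulrA mulfV ?mul1r// gt_eqF.
have Hb1 : b1 <= 2 * y1 + 18 * B * s.
  have := ler_wpM2l (ltW lV0) H1; rewrite -/b1 => /le_trans; apply.
  by rewrite mulrDr mulrCA -/y1 (mulrCA _ (18 * B)) sE.
have Hb0 : b0 <= b1 + c0 * s.
  have := ler_wpM2l (ltW lV0) H0; rewrite -/b0 => /le_trans; apply.
  by rewrite mulrDr -/b1 (mulrCA _ c0) sE.
have Hl2 : lam * al2 <= y2 by rewrite ler_wpM2l// ltW.
rewrite -/y1 -/y2; set Z := y1 + y2; set S := Z + s.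
have Z0 : 0 <= Z by rewrite addr_ge0.
have S0 : 0 < S by rewrite ltr_wpDl.
have Bs := mulr_ge0 B0 (ltW s0). have c0s := mulr_ge0 c00 (ltW s0).
have BZ := mulr_ge0 B0 Z0. have c0Z := mulr_ge0 c00 Z0.
have Hb1S : b1 <= ka * S.
  by apply: le_trans Hb1 _; rewrite /ka /S /Z; rewrite /Z in BZ c0Z; lra.
have Hb0S : b0 <= ka * S.
  apply: le_trans Hb0 _; apply: le_trans (lerD Hb1 (lexx _)) _.
  by rewrite /ka /S /Z; rewrite /Z in BZ c0Z; lra.
have Hb1Z : b1 <= ka * (1 + Z).
  apply: le_trans Hb1 _.
  have Bs1 : B * s <= B by rewrite ler_piMr.
  by rewrite /ka /Z; rewrite /Z in BZ c0Z; lra.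
have HM : M <= mu * S.
  rewrite ME /mu -mulrA ler_wpM2l//.
  have -> : lam^-1 * (al0 + al1) = b0 + b1 by rewrite mulrDr.
  have la1 : lam * al1 <= b1.
    rewrite a1E mulrA ler_piMl//; apply: mulr_ile1 => //; exact: ltW.
  have : y2 <= S by rewrite /S /Z; lra.
  rewrite mulrDr; lra.
have M0 : 0 <= M.
  rewrite ME mulr_ge0// addr_ge0// mulr_ge0// ?(ltW lam0) ?(ltW lV0)// addr_ge0//.
set W := (1 + Z) * S.
have SW : S <= W by rewrite /W ler_peMl ?(ltW S0)//; lra.
have T1 : lam^-1 * D1 <= y1 + K1 * (mu * ka + 2 * (ka * B) + B) * W.
  apply: le_trans (ler_wpM2l (ltW lV0) HD1) _.
  have -> : lam^-1 * (Y1 + K1 * (M * al1 + B * (al0 + al1) + B * sig2)) =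
     y1 + K1 * (M * b1 + B * (b0 + b1) + B * (lam^-1 * sig2)).
    by rewrite /y1 /b1 /b0; ring.
  rewrite sE lerD2l -mulrA ler_wpM2l//.
  have E1 : M * b1 <= (mu * ka) * W.
    have := ler_pM M0 b10 HM Hb1Z; rewrite /W => /le_trans; apply.
    by rewrite le_eqVlt; apply/orP; left; apply/eqP; ring.
  have E2 : B * (b0 + b1) <= 2 * (ka * B) * W.
    have h : b0 + b1 <= 2 * (ka * S) by lra.
    apply: le_trans (ler_wpM2l B0 h) _.
    have -> : B * (2 * (ka * S)) = 2 * (ka * B) * S by ring.
    by rewrite ler_wpM2l// mulr_ge0.
  have E3 : B * s <= B * W by rewrite ler_wpM2l//; apply: le_trans _ SW; rewrite /S; lra.
  rewrite [leRHS]mulrDl; apply: (lerD _ E3).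
  by rewrite mulrDl; exact: (lerD E1 E2).
have T2 : lam * D2 <= y2 + K2 * (mu + 3 * (ka * B) + 2 * B) * W.
  apply: le_trans (ler_wpM2l (ltW lam0) HD2) _.
  have -> : lam * (Y2 + K2 * (M * al2 + B * (al0 + 2 * al1 + al2) + B)) =
     y2 + K2 * (M * (lam * al2) + B * (lam * al0 + 2 * (lam * al1) + lam * al2) + B * lam).
    by rewrite /y2; ring.
  rewrite lerD2l -mulrA ler_wpM2l//.
  have l2 : 0 <= lam * al2 by rewrite mulr_ge0// ltW.
  have l2Z : lam * al2 <= 1 + Z by rewrite /Z; lra.
  have lam2 : lam * lam <= 1 by rewrite mulr_ile1 ?(ltW lam0).
  have la1 : lam * al1 <= b1 by rewrite a1E mulrA ler_piMl.
  have la0 : lam * al0 <= b0 by rewrite a0E mulrA ler_piMl.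
  have E1 : M * (lam * al2) <= mu * W.
    have := ler_pM M0 l2 HM l2Z; rewrite /W => /le_trans; apply.
    by rewrite le_eqVlt; apply/orP; left; apply/eqP; ring.
  have E2 : B * (lam * al0 + 2 * (lam * al1) + lam * al2) <= (3 * (ka * B) + B) * W.
    have h : lam * al0 + 2 * (lam * al1) + lam * al2 <= 3 * (ka * S) + S.
      have : y2 <= S by rewrite /S /Z; lra.
      lra.
    apply: le_trans (ler_wpM2l B0 h) _.
    have -> : B * (3 * (ka * S) + S) = (3 * (ka * B) + B) * S by ring.
    by rewrite ler_wpM2l// addr_ge0// mulr_ge0.
  have E3 : B * lam <= B * W by rewrite ler_wpM2l//; apply: le_trans _ SW; rewrite /S; lra.
  have -> : (mu + 3 * (ka * B) + 2 * B) * W = mu * W + (3 * (ka * B) + B) * W + B * W by ring.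
  by apply: (lerD _ E3); exact: (lerD E1 E2).
have ZW : Z <= W by apply: le_trans _ SW; rewrite /S; lra.
apply: le_trans (lerD T1 T2) _.
set k1 := K1 * _ ; set k2 := K2 * _.
have -> : (1 + k1 + k2) * W = W + k1 * W + k2 * W by ring.
by move: ZW; rewrite {1}/Z; move: (k1 * W) (k2 * W) => *; lra.
Qed.

(** * The quadratic source *)

Section source_terms.
Variable R : realType.
Local Notation X := 'rV[R]_3.
Implicit Types (f g : X -> R) (i j k l : 'I_3) (B M : R).

Definition C2_bounded B f := [/\ forall x, in_cell x -> f x ^+ 2 <= B,
  forall k x, in_cell x -> pd k f x ^+ 2 <= B
  & forall k l x, in_cell x -> pd k (pd l f) x ^+ 2 <= B].

Definition l2v (w : 'I_3 -> X -> R) := \sum_i l2sq (w i).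
Definition d1v (w : 'I_3 -> X -> R) := \sum_i d1sq (w i).
Definition d2v (w : 'I_3 -> X -> R) := \sum_i d2sq (w i).

Lemma l2v_ge0 w : 0 <= l2v w. Proof. by apply: sumr_ge0 => i _; exact: l2sq_ge0. Qed.
Lemma d1v_ge0 w : 0 <= d1v w. Proof. by apply: sumr_ge0 => i _; exact: d1sq_ge0. Qed.
Lemma d2v_ge0 w : 0 <= d2v w. Proof. by apply: sumr_ge0 => i _; exact: d2sq_ge0. Qed.

(** v (x) v - u (x) u, where v = u + w *)
Definition quad (w u : 'I_3 -> X -> R) i j x :=
  w i x * w j x + u i x * w j x + w i x * u j x.

Lemma l2sq_sum3 f g h (F G H : R) : continuous f -> continuous g -> continuous h ->
  l2sq f <= F -> l2sq g <= G -> l2sq h <= H ->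
  l2sq (fun x => f x + g x + h x) <= 4 * F + 4 * G + 2 * H.
Proof.
have ub (x y z v X Y Z : R) : z <= 2 * v + 2 * x -> v <= 2 * y + 2 * X ->
    y <= Y -> X <= Z -> forall H, x <= H -> z <= 4 * Y + 4 * Z + 2 * H.
  by move=> ? ? ? ? ? ?; lra.
move=> cf cg ch fF gG hH.
exact (ub _ _ _ _ _ _ _ (l2sqD (contD cf cg) ch) (l2sqD cf cg) fF gG _ hH).
Qed.

Variables (w u : 'I_3 -> X -> R) (M B : R).
Hypotheses (Cw : forall i, Cs 2 (w i)) (Cu : forall i, Cs 2 (u i)).
Hypotheses (M0 : 0 <= M) (B0 : 0 <= B).
Hypothesis wM : forall i x, in_cell x -> w i x ^+ 2 <= M.
Hypothesis uB : forall i, C2_bounded B (u i).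

Let l2w i : l2sq (w i) <= l2v w.
Proof. exact: (term_le_sum (F := fun i => l2sq (w i)) i (fun i => l2sq_ge0 _)). Qed.
Let d1w i : d1sq (w i) <= d1v w.
Proof. exact: (term_le_sum (F := fun i => d1sq (w i)) i (fun i => d1sq_ge0 _)). Qed.
Let d2w i : d2sq (w i) <= d2v w.
Proof. exact: (term_le_sum (F := fun i => d2sq (w i)) i (fun i => d2sq_ge0 _)). Qed.
Let l2pw i k : l2sq (pd k (w i)) <= d1v w.
Proof. exact: (le_trans (l2sq_le_d1sq (w i) k) (d1w i)). Qed.

Let Cww i j : Cs 2 (fun x => w i x * w j x). Proof. exact: CsM. Qed.
Let Cuw i j : Cs 2 (fun x => u i x * w j x). Proof. exact: CsM. Qed.
Let Cwu i j : Cs 2 (fun x => w i x * u j x). Proof. exact: CsM. Qed.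

Lemma Cs_quad i j : Cs 2 (quad w u i j).
Proof. exact: (CsD (CsD (Cww i j) (Cuw i j)) (Cwu i j)). Qed.

Let wuC i j : (fun x => w i x * u j x) = (fun x => u j x * w i x).
Proof. by apply/funext => x; rewrite mulrC. Qed.

Lemma pd_quad i j k : pd k (quad w u i j) = fun x =>
  pd k (fun x => w i x * w j x) x + pd k (fun x => u i x * w j x) x
  + pd k (fun x => w i x * u j x) x.
Proof.
have d1 := Cs_pdable (Cww i j). have d2 := Cs_pdable (Cuw i j).
have d3 := Cs_pdable (Cwu i j).
by rewrite /quad (pdD (pdableD d1 d2) d3) (pdD d1 d2).
Qed.

Lemma l2sq_pd_quad i j k :
  l2sq (pd k (quad w u i j)) <= 16 * (M * d1v w) + 16 * (B * (l2v w + d1v w)).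
Proof.
have C1 (h : X -> R) : Cs 2 h -> Cs 1 h := @CsW _ 1 h.
have c (h : X -> R) : Cs 2 h -> continuous (pd k h) by move=> Ch; exact: Cs_pd_cont Ch.
have E1 := l2sq_pd_ww (C1 _ (Cw i)) (C1 _ (Cw j)) (wM i) (wM j) M0 (l2pw i k) (l2pw j k).
have uw a b : l2sq (pd k (fun x => u a x * w b x)) <= 2 * (B * (l2v w + d1v w)).
  have [u0 u1 _] := uB a.
  exact (l2sq_pd_uw (C1 _ (Cu a)) (C1 _ (Cw b)) u0 (u1 k) B0 (l2w b) (l2pw b k)).
have E2 := uw i j. have := uw j i; rewrite -wuC => E3.
rewrite pd_quad.
apply: (le_trans (l2sq_sum3 (c _ (Cww i j)) (c _ (Cuw i j)) (c _ (Cwu i j)) E1 E2 E3)).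
have := mulr_ge0 B0 (addr_ge0 (l2v_ge0 w) (d1v_ge0 w)).
move: (M * d1v w) (B * (l2v w + d1v w)) => a b {E1 E2 E3 uw} b0; lra.
Qed.

Lemma l2sq_pd_pd_quad i j k l : (forall i, Defs.periodic (w i)) ->
  l2sq (pd l (pd k (quad w u i j))) <=
  320 * (M * d2v w) + 32 * (B * (l2v w + 2 * d1v w + d2v w)).
Proof.
move=> pw.
have c (h : X -> R) : Cs 2 h -> continuous (pd l (pd k h)).
  by move=> Ch; exact: (Cs_pd_cont (Cs_pd k Ch)).
have E1 := l2sq_pd_pd_ww k l (Cw i) (Cw j) (pw i) (pw j) (wM i) (wM j) M0 (d2w i) (d2w j).
have uw a b : l2sq (pd l (pd k (fun x => u a x * w b x))) <=
    4 * (B * (l2v w + 2 * d1v w + d2v w)).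
  have [u0 u1 u2] := uB a.
  exact (l2sq_pd_pd_uw k l (Cu a) (Cw b) u0 u1 u2 B0 (l2w b) (d1w b) (d2w b)).
have E2 := uw i j. have := uw j i; rewrite -wuC => E3.
have d1 := Cs_pdable (Cs_pd k (Cww i j)). have d2 := Cs_pdable (Cs_pd k (Cuw i j)).
have d3 := Cs_pdable (Cs_pd k (Cwu i j)).
rewrite pd_quad (pdD (pdableD d1 d2) d3) (pdD d1 d2).
apply: (le_trans (l2sq_sum3 (c _ (Cww i j)) (c _ (Cuw i j)) (c _ (Cwu i j)) E1 E2 E3)).
have two : 0 <= 2 :> R by [].
have := mulr_ge0 B0 (addr_ge0 (addr_ge0 (l2v_ge0 w) (mulr_ge0 two (d1v_ge0 w))) (d2v_ge0 w)).
move: (M * d2v w) (B * (_ + _)) => a b {E1 E2 E3 uw} b0; lra.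
Qed.

Variables (V : 'I_3 -> 'I_3 -> X -> R) (del sig2 : R).
Hypotheses (CV : forall i j, Cs 2 (V i j)) (VB : forall i j, C2_bounded B (V i j)).
Hypothesis del_sig : del ^+ 2 <= sig2.

Let src i j x := quad w u i j x - del * V i j x.

Let pd_src i j k : pd k (src i j) = fun x => pd k (quad w u i j) x - del * pd k (V i j) x.
Proof.
have d1 := Cs_pdable (Cs_quad i j). have d2 := Cs_pdable (CV i j).
by rewrite /src (pdB k d1 (@pdableZ R del _ d2)) (@pdZ R del _ d2).
Qed.

Let cstB (c : R) g : continuous g -> (forall x, in_cell x -> g x ^+ 2 <= B) ->
  c ^+ 2 <= sig2 -> l2sq (fun x => c * g x) <= B * sig2.
Proof.
move=> cg gB cs; rewrite (l2sqZ c cg) mulrC.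
by apply: ler_pM => //; [exact: l2sq_ge0|exact: sqr_ge0|exact: l2sq_bounded].
Qed.

Lemma l2sq_source1 (P : X -> R) i j k (c : R) : Cs 2 P -> C2_bounded B P -> c ^+ 2 <= sig2 ->
  l2sq (fun x => pd k (src i j) x + c * pd j P x) <=
  64 * (M * d1v w + B * (l2v w + d1v w) + B * sig2).
Proof.
move=> CP [_ PB _] cs.
have cq := Cs_pd_cont (j := k) (Cs_quad i j). have cV := Cs_pd_cont (j := k) (CV i j).
have cP := Cs_pd_cont (j := j) CP.
have [_ V1 _] := VB i j.
have EV : l2sq (fun x => (- del) * pd k (V i j) x) <= B * sig2.
  by apply: (cstB cV (V1 k)); rewrite sqrrN.
have EP := cstB cP (PB j) cs.
have Eq := l2sq_pd_quad i j k.
have -> : (fun x => pd k (src i j) x + c * pd j P x) =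
    (fun x => pd k (quad w u i j) x + (- del) * pd k (V i j) x + c * pd j P x).
  by apply/funext => x; rewrite pd_src mulNr.
have cV' : continuous (fun x => (- del) * pd k (V i j) x) by cont.
have cP' : continuous (fun x => c * pd j P x) by cont.
apply: (le_trans (l2sq_sum3 cq cV' cP' Eq EV EP)).
have s0 : 0 <= B * sig2 by rewrite mulr_ge0// (le_trans _ cs)// sqr_ge0.
move: (M * d1v w) (B * (_ + _)) (B * sig2) s0 => a b s {Eq EV EP} s0; lra.
Qed.

Lemma l2sq_source2 i j k l : (forall i, Defs.periodic (w i)) -> sig2 <= 1 ->
  l2sq (pd l (pd k (src i j))) <=
  640 * (M * d2v w + B * (l2v w + 2 * d1v w + d2v w) + B).
Proof.
move=> pw s1.
have cq := Cs_pd_cont (j := l) (Cs_pd k (Cs_quad i j)).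
have cV := Cs_pd_cont (j := l) (Cs_pd k (CV i j)).
have [_ _ V2] := VB i j.
have EV : l2sq (fun x => (- del) * pd l (pd k (V i j)) x) <= B * sig2.
  by apply: (cstB cV (V2 l k)); rewrite sqrrN.
have Eq := l2sq_pd_pd_quad i j k l pw.
have -> : pd l (pd k (src i j)) =
    (fun x => pd l (pd k (quad w u i j)) x + (- del) * pd l (pd k (V i j)) x).
  have d1 := Cs_pdable (Cs_pd k (Cs_quad i j)). have d2 := Cs_pdable (Cs_pd k (CV i j)).
  by rewrite pd_src (pdB l d1 (@pdableZ R del _ d2)) (@pdZ R del _ d2); apply/funext => x; rewrite mulNr.
have cV' : continuous (fun x => (- del) * pd l (pd k (V i j)) x) by cont.
apply: (le_trans (l2sqD cq cV')).
have two : 0 <= 2 :> R by [].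
apply: (le_trans (lerD (ler_wpM2l two Eq) (ler_wpM2l two EV))).
have s0 : B * sig2 <= B by rewrite ler_piMr.
have := mulr_ge0 B0 (addr_ge0 (addr_ge0 (l2v_ge0 w) (mulr_ge0 two (d1v_ge0 w))) (d2v_ge0 w)).
move: (M * d2v w) (B * (_ + _)) (B * sig2) s0 B0 => a b s {Eq EV} s0 B1 b0.
lra.
Qed.

End source_terms.

(** * The energies of the perturbation *)

Section energies.
Variables (R : realType) (T : R).
Hypothesis T_gt0 : 0 < T.
Local Notation X := 'rV[R]_3.
Variables (eps del : R).
Hypotheses (eps_gt0 : 0 < eps) (del_gt0 : 0 < del).
Implicit Types (b F : R -> X -> R) (a G : 'I_3 -> R -> X -> R)
  (D H : 'I_3 -> 'I_3 -> R -> X -> R) (i j k l : 'I_3).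

Lemma energyE a b D t : (forall i, continuous (a i t)) -> continuous (b t) ->
  (forall i j, continuous (D i j t)) ->
  energy eps del a b D t =
  l2v (a ^~ t) + eps * l2sq (b t) + del * \sum_i \sum_j l2sq (D i j t).
Proof.
move=> ca cb cD; rewrite /energy /energy_density /l2v l2sqE.
rewrite !torus_intD; [|by cont..].
rewrite !torus_intZ; [|by cont..].
rewrite torus_int_sum; last by move=> i; cont.
rewrite torus_int_sum; last by move=> i; cont.
congr (_ + _ + _ * _).
apply: eq_bigr => i _; rewrite torus_int_sum; last by move=> j; cont.
by apply: eq_bigr => j _; exact (esym (l2sqE _)).
Qed.

Lemma l2sq_mat_ge0 (D : 'I_3 -> 'I_3 -> X -> R) : 0 <= \sum_i \sum_j l2sq (D i j).
Proof. by apply: sumr_ge0 => i _; apply: sumr_ge0 => j _; exact: l2sq_ge0. Qed.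

Lemma energy_lower a b D F G H t : hyperbolic_system T eps del 0 a b D F G H ->
  0 <= t <= T -> l2v (a ^~ t) + eps * l2sq (b t) <= energy eps del a b D t.
Proof.
move=> [Sa Sb SD _ _ _ _ _ _ _ _ _] tT.
have ca i := Cs_cont (St_Cs (Sa i) tT). have cb := Cs_cont (St_Cs Sb tT).
have cD i j := Cs_cont (St_Cs (SD i j) tT).
rewrite energyE// lerDl mulr_ge0 ?(ltW del_gt0)//; exact: l2sq_mat_ge0.
Qed.

Lemma sum3_le (F : 'I_3 -> R) (c : R) : (forall i, F i <= c) -> \sum_i F i <= 3 * c.
Proof.
move=> Fc; apply: (@le_trans _ _ (\sum_(i < 3) c)); first by apply: ler_sum => i _; exact: Fc.
by rewrite sumr_const card_ord mulr_natl.
Qed.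

Lemma energy_rate a b D F G H t (g f h : R) :
  hyperbolic_system T eps del 0 a b D F G H -> 0 < t < T ->
  (forall i, l2sq (G i t) <= g) -> eps^-1 * l2sq (F t) <= f ->
  (forall i j, l2sq (H i j t) <= h) ->
  derivable (energy eps del a b D) t 1 /\
  'D_1 (energy eps del a b D) t <= energy eps del a b D t + (3 * g + f + 9 * h).
Proof.
move=> S tT Gg Ff Hh.
have [de [dE <-] le] := energy_derive eps_gt0 del_gt0 S tT.
split => //; apply: (le_trans le).
have E1 := sum3_le Gg.
have E2 : \sum_i \sum_j l2sq (H i j t) <= 3 * (3 * h).
  by apply: sum3_le => i; apply: sum3_le => j.
have -> : 9 * h = 3 * (3 * h) by ring.
rewrite -!addrA lerD2l; exact: (lerD E1 (lerD Ff E2)).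
Qed.

Lemma is_derive_sum3 (E : 'I_3 -> R -> R) (t c : R) :
  (forall k, derivable (E k) t 1 /\ 'D_1 (E k) t <= E k t + c) ->
  derivable (fun t => \sum_k E k t) t 1 /\
  'D_1 (fun t => \sum_k E k t) t <= \sum_k E k t + 3 * c.
Proof.
move=> HE.
have D : is_derive t (1 : R) (fun t => \sum_k E k t) (\sum_k 'D_1 (E k) t).
  by apply: is_derive_sum_fun => k; apply: derivableP; have [] := HE k.
have [d ->] := D; split => //.
rewrite -lerBlDl -sumrB; apply: sum3_le => k; rewrite lerBlDl; exact: (HE k).2.
Qed.

End energies.

Lemma sum_linear (R : pzRingType) (a b d : 'I_3 -> R) (c e f g : R) :
  \sum_k (g * a k + c + e * b k + f * d k) =
  g * \sum_k a k + c *+ 3 + e * \sum_k b k + f * \sum_k d k.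
Proof. by rewrite !big_split /= -!mulr_sumr sumr_const card_ord. Qed.

Lemma sum_linear2 (R : pzRingType) (a b d : 'I_3 -> 'I_3 -> R) (e f : R) :
  \sum_k \sum_l (a k l + e * b k l + f * d k l) =
  \sum_k \sum_l a k l + e * \sum_k \sum_l b k l + f * \sum_k \sum_l d k l.
Proof.
rewrite !mulr_sumr -!big_split /=; apply: eq_bigr => k _.
by rewrite !mulr_sumr -!big_split.
Qed.

(** Bound for the squared sup norm of the velocity, by [agmon] at scale lam.
    *)
Definition sup_bound (R : realType) (lam a0 a1 a2 : R) :=
  agmon_const R * (lam^-1 * (a0 + a1) + lam * (a1 + a2)).

Lemma sup_bound_ge0 (R : realType) (lam a0 a1 a2 : R) : 0 < lam -> 0 <= a0 -> 0 <= a1 -> 0 <= a2 ->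
  0 <= sup_bound lam a0 a1 a2.
Proof.
move=> l0 a00 a10 a20; rewrite mulr_ge0 ?(ltW (agmon_const_gt0 R))// addr_ge0// mulr_ge0//.
- by rewrite invr_ge0 ltW.
- by rewrite addr_ge0.
- exact: ltW.
- by rewrite addr_ge0.
Qed.

Section perturbation.
Variable R : realType.
Local Notation X := 'rV[R]_3.
Implicit Types (i j k l : 'I_3).

(** The system for the difference (w, q, W) between a relaxed solution and a
    reference solution (p, u, U). Here V, P1 and P2 are the time derivatives
    of U, of p and of P1. *)
Record perturbation (T eps del B : R) (w : 'I_3 -> R -> X -> R) (q : R -> X -> R)
    (W : 'I_3 -> 'I_3 -> R -> X -> R) (u : 'I_3 -> R -> X -> R)
    (V : 'I_3 -> 'I_3 -> R -> X -> R) (P1 P2 : R -> X -> R) : Prop := Perturbation {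
  pt_sys : hyperbolic_system T eps del 2 w q W (fun t x => - eps * P1 t x)
    (fun _ _ _ => 0)
    (fun i j t x => quad (w ^~ t) (u ^~ t) i j x - del * V i j t x);
  pt_u : forall i, St T 2 (u i);
  pt_V : forall i j, St T 2 (V i j);
  pt_P1 : St T 2 P1;
  pt_P2 : St T 1 P2;
  pt_dP : dtime T P1 P2;
  pt_pP : forall t, 0 <= t <= T -> Defs.periodic (P1 t);
  pt_mP : forall t, 0 < t < T -> torus_int (P1 t) = 0;
  pt_uB : forall t i, 0 <= t <= T -> C2_bounded B (u i t);
  pt_VB : forall t i j, 0 <= t <= T -> C2_bounded B (V i j t);
  pt_P1B : forall t, 0 <= t <= T -> C2_bounded B (P1 t);
  pt_P2B : forall t x, 0 <= t <= T -> in_cell x -> P2 t x ^+ 2 <= B }.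

Variables (T eps del B : R) (w : 'I_3 -> R -> X -> R) (q : R -> X -> R)
  (W : 'I_3 -> 'I_3 -> R -> X -> R) (u : 'I_3 -> R -> X -> R)
  (V : 'I_3 -> 'I_3 -> R -> X -> R) (P1 P2 : R -> X -> R).
Hypothesis T_gt0 : 0 < T.
Hypotheses (eps_gt0 : 0 < eps) (del_gt0 : 0 < del) (sig_le1 : eps + del <= 1).
Hypothesis B0 : 0 <= B.
Hypothesis pt : perturbation T eps del B w q W u V P1 P2.

Let sys := pt_sys pt.
Let sig2 := (eps + del) ^+ 2.

Let sig2_le1 : sig2 <= 1.
Proof. by rewrite /sig2 expr_le1// addr_ge0 ?ltW. Qed.

Let eps_sig : eps ^+ 2 <= sig2.
Proof. by rewrite /sig2 ler_sqr ?nnegrE ?addr_ge0 ?(ltW eps_gt0) ?(ltW del_gt0)// lerDl ltW. Qed.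

Let del_sig : del ^+ 2 <= sig2.
Proof. by rewrite /sig2 ler_sqr ?nnegrE ?addr_ge0 ?(ltW eps_gt0) ?(ltW del_gt0)// lerDr ltW. Qed.

Let bool_sig i k : (eps * (i == k)%:R) ^+ 2 <= sig2.
Proof.
apply: le_trans eps_sig; rewrite exprMn ler_piMr ?sqr_ge0//.
by case: (i == k); rewrite ?expr1n ?expr0n.
Qed.

Let inT t : 0 < t < T -> 0 <= t <= T.
Proof. by move=> /andP[? ?]; rewrite !ltW. Qed.

(** The velocity in the k-th derivative of the system, after [hs_shift]. *)
Definition shifted k i t x := pd k (w i t) x + eps * (i == k)%:R * P1 t x.

Definition energy1 t := \sum_k energy eps del (shifted k)
  (fun t => pd k (q t)) (fun i j t => pd k (W i j t)) t.

Definition energy2 t := \sum_k \sum_l energy eps del (fun i t => pd l (pd k (w i t)))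
  (fun t => pd l (pd k (q t))) (fun i j t => pd l (pd k (W i j t))) t.

Lemma system1 k : hyperbolic_system T eps del 0 (shifted k)
  (fun t => pd k (q t)) (fun i j t => pd k (W i j t)) (fun _ _ => 0)
  (fun i t x => pd k (fun _ : X => 0) x + eps * (i == k)%:R * P2 t x)
  (fun i j t x => pd k (fun x => quad (w ^~ t) (u ^~ t) i j x - del * V i j t x) x
                  + eps * (i == k)%:R * pd j (P1 t) x).
Proof.
apply: (hs_shift T_gt0 (hs_pd T_gt0 k sys)).
- move=> t x /inT tT; have d := St_pdable (pt_P1 pt) tT.
  by rewrite (@pdZ R (- eps) _ d).
- exact: pt_P1 pt.
- exact: pt_P2 pt.
- exact: pt_dP pt.
- exact: pt_pP pt.
Qed.

Lemma system2 k l : hyperbolic_system T eps del 0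
  (fun i t => pd l (pd k (w i t))) (fun t => pd l (pd k (q t)))
  (fun i j t => pd l (pd k (W i j t))) (fun t => pd l (pd k (fun x => - eps * P1 t x)))
  (fun _ _ => pd l (pd k (fun _ : X => 0)))
  (fun i j t => pd l (pd k (fun x => quad (w ^~ t) (u ^~ t) i j x - del * V i j t x))).
Proof. exact: (hs_pd T_gt0 l (hs_pd T_gt0 k sys)). Qed.

Let A0 t := l2v (w ^~ t).
Let A1 t := d1v (w ^~ t).
Let A2 t := d2v (w ^~ t).

Let Cw t i : 0 <= t <= T -> Cs 3 (w i t).
Proof. by move=> tT; exact: St_Cs (hs_a sys i) tT. Qed.
Let Cq t : 0 <= t <= T -> Cs 3 (q t).
Proof. by move=> tT; exact: St_Cs (hs_b sys) tT. Qed.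
Let CP t : 0 <= t <= T -> Cs 2 (P1 t).
Proof. by move=> tT; exact: St_Cs (pt_P1 pt) tT. Qed.

Let l2sq_cP1 t (c : R) : 0 <= t <= T -> c ^+ 2 <= sig2 ->
  l2sq (fun x => c * P1 t x) <= B * sig2.
Proof.
move=> tT cs; have cP := Cs_cont (CP tT); rewrite (l2sqZ c cP) mulrC.
have [PB _ _] := pt_P1B pt tT.
by apply: ler_pM => //; [exact: l2sq_ge0|exact: sqr_ge0|exact: l2sq_bounded].
Qed.

Lemma energy1_ge0 t : 0 <= t <= T -> 0 <= energy1 t.
Proof.
move=> tT; apply: sumr_ge0 => k _.
apply: le_trans _ (energy_lower del_gt0 (system1 k) tT).
by rewrite addr_ge0 ?l2v_ge0// mulr_ge0 ?l2sq_ge0// ltW.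
Qed.

Lemma energy2_ge0 t : 0 <= t <= T -> 0 <= energy2 t.
Proof.
move=> tT; apply: sumr_ge0 => k _; apply: sumr_ge0 => l _.
apply: le_trans _ (energy_lower del_gt0 (system2 k l) tT).
by rewrite addr_ge0 ?l2v_ge0// mulr_ge0 ?l2sq_ge0// ltW.
Qed.

Let A1E t : A1 t = \sum_k l2v (fun i => pd k (w i t)).
Proof.
apply: (etrans (eq_bigr _ (fun i _ => d1sqE (w i t)))); exact: exchange_big.
Qed.

Let A2E t : A2 t = \sum_k \sum_l l2v (fun i => pd l (pd k (w i t))).
Proof.
apply: (etrans (eq_bigr _ (fun i _ => d2sqE (w i t)))).
apply: (etrans (exchange_big _ _ _ _ _ _)); apply: eq_bigr => k _; exact: exchange_big.
Qed.

Let sum_d1sqE t : \sum_i \sum_j d1sq (W i j t) =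
  \sum_k \sum_i \sum_j l2sq (pd k (W i j t)).
Proof.
rewrite [RHS]exchange_big; apply: eq_bigr => i _.
rewrite [RHS]exchange_big; apply: eq_bigr => j _; exact: d1sqE.
Qed.

Let sum_d2sqE t : \sum_i \sum_j d2sq (W i j t) =
  \sum_k \sum_l \sum_i \sum_j l2sq (pd l (pd k (W i j t))).
Proof.
under [RHS]eq_bigr do rewrite exchange_big.
rewrite [RHS]exchange_big; apply: eq_bigr => i _.
under [RHS]eq_bigr do rewrite exchange_big.
rewrite [RHS]exchange_big; apply: eq_bigr => j _; exact: d2sqE.
Qed.

Lemma d1v_le_energy1 t : 0 <= t <= T -> d1v (w ^~ t) <= 2 * energy1 t + 18 * B * sig2.
Proof.
move=> tT; rewrite -/(A1 t) A1E /energy1.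
have E k : l2v (fun i => pd k (w i t)) <= 2 * energy eps del (shifted k)
    (fun t => pd k (q t)) (fun i j t => pd k (W i j t)) t + 3 * (2 * (B * sig2)).
  have L := energy_lower del_gt0 (system1 k) tT.
  have H i : l2sq (pd k (w i t)) - 2 * l2sq (shifted k i t) <= 2 * (B * sig2).
    have c1 : continuous (shifted k i t).
      exact: (Cs_cont (St_Cs (hs_a (system1 k) i) tT)).
    pose c := - (eps * (i == k)%:R).
    have c2 : continuous (fun x => c * P1 t x).
      by have cP := Cs_cont (CP tT); cont.
    have := l2sqD c1 c2.
    have -> : (fun x => shifted k i t x + c * P1 t x) = pd k (w i t).
      by apply/funext => x; rewrite /shifted /c mulNr addrK.
    have c2s : c ^+ 2 <= sig2 by rewrite /c sqrrN.
    have two : 0 <= 2 :> R by [].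
    have N := ler_wpM2l two (l2sq_cP1 tT c2s).
    by move=> h; rewrite lerBlDl; apply: (le_trans h); rewrite lerD2l.
  have S := sum3_le H.
  move: S; rewrite sumrB -mulr_sumr -/(l2v (fun i => pd k (w i t))) -/(l2v (fun i => shifted k i t)).
  rewrite lerBlDl => S; apply: (le_trans S); rewrite lerD2r ler_pM2l//.
  apply: (le_trans _ L); rewrite lerDl mulr_ge0 ?(ltW eps_gt0)//; exact: l2sq_ge0.
apply: (@le_trans _ _ (\sum_k (2 * energy eps del (shifted k)
    (fun t => pd k (q t)) (fun i j t => pd k (W i j t)) t + 3 * (2 * (B * sig2))))).
  by apply: ler_sum => k _; exact: E.
rewrite big_split /= -mulr_sumr lerD2l sumr_const card_ord -mulr_natr.
by rewrite le_eqVlt; apply/orP; left; apply/eqP; ring.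
Qed.

Lemma d2v_le_energy2 t : 0 <= t <= T -> d2v (w ^~ t) <= energy2 t.
Proof.
move=> tT; rewrite -/(A2 t) A2E; apply: ler_sum => k _; apply: ler_sum => l _.
apply: le_trans _ (energy_lower del_gt0 (system2 k l) tT).
by rewrite lerDl mulr_ge0 ?(ltW eps_gt0)//; exact: l2sq_ge0.
Qed.

Lemma d1sq_le_energy1 t : 0 <= t <= T -> eps * d1sq (q t) <= energy1 t.
Proof.
move=> tT; rewrite d1sqE mulr_sumr; apply: ler_sum => k _.
apply: le_trans _ (energy_lower del_gt0 (system1 k) tT).
by rewrite lerDr; exact: l2v_ge0.
Qed.

(** The equation for w is in divergence form. *)
Lemma mean_w t i : 0 <= t <= T -> torus_int (w i t) = torus_int (w i 0).
Proof.
move=> tT; have Sw := hs_a sys i. have Sq := hs_b sys. have SW j := hs_D sys i j.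
apply: (constant_of_derive0 (g := fun t => torus_int (w i t)) _ _ tT).
  exact: (continuous_torus_int_clamp T_gt0 (St_contK Sw)).
move=> s sT; have sT' := inT sT.
have cpW j := St_contK (St_pd j (SW j)). have cpq := St_contK (St_pd i Sq).
pose d s x : R := 0 - \sum_j pd j (W i j s) x - pd i (q s) x.
have cd : contK T d by rewrite /d; cont_t.
apply: (is_derive_eq (torus_int_dtime (St_contK Sw) cd (hs_dta sys i) sT)).
have ic j : continuous (pd j (W i j s)) := Cs_pd_cont (St_Cs (SW j) sT').
have iq : continuous (pd i (q s)) := Cs_pd_cont (Cq sT').
have cS : continuous (fun x => \sum_j pd j (W i j s) x) by cont.
rewrite /d torus_intB; [|by cont|exact: iq].
rewrite torus_intB; [|exact: cont_cst|exact: cS].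
rewrite torus_int_cst (torus_int_sum _ ic) big1 => [|j _].
  by rewrite (torus_int_div i (hs_pb sys sT') (CsW (CsW (Cq sT')))) !subr0.
exact: (torus_int_div j (hs_pD sys i j sT') (CsW (CsW (St_Cs (SW j) sT')))).
Qed.

(** The equation for q is in divergence form up to a source of zero mean. *)
Lemma mean_q t : 0 <= t <= T -> torus_int (q t) = torus_int (q 0).
Proof.
move=> tT; have Sq := hs_b sys. have Sw j := hs_a sys j.
apply: (constant_of_derive0 (g := fun t => torus_int (q t)) _ _ tT).
  exact: (continuous_torus_int_clamp T_gt0 (St_contK Sq)).
move=> s sT; have sT' := inT sT.
have cpw j := St_contK (St_pd j (Sw j)). have cP1 := St_contK (pt_P1 pt).
pose d s x : R := eps^-1 * (- eps * P1 s x - \sum_j pd j (w j s) x).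
have cd : contK T d by rewrite /d; cont_t.
apply: (is_derive_eq (torus_int_dtime (St_contK Sq) cd (hs_dtb sys) sT)).
have ic j : continuous (pd j (w j s)) := Cs_pd_cont (Cw j sT').
have cS : continuous (fun x => \sum_j pd j (w j s) x) by cont.
have cP := Cs_cont (CP sT').
have cP' : continuous (fun x => - eps * P1 s x) by cont.
rewrite /d torus_intZ; last by cont.
rewrite torus_intB; [|exact: cP'|exact: cS].
rewrite (torus_intZ _ cP) (pt_mP pt sT) (torus_int_sum _ ic) big1 => [|j _].
  by rewrite mulr0 subr0 mulr0.
exact: (torus_int_div j (hs_pa sys j sT') (CsW (CsW (Cw j sT')))).
Qed.

Lemma l2v_le_d1v t : 0 <= t <= T ->
  l2v (w ^~ t) <= d1v (w ^~ t) + l2v (w ^~ 0).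
Proof.
move=> tT; rewrite /l2v /d1v -big_split; apply: ler_sum => i _ /=.
have O : 0 <= (0 : R) <= T by rewrite lexx ltW.
apply: (le_trans (poincare_l2sq (CsW (CsW (Cw i tT))))).
rewrite [leLHS]addrC lerD2l (mean_w i tT); exact: (torus_int_sqr_le (Cs_cont (Cw i O))).
Qed.

Lemma l2sq_q_le t : 0 <= t <= T -> l2sq (q t) <= l2sq (q 0) + d1sq (q t).
Proof.
move=> tT; have O : 0 <= (0 : R) <= T by rewrite lexx ltW.
apply: (le_trans (poincare_l2sq (CsW (CsW (Cq tT))))).
rewrite lerD2r (mean_q tT); exact: (torus_int_sqr_le (Cs_cont (Cq O))).
Qed.

Lemma energy1_upper t : 0 <= t <= T -> energy1 t <=
  2 * d1v (w ^~ t) + 18 * B * (eps + del) ^+ 2 + eps * d1sq (q t)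
  + del * \sum_i \sum_j d1sq (W i j t).
Proof.
move=> tT.
have cP := Cs_cont (CP tT). have [PB _ _] := pt_P1B pt tT.
have H k i : l2sq (shifted k i t) <= 2 * l2sq (pd k (w i t)) + 2 * (B * sig2).
  have c1 : continuous (pd k (w i t)) := Cs_pd_cont (St_Cs (hs_a sys i) tT).
  have c2 : continuous (fun x => eps * (i == k)%:R * P1 t x) by cont.
  apply: (le_trans (l2sqD c1 c2)); rewrite lerD2l ler_pM2l// (l2sqZ _ cP) mulrC.
  by apply: ler_pM; [exact: l2sq_ge0|exact: sqr_ge0|exact: l2sq_bounded|exact: bool_sig].
have E k : energy eps del (shifted k) (fun t => pd k (q t))
    (fun i j t => pd k (W i j t)) t <=
    2 * l2v (fun i => pd k (w i t)) + 6 * (B * sig2) + eps * l2sq (pd k (q t))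
    + del * \sum_i \sum_j l2sq (pd k (W i j t)).
  have ca i := Cs_cont (St_Cs (hs_a (system1 k) i) tT).
  have cb := Cs_cont (St_Cs (hs_b (system1 k)) tT).
  have cD i j := Cs_cont (St_Cs (hs_D (system1 k) i j) tT).
  rewrite energyE// !lerD2r.
  apply: (@le_trans _ _ (\sum_i (2 * l2sq (pd k (w i t)) + 2 * (B * sig2)))).
    by apply: ler_sum => i _; exact: H.
  rewrite big_split /= -mulr_sumr lerD2l sumr_const card_ord -mulr_natr.
  by rewrite le_eqVlt; apply/orP; left; apply/eqP; ring.
apply: (le_trans (ler_sum _ (fun k _ => E k))).
have S := sum_linear (fun k => l2v (fun i => pd k (w i t))) (fun k => l2sq (pd k (q t)))
  (fun k => \sum_i \sum_j l2sq (pd k (W i j t))) (6 * (B * sig2)) eps del 2.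
have fold (x y z x' y' z' v : R) : x = x' -> y = y' -> z = z' ->
    v = 2 * x' + (6 * (B * sig2)) *+ 3 + eps * y' + del * z' ->
    v <= 2 * x + 18 * B * sig2 + eps * y + del * z.
  by move=> -> -> -> ->; rewrite le_eqVlt; apply/orP; left; apply/eqP; ring.
exact (fold _ _ _ _ _ _ _ (A1E t) (d1sqE (q t)) (sum_d1sqE t) S).
Qed.

Lemma energy2E t : 0 <= t <= T -> energy2 t =
  d2v (w ^~ t) + eps * d2sq (q t) + del * \sum_i \sum_j d2sq (W i j t).
Proof.
move=> tT; rewrite -/(A2 t) A2E sum_d2sqE d2sqE.
apply: (etrans _ (sum_linear2 _ _ _ _ _)).
apply: eq_bigr => k _; apply: eq_bigr => l _.
have S := system2 k l.
have ca i := Cs_cont (St_Cs (hs_a S i) tT).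
have cb := Cs_cont (St_Cs (hs_b S) tT).
have cD i j := Cs_cont (St_Cs (hs_D S i j) tT).
exact: (energyE eps del ca cb cD).
Qed.

Let Bs : 0 <= B * sig2.
Proof. by rewrite mulr_ge0// sqr_ge0. Qed.

Let Mt lam t := sup_bound lam (A0 t) (A1 t) (A2 t).

Let Mt_ge0 lam t : 0 < lam -> 0 <= Mt lam t.
Proof. by move=> l0; apply: sup_bound_ge0; rewrite ?l2v_ge0 ?d1v_ge0 ?d2v_ge0. Qed.

Lemma velocity_sup_bound lam t i x : 0 < lam -> lam <= 1 -> 0 <= t <= T -> in_cell x ->
  w i t x ^+ 2 <= sup_bound lam (l2v (w ^~ t)) (d1v (w ^~ t)) (d2v (w ^~ t)).
Proof.
move=> l0 l1 tT xc.
have Cwi := Cw i tT.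
apply: (le_trans (agmon (CsW Cwi) (hs_pa sys i tT) l0 l1 xc)).
rewrite /sup_bound ler_pM2l ?agmon_const_gt0//.
have h0 := term_le_sum (F := fun i => l2sq (w i t)) i (fun i => l2sq_ge0 _).
have h1 := term_le_sum (F := fun i => d1sq (w i t)) i (fun i => d1sq_ge0 _).
have h2 := term_le_sum (F := fun i => d2sq (w i t)) i (fun i => d2sq_ge0 _).
have lV : 0 <= lam^-1 by rewrite invr_ge0 ltW.
exact (lerD (ler_wpM2l lV (lerD h0 h1)) (ler_wpM2l (ltW l0) (lerD h1 h2))).
Qed.

(** The constant is a round upper bound for the sum of the bounds on the
    single entries of the sources; so is the one in [energy2_rate]. *)
Lemma energy1_rate lam t : 0 < lam -> lam <= 1 -> 0 < t < T ->
  derivable energy1 t 1 /\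
  'D_1 energy1 t <= energy1 t + 2000 * (Mt lam t * A1 t + B * (A0 t + A1 t) + B * sig2).
Proof.
move=> l0 l1 tT; have tT' := inT tT.
set h := Mt lam t * A1 t + B * (A0 t + A1 t) + B * sig2.
have h0 : B * sig2 <= h.
  rewrite /h lerDr addr_ge0//; first by rewrite mulr_ge0 ?Mt_ge0 ?d1v_ge0.
  by rewrite mulr_ge0 ?addr_ge0 ?l2v_ge0 ?d1v_ge0.
have [] := @is_derive_sum3 R (fun k => energy eps del (shifted k)
    (fun t => pd k (q t)) (fun i j t => pd k (W i j t))) t
    (3 * (B * sig2) + 0 + 9 * (64 * h)).
  move=> k; apply: (energy_rate eps_gt0 del_gt0 (system1 k) tT).
  - move=> i.
    have -> : (fun x => pd k (fun _ : X => 0) x + eps * (i == k)%:R * P2 t x) =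
        (fun x => eps * (i == k)%:R * P2 t x).
      by apply/funext => x; rewrite pd_cst add0r.
    have cP := Cs_cont (St_Cs (pt_P2 pt) tT').
    have PB := l2sq_bounded cP (fun x xc => pt_P2B pt tT' xc).
    rewrite (l2sqZ _ cP) mulrC.
    apply: (ler_pM _ _ PB (bool_sig i k)); [exact: l2sq_ge0|exact: sqr_ge0].
  - by rewrite l2sqE; under eq_torus_int do rewrite expr0n /=; rewrite torus_int_cst mulr0.
  - move=> i j.
    exact: (l2sq_source1 (fun i => CsW (St_Cs (hs_a sys i) tT'))
      (fun i => St_Cs (pt_u pt i) tT') (Mt_ge0 t l0) B0
      (fun i x xc => velocity_sup_bound i l0 l1 tT' xc)
      (fun i => pt_uB pt i tT') (fun i j => St_Cs (pt_V pt i j) tT')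
      (fun i j => pt_VB pt i j tT') del_sig i j k
      (St_Cs (pt_P1 pt) tT') (pt_P1B pt tT') (bool_sig i k)).
move=> d E; split=> //; apply: (le_trans E); rewrite lerD2l.
move: (B * sig2) h Bs h0 {E d} => s h' s0 h0; lra.
Qed.

Lemma energy2_rate lam t : 0 < lam -> lam <= 1 -> 0 < t < T ->
  derivable energy2 t 1 /\
  'D_1 energy2 t <= energy2 t + 30 * 2000 * (Mt lam t * A2 t + B * (A0 t + 2 * A1 t + A2 t) + B).
Proof.
move=> l0 l1 tT; have tT' := inT tT.
set h := Mt lam t * A2 t + B * (A0 t + 2 * A1 t + A2 t) + B.
have h0 : B <= h.
  rewrite /h lerDr addr_ge0//; first by rewrite mulr_ge0 ?Mt_ge0 ?d2v_ge0.
  by rewrite mulr_ge0// !addr_ge0 ?mulr_ge0 ?l2v_ge0 ?d1v_ge0 ?d2v_ge0.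
have [] := @is_derive_sum3 R (fun k t => \sum_l energy eps del
    (fun i t => pd l (pd k (w i t))) (fun t => pd l (pd k (q t)))
    (fun i j t => pd l (pd k (W i j t))) t) t (3 * (3 * 0 + B + 9 * (640 * h))).
  move=> k; apply: is_derive_sum3 => l.
  apply: (energy_rate eps_gt0 del_gt0 (system2 k l) tT).
  - move=> i; rewrite l2sqE.
    have -> : (fun x => pd l (pd k (fun _ : X => 0)) x ^+ 2) = (fun=> 0).
      by apply/funext => x; rewrite !pd_cst expr0n.
    by rewrite torus_int_cst.
  - have CPt := St_Cs (pt_P1 pt) tT'.
    have [_ _ P2B] := pt_P1B pt tT'.
    have cP2 := Cs_pd_cont (j := l) (Cs_pd k CPt).
    have -> : pd l (pd k (fun x => - eps * P1 t x)) = (fun x => - eps * pd l (pd k (P1 t)) x).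
      rewrite (@pdZ R (- eps) _ (Cs_pdable CPt) k).
      exact: (@pdZ R (- eps) _ (Cs_pdable (Cs_pd k CPt)) l).
    rewrite (l2sqZ _ cP2) sqrrN expr2 -(mulrA eps) mulKf ?gt_eqF//.
    have LB := l2sq_bounded cP2 (P2B l k).
    have e1 : eps <= 1 by apply: le_trans sig_le1; rewrite lerDl ltW.
    apply: (le_trans _ LB); rewrite ler_piMl//; exact: l2sq_ge0.
  - move=> i j.
    exact: (l2sq_source2 (fun i => CsW (St_Cs (hs_a sys i) tT'))
      (fun i => St_Cs (pt_u pt i) tT') (Mt_ge0 t l0) B0
      (fun i x xc => velocity_sup_bound i l0 l1 tT' xc)
      (fun i => pt_uB pt i tT') (fun i j => St_Cs (pt_V pt i j) tT')
      (fun i j => pt_VB pt i j tT') del_sig i j k l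
      (fun i => hs_pa sys i tT') sig2_le1).
move=> d E; split=> //; apply: (le_trans E); rewrite lerD2l.
move: h h0 B0 {E d} => h' h0 B1; lra.
Qed.

Lemma continuous_energy1 : continuous (fun t => energy1 (clamp T t)).
Proof.
apply: cont_sum => k; exact: (continuous_energy T_gt0 (system1 k)).
Qed.

Lemma continuous_energy2 : continuous (fun t => energy2 (clamp T t)).
Proof.
apply: cont_sum => k; apply: cont_sum => l.
exact: (continuous_energy T_gt0 (system2 k l)).
Qed.

End perturbation.

(** [logistic_rate] turns the two energy inequalities into a single one, to
    which [logistic_bound] applies. *)
Theorem energy_bound (R : realType) (B c0 : R) : 0 <= B -> 0 <= c0 ->
  exists2 C : R, 0 <= C & forall (T eps del lam s : R) w q W u V P1 P2,
    let Z t := lam^-1 * energy1 eps del w q W P1 t + lam * energy2 eps del w q W t in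
    0 < T -> 0 < eps -> 0 < del -> eps + del <= 1 ->
    perturbation T eps del B w q W u V P1 P2 ->
    0 < lam -> lam <= s -> s <= 1 -> lam * s = (eps + del) ^+ 2 ->
    l2v (w ^~ 0) <= c0 * (eps + del) ^+ 2 ->
    (Z 0 + s) * expR (C * T) <= 2^-1 ->
    forall t, 0 <= t <= T -> Z t <= 2 * ((Z 0 + s) * expR (C * T)).
Proof.
move=> B0 c00.
have [C C0 HC] := @logistic_rate R (agmon_const R) B c0 2000 (30 * 2000)
  (ltW (agmon_const_gt0 R)) B0 c00 (ler0n _ _) (mulr_ge0 (ler0n _ _) (ler0n _ _)).
exists C => // T eps del lam s w q W u V P1 P2 Z T0 e0 d0 sg pt l0 ls s1 lsE w0 small t tT.
have l1 : lam <= 1 by apply: le_trans ls s1.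
have s0 : 0 <= s <= 1 by rewrite s1 andbT (le_trans (ltW l0) ls).
have inT t' : 0 < t' < T -> 0 <= t' <= T by move=> /andP[? ?]; rewrite !ltW.
have lV0 : 0 <= lam^-1 by rewrite invr_ge0 ltW.
pose dZ t' := lam^-1 * 'D_1 (energy1 eps del w q W P1) t' + lam * 'D_1 (energy2 eps del w q W) t'.
apply: (logistic_bound (dZ := dZ) T0 C0 s0 _ _ _ _ small tT).
- have c1 := continuous_energy1 T0 pt. have c2 := continuous_energy2 T0 pt.
  exact: (contD (contM (@cont_cst _ _ lam^-1) c1) (contM (@cont_cst _ _ lam) c2)).
- move=> t' tT'.
  have [D1 _] := energy1_rate T0 e0 d0 B0 pt l0 l1 tT'.
  have [D2 _] := energy2_rate T0 e0 d0 sg B0 pt l0 l1 tT'.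
  apply: (is_derive_eq (is_deriveD_fun
    (is_deriveM_fun (is_derive_cst_fun lam^-1 t' 1) (derivableP D1))
    (is_deriveM_fun (is_derive_cst_fun lam t' 1) (derivableP D2)))).
  by rewrite !mulr0 !addr0.
- move=> t' tT'; rewrite /Z addr_ge0// mulr_ge0 ?(ltW l0)//.
    exact: energy1_ge0 pt _ _.
  exact: energy2_ge0 pt _ _.
- move=> t' tT'; have tT2 := inT _ tT'.
  have [_ R1] := energy1_rate T0 e0 d0 B0 pt l0 l1 tT'.
  have [_ R2] := energy2_rate T0 e0 d0 sg B0 pt l0 l1 tT'.
  apply: (HC _ _ _ _ _ _ _ _ _ _ _ l0 ls s1 lsE (l2v_ge0 _) (d1v_ge0 _) (d2v_ge0 _)
    (energy1_ge0 T0 e0 d0 pt tT2) (energy2_ge0 T0 e0 d0 pt tT2)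
    (d1v_le_energy1 T0 e0 d0 pt tT2) _ (d2v_le_energy2 T0 e0 d0 pt tT2) erefl R1 R2).
  by apply: (le_trans (l2v_le_d1v T0 pt tT2)); rewrite lerD2l.
Qed.

(** * The estimate in H^1 *)

Lemma powR_small (R : realType) (a th : R) : 0 <= a -> a < 1 -> 0 < th ->
  exists2 eta : R, 0 < eta & forall sig : R, 0 < sig -> sig < eta ->
    [/\ sig <= 1, sig <= sig `^ a, sig `^ a <= 1 & sig / sig `^ a <= th].
Proof.
move=> a0 a1 th0; have b0 : 0 < 1 - a by rewrite subr_gt0.
exists (Num.min 1 (th `^ (1 - a)^-1)); first by rewrite lt_min ltr01 powR_gt0.
move=> sig s0; rewrite lt_min => /andP[s1 sth].
have p (c : R) : 0 <= c -> sig `^ c <= 1.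
  move=> c0; have E : 1 = 1 `^ c :> R by rewrite powR1.
  rewrite [leRHS]E.
  by apply: ge0_ler_powR; rewrite ?nnegrE ?(ltW s0)// ltW.
have e : sig / sig `^ a = sig `^ (1 - a).
  rewrite powRD ?gt_eqF ?implybT//.
  by rewrite powRr1 ?(ltW s0)// powRN.
split; [exact: ltW| |exact: p|].
- have := p _ (ltW b0); rewrite -e ler_pdivrMr ?powR_gt0// mul1r.
  by [].
- rewrite e; have := @ge0_ler_powR R (1 - a) (ltW b0) sig (th `^ (1 - a)^-1).
  rewrite !nnegrE powR_ge0 (ltW s0) => /(_ isT isT (ltW sth)) /le_trans; apply.
  by rewrite -powRrM mulVf ?gt_eqF// powRr1// ltW.
Qed.

(** Put r = sigma^a, lam = sigma r and s = sigma / r, so that lam s = sigma^2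
    and lam <= s. The energies are initially of order sigma^2 and r^-2, hence
    Z(0) is of order s, which is small because a < 1. By [energy_bound] Z
    remains of order s up to time T, and the first energy, at most lam Z, of
    order sigma^2. The conserved means and the Poincare inequality give the
    norms of order zero. *)
Theorem H1_estimate (R : realType) (B C0 D a T : R) : 0 <= B -> 0 <= C0 -> 0 <= D ->
  0 <= a -> a < 1 -> 0 < T ->
  exists K eta : R, [/\ 0 <= K, 0 < eta & forall (eps del : R) w q W u V P1 P2,
    0 < eps -> 0 < del -> eps + del < eta ->
    perturbation T eps del B w q W u V P1 P2 ->
    l2v (w ^~ 0) + d1v (w ^~ 0) + eps * (l2sq (q 0) + d1sq (q 0))
      + del * \sum_i \sum_j d1sq (W i j 0) <= C0 * (eps + del) ^+ 2 ->
    d2v (w ^~ 0) + eps * d2sq (q 0) + del * \sum_i \sum_j d2sq (W i j 0)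
      <= D * ((eps + del) `^ (- a)) ^+ 2 ->
    forall t, 0 <= t <= T ->
      l2v (w ^~ t) + d1v (w ^~ t) <= K * (eps + del) ^+ 2 /\
      eps * (l2sq (q t) + d1sq (q t)) <= K * (eps + del) ^+ 2].
Proof.
move=> B0 C00 D0 a0 a1 T0.
have init1 (x0 x1 y0 y1 f z c b : R) : 0 <= x0 -> 0 <= f * y0 -> 0 <= f * y1 -> 0 <= z ->
    0 <= x1 -> x0 + x1 + f * (y0 + y1) + z <= c ->
    2 * x1 + b + f * y1 + z <= 2 * c + b.
  by move=> ? ? ? ? ?; rewrite mulrDr => ?; lra.
have init0 (x0 x1 y0 y1 f z c : R) : 0 <= f * y0 -> 0 <= f * y1 -> 0 <= z ->
    0 <= x1 -> x0 + x1 + f * (y0 + y1) + z <= c -> x0 <= c.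
  by move=> ? ? ? ?; rewrite mulrDr => ?; lra.
have init2 (x0 x1 y0 y1 f z c : R) : 0 <= x0 -> 0 <= f * y1 -> 0 <= z ->
    0 <= x1 -> x0 + x1 + f * (y0 + y1) + z <= c -> f * y0 <= c.
  by move=> ? ? ? ?; rewrite mulrDr => ?; lra.
have final (k s2 y x1 x0 f q q1 q0 : R) : 0 <= B * s2 -> 0 <= k * s2 -> y <= k * s2 ->
    x1 <= 2 * y + 18 * B * s2 -> x0 <= x1 + C0 * s2 ->
    f * q1 <= y -> f * q <= f * (q0 + q1) -> f * q0 <= C0 * s2 ->
    x0 + x1 <= (4 * k + 36 * B + C0) * s2 /\ f * (q + q1) <= (4 * k + 36 * B + C0) * s2.
  move=> ? ? ? ? ? ?; rewrite mulrDr => ? ?.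
  by rewrite (mulrDr f) !(mulrDl _ _ s2); split; lra.
have [C Cge HC] := @energy_bound R B C0 B0 C00.
pose e := expR (C * T); have e0 : 0 < e := expR_gt0 _.
pose c := 2 * C0 + 18 * B + D + 1.
have cp : 0 < c by rewrite /c; lra.
have ce0 : 0 < c * e by rewrite mulr_gt0.
have [eta eta0 Heta] := @powR_small R a (2 * (c * e))^-1 a0 a1 ltac:(by rewrite invr_gt0 mulr_gt0).
pose K := 2 * (c * e).
have K0 : 0 <= K by rewrite /K mulr_ge0 ?ltW.
exists (4 * K + 36 * B + C0), eta; split => //; first by lra.
move=> eps del w q W u V P1 P2 eps0 del0 sig_eta pt I1 I2 t tT.
set sig := eps + del in sig_eta I1 I2 *.
have sig0 : 0 < sig by rewrite addr_gt0.
have [s1 sr r1 sth] := Heta _ sig0 sig_eta.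
set r := sig `^ a in sr r1 sth.
have r0 : 0 < r by rewrite powR_gt0.
pose lam := sig * r; pose s := sig / r.
have lam0 : 0 < lam by rewrite mulr_gt0.
have s0 : 0 < s by rewrite divr_gt0.
have lamsE : lam * s = sig ^+ 2 by rewrite /lam /s; field; rewrite gt_eqF.
have lams : lam <= s.
  rewrite /lam /s ler_pdivlMr// -mulrA ler_piMr ?(ltW sig0)//.
  by rewrite mulr_ile1 ?(ltW r0).
have ls1 : s <= 1 by rewrite /s ler_pdivrMr// mul1r.
have O : 0 <= (0 : R) <= T by rewrite lexx ltW.
have rE : (sig `^ (- a)) ^+ 2 = r^-1 ^+ 2 by rewrite powRN.
have q0 := l2sq_ge0 (q 0); have q1 := d1sq_ge0 (q 0).
have w0 := l2v_ge0 (w ^~ 0); have w1 := d1v_ge0 (w ^~ 0).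
have W1 : 0 <= \sum_i \sum_j d1sq (W i j 0).
  by apply: sumr_ge0 => i _; apply: sumr_ge0 => j _; exact: d1sq_ge0.
have sig20 := sqr_ge0 sig.
have eq0 := mulr_ge0 (ltW eps0) q0; have eq1 := mulr_ge0 (ltW eps0) q1.
have dW1 := mulr_ge0 (ltW del0) W1.
have eqW (x y : R) : x = y -> x <= y by move=> ->.
have Y10 := le_trans (energy1_upper T0 eps0 del0 pt O) (init1 _ _ _ _ _ _ _ _ w0 eq0 eq1 dW1 w1 I1).
have Y20 := le_trans (eqW _ _ (energy2E T0 pt O)) I2.
have w0le := init0 _ _ _ _ _ _ _ eq0 eq1 dW1 w1 I1.
have q0le := init2 _ _ _ _ _ _ _ w0 eq1 dW1 w1 I1.
rewrite rE in Y20; rewrite -/sig in Y10.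
set y1 := energy1 _ _ _ _ _ _ 0 in Y10; set y2 := energy2 _ _ _ _ _ 0 in Y20.
have lV0 : 0 <= lam^-1 by rewrite invr_ge0 ltW.
have Z0 : lam^-1 * y1 + lam * y2 + s <= c * s.
  have h1 := ler_wpM2l lV0 Y10. have h2 := ler_wpM2l (ltW lam0) Y20.
  have g1 : lam^-1 * (2 * (C0 * sig ^+ 2) + 18 * B * sig ^+ 2) = (2 * C0 + 18 * B) * s.
    by rewrite /lam /s; field; rewrite !gt_eqF.
  have g2 : lam * (D * r^-1 ^+ 2) = D * s by rewrite /lam /s; field; rewrite !gt_eqF.
  rewrite g1 in h1; rewrite g2 in h2; rewrite /c.
  have -> : (2 * C0 + 18 * B + D + 1) * s = (2 * C0 + 18 * B) * s + D * s + s by ring.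
  by rewrite lerD2r; exact: (lerD h1 h2).
have small : (lam^-1 * y1 + lam * y2 + s) * e <= 2^-1.
  apply: (le_trans (ler_wpM2r (ltW e0) Z0)).
  have -> : c * s * e = c * e * s by ring.
  apply: (le_trans (ler_wpM2l (ltW ce0) sth)).
  by rewrite invfM mulrCA mulfV ?mulr1// gt_eqF.
have H := HC T eps del lam s w q W u V P1 P2 T0 eps0 del0 s1 pt lam0 lams ls1 lamsE w0le small t tT.
have HK : lam^-1 * energy1 eps del w q W P1 t + lam * energy2 eps del w q W t <= K * s.
  apply: (le_trans H); have -> : K * s = 2 * (c * s * e) by rewrite /K; ring.
  by rewrite ler_pM2l// ler_wpM2r// ltW.
have Y2t := mulr_ge0 (ltW lam0) (energy2_ge0 T0 eps0 del0 pt tT).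
have Y1t : energy1 eps del w q W P1 t <= K * sig ^+ 2.
  have h : lam^-1 * energy1 eps del w q W P1 t <= K * s by apply: le_trans HK; rewrite lerDl.
  by move: h; rewrite mulrC ler_pdivrMr// -mulrA (mulrC s) lamsE.
have F1 := d1v_le_energy1 T0 eps0 del0 pt tT.
have F0 := l2v_le_d1v T0 pt tT.
have G1 := d1sq_le_energy1 T0 del0 pt tT.
have G0 := ler_wpM2l (ltW eps0) (l2sq_q_le T0 pt tT).
have Bsig : 0 <= B * sig ^+ 2 by rewrite mulr_ge0.
have Ksig : 0 <= K * sig ^+ 2 by rewrite mulr_ge0.
exact: (final _ _ _ _ _ _ _ _ _ Bsig Ksig Y1t F1 (le_trans F0 (lerD (lexx _) w0le)) G1 G0 q0le).
Qed.

(** * Sobolev norms of tensors *)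

Section sobolev_norms.
Variable R : realType.
Local Notation X := 'rV[R]_3.
Implicit Types (J : finType).

Lemma L2norm_sqr J (f : tensor R J) : L2norm f ^+ 2 = \sum_k l2sq (f k).
Proof.
rewrite /L2norm sqr_sqrtr; last first.
  by apply: sumr_ge0 => k _; apply: torus_int_ge0 => x; exact: sqr_ge0.
by apply: eq_bigr => k _; exact (esym (l2sqE (f k))).
Qed.

Lemma L2norm_tgrad_sqr J (f : tensor R J) : L2norm (tgrad f) ^+ 2 = \sum_k d1sq (f k).
Proof.
apply: (etrans (L2norm_sqr _)).
apply: (etrans (esym (pair_bigA _ (fun k j => l2sq (pd j (f k)))))).
by apply: eq_bigr => k _; exact (esym (d1sqE (f k))).
Qed.

Lemma L2norm_tgrad2_sqr J (f : tensor R J) :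
  L2norm (tgrad (tgrad f)) ^+ 2 = \sum_k d2sq (f k).
Proof.
apply: (etrans (L2norm_tgrad_sqr _)).
apply: (etrans (esym (pair_bigA _ (fun k j => d1sq (pd j (f k)))))).
apply: eq_bigr => k _; apply: (etrans _ (esym (d2sqE (f k)))).
by apply: eq_bigr => j _; exact: d1sqE.
Qed.

Lemma H1norm_ge0 J (f : tensor R J) : 0 <= H1norm f.
Proof. exact: sqrtr_ge0. Qed.

Lemma H1norm_sqr J (f : tensor R J) :
  H1norm f ^+ 2 = \sum_k l2sq (f k) + \sum_k d1sq (f k).
Proof.
rewrite /H1norm sqr_sqrtr ?addr_ge0 ?sqr_ge0//.
by rewrite L2norm_tgrad_sqr L2norm_sqr.
Qed.

Lemma sum_unit (F : unit -> R) : \sum_k F k = F tt.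
Proof. by rewrite (big_pred1 tt)// => -[]. Qed.

Lemma sum_mat (F : 'I_3 * 'I_3 -> R) : \sum_k F k = \sum_i \sum_j F (i, j).
Proof. by rewrite (pair_bigA _ (fun i j => F (i, j))); apply: eq_bigr => -[]. Qed.

Lemma H1norm_tvec_sqr (v : X -> X) :
  H1norm (tvec v) ^+ 2 = l2v (fun i x => v x 0 i) + d1v (fun i x => v x 0 i).
Proof. exact: H1norm_sqr. Qed.

Lemma H1norm_tscal_sqr (f : X -> R) : H1norm (tscal f) ^+ 2 = l2sq f + d1sq f.
Proof. by rewrite H1norm_sqr !sum_unit. Qed.

Lemma H1norm_tmat_ge (M : X -> 'M[R]_3) :
  \sum_i \sum_j d1sq (fun x => M x i j) <= H1norm (tmat M) ^+ 2.
Proof.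
rewrite H1norm_sqr !sum_mat lerDr.
by apply: sumr_ge0 => i _; apply: sumr_ge0 => j _; exact: l2sq_ge0.
Qed.

Lemma d2sqZ (c : R) (f : X -> R) : Cs 2 f -> d2sq (fun x => c * f x) = c ^+ 2 * d2sq f.
Proof.
move=> Cf; rewrite !d2sqE mulr_sumr; apply: eq_bigr => j _.
rewrite mulr_sumr; apply: eq_bigr => k _.
have -> : pd k (pd j (fun x => c * f x)) = (fun x => c * pd k (pd j f) x).
  rewrite (@pdZ R c _ (Cs_pdable Cf) j); exact: (@pdZ R c _ (Cs_pdable (Cs_pd j Cf)) k).
exact: (l2sqZ c (Cs_pd_cont (Cs_pd j Cf))).
Qed.

Lemma hessian_norm_sqr (eps del : R) (u : X -> X) (p : X -> R) (U : X -> 'M[R]_3) :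
  0 <= eps -> 0 <= del -> Cs 2 p -> (forall i j, Cs 2 (fun x => U x i j)) ->
  L2norm (tgrad (tgrad (tpair (tvec u) (tpair (tscal (fun x => Num.sqrt eps * p x))
    (tmat (fun x => Num.sqrt del *: U x)))))) ^+ 2 =
  d2v (fun i x => u x 0 i) + eps * d2sq p + del * \sum_i \sum_j d2sq (fun x => U x i j).
Proof.
move=> e0 d0 Cp CU; rewrite L2norm_tgrad2_sqr !big_sumType /= sum_unit sum_mat addrA.
congr (_ + _ + _).
  by rewrite /tscal (d2sqZ _ Cp) sqr_sqrtr.
rewrite mulr_sumr; apply: eq_bigr => i _; rewrite mulr_sumr; apply: eq_bigr => j _.
rewrite -[del in RHS]sqr_sqrtr// -(d2sqZ _ (CU i j)).
by congr d2sq; apply/funext => x; rewrite /tmat /= mxE.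
Qed.

Lemma d2sqB_le (f g : X -> R) (B : R) : Cs 2 f -> Cs 2 g -> C2_bounded B g ->
  d2sq (fun x => f x - g x) <= 2 * d2sq f + 18 * B.
Proof.
move=> Cf Cg [_ _ gB].
have H j k : l2sq (pd k (pd j (fun x => f x - g x))) <= 2 * l2sq (pd k (pd j f)) + 2 * B.
  have cf := Cs_pd_cont (j := k) (Cs_pd j Cf). have cg := Cs_pd_cont (j := k) (Cs_pd j Cg).
  have -> : pd k (pd j (fun x => f x - g x)) =
      (fun x => pd k (pd j f) x + - pd k (pd j g) x).
    rewrite (pdB j (Cs_pdable Cf) (Cs_pdable Cg)).
    exact: (pdB k (Cs_pdable (Cs_pd j Cf)) (Cs_pdable (Cs_pd j Cg))).
  apply: (le_trans (l2sqD cf (contN cg))); rewrite l2sqN lerD2l ler_pM2l//.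
  exact: (l2sq_bounded cg (gB k j)).
rewrite !d2sqE mulr_sumr.
have -> : 18 * B = 3 * (3 * (2 * B)) by ring.
have sumS (F G : 'I_3 -> R) (c : R) : (forall i, F i <= G i + c) -> \sum_i F i <= \sum_i G i + 3 * c.
  move=> h; apply: (le_trans (ler_sum _ (fun i _ => h i))).
  by rewrite big_split /= sumr_const card_ord mulr_natl.
apply: (sumS) => j; rewrite mulr_sumr; apply: (sumS) => k; exact: H.
Qed.

End sobolev_norms.

(** * The difference of two solutions *)

Section uniform_bounds.
Variables (R : realType) (T : R).
Local Notation X := 'rV[R]_3.

Lemma contK_family_bounded (J : finType) (F : J -> R -> X -> R) :
  (forall i, contK T (F i)) ->
  exists2 B, 0 <= B & forall i t x, 0 <= t <= T -> in_cell x -> F i t x ^+ 2 <= B.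
Proof.
move=> cF.
have H i : exists M : R, forall t x, 0 <= t <= T -> in_cell x -> F i t x ^+ 2 <= M.
  have [M M0 FM] := contK_bounded (cF i); exists (M ^+ 2) => t x tT xc.
  rewrite -real_normK ?num_real// ler_sqr ?nnegrE ?(ltW M0)//; exact: FM.
have [b Hb] := choice H.
exists (\sum_i `|b i|); first by apply: sumr_ge0.
move=> i t x tT xc; apply: (le_trans (Hb i t x tT xc)); apply: (le_trans (ler_norm _)).
by rewrite (bigD1 i)//= lerDl sumr_ge0.
Qed.

Lemma C2_bounded_le (B B' : R) (f : X -> R) : B <= B' -> C2_bounded B f -> C2_bounded B' f.
Proof.
move=> BB [H0 H1 H2]; split.
- by move=> x xc; exact: le_trans (H0 x xc) BB.
- by move=> k x xc; exact: le_trans (H1 k x xc) BB.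
- by move=> k l x xc; exact: le_trans (H2 k l x xc) BB.
Qed.

Lemma St_family_bounded (J : finType) (F : J -> R -> X -> R) :
  (forall i, St T 2 (F i)) ->
  exists2 B, 0 <= B & forall i t, 0 <= t <= T -> C2_bounded B (F i t).
Proof.
move=> SF.
have [B0 B00 H0] := contK_family_bounded (fun i => St_contK (SF i)).
have [B1 B10 H1] := contK_family_bounded
  (fun z : J * 'I_3 => St_contK (St_pd z.2 (SF z.1))).
have [B2 B20 H2] := contK_family_bounded
  (fun z : J * 'I_3 * 'I_3 => St_contK (St_pd z.2 (St_pd z.1.2 (SF z.1.1)))).
exists (B0 + B1 + B2); first by rewrite !addr_ge0.
move=> i t tT; split.
- by move=> x xc; apply: (le_trans (H0 i t x tT xc)); lra.
- by move=> k x xc; apply: (le_trans (H1 (i, k) t x tT xc)); lra.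
- by move=> k l x xc; apply: (le_trans (H2 (i, l, k) t x tT xc)); lra.
Qed.

End uniform_bounds.

Section time_derivative.
Variable R : realType.
Implicit Types (I : set R).

Lemma dt_ext I (f g : R -> R) t : I t -> (forall s, I s -> f s = g s) -> dt I f t = dt I g t.
Proof.
move=> It fg; have E s : I s -> dquot f t s = dquot g t s by move=> Is; rewrite /dquot !fg.
have HI : (within I t^') I by exact: withinT.
rewrite /dt; congr (lim _); apply/funext => P; apply/propeqP; split => H.
  change ((within I t^') (dquot g t @^-1` P)).
  by apply: filterS2 HI (H : (within I t^') (dquot f t @^-1` P)) => s Is; rewrite /preimage /= E.
change ((within I t^') (dquot f t @^-1` P)).
by apply: filterS2 HI (H : (within I t^') (dquot g t @^-1` P)) => s Is; rewrite /preimage /= E.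
Qed.

Lemma smooth_dt I (f : R -> 'rV[R]_3 -> R) : smooth I f ->
  smooth I (fun t x => dt I (f^~ x) t).
Proof. by move=> sf n; have [_ []] := sf n.+1. Qed.

End time_derivative.

Section solutions_to_perturbation.
Variables (R : realType) (T : R).
Hypothesis T_gt0 : 0 < T.
Local Notation X := 'rV[R]_3.
Implicit Types (i j k : 'I_3).
Variables (T0 : \bar R) (p : R -> X -> R) (u : R -> X -> X) (U : R -> X -> 'M[R]_3).
Hypotheses (T_le_T0 : (T%:E <= T0)%E) (NS : navier_stokes T0 p u U).

Let I0 := time_upto T0.
Let TI0 t : 0 <= t <= T -> I0 t.
Proof. by move=> /andP[t0 tT]; split => //; apply: le_trans T_le_T0; rewrite lee_fin. Qed.

Definition coord (v : R -> X -> X) i t x := v t x 0 i.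
Definition entry (M : R -> X -> 'M[R]_3) i j t x := M t x i j.
Definition dtp t x := dt (time_upto T0) (p^~ x) t.
Definition dttp t x := dt (time_upto T0) (dtp^~ x) t.
Definition dtU i j t x := dt (time_upto T0) (fun s => U s x i j) t.

Let sp : smooth I0 p. Proof. by have [[]] := NS. Qed.
Let su i : smooth I0 (coord u i). Proof. by have [[_ _ h _] _ _ _ _] := NS; exact: (h i). Qed.
Let sU i j : smooth I0 (entry U i j). Proof. by have [[_ _ _ h] _ _ _ _] := NS; exact: (h i j). Qed.

Let SI0 n F : smooth I0 F -> St T n F.
Proof. by move=> sF; exact: (Ck_St T_gt0 TI0 (sF n)). Qed.

Lemma reference_bounded : exists2 B : R, 0 <= B & forall t, 0 <= t <= T ->
  [/\ forall i, C2_bounded B (coord u i t),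
      forall i j, C2_bounded B (entry U i j t) /\ C2_bounded B (dtU i j t),
      C2_bounded B (p t), C2_bounded B (dtp t)
    & forall x, in_cell x -> dttp t x ^+ 2 <= B].
Proof.
have [B1 B10 H1] := St_family_bounded (fun i => SI0 2 (su i)).
have [B2 B20 H2] := St_family_bounded (fun z : 'I_3 * 'I_3 => SI0 2 (sU z.1 z.2)).
have [B3 B30 H3] := St_family_bounded (fun z : 'I_3 * 'I_3 => SI0 2 (smooth_dt (sU z.1 z.2))).
have [B4 B40 H4] := St_family_bounded (fun _ : unit => SI0 2 sp).
have [B5 B50 H5] := St_family_bounded (fun _ : unit => SI0 2 (smooth_dt sp)).
have [B6 B60 H6] := St_family_bounded (fun _ : unit => SI0 2 (smooth_dt (smooth_dt sp))).
exists (B1 + B2 + B3 + B4 + B5 + B6); first by rewrite !addr_ge0.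
move=> t tT; split.
- by move=> i; apply: C2_bounded_le (H1 i t tT); lra.
- move=> i j; split.
    by apply: C2_bounded_le (H2 (i, j) t tT); lra.
  by apply: C2_bounded_le (H3 (i, j) t tT); lra.
- by apply: C2_bounded_le (H4 tt t tT); lra.
- by apply: C2_bounded_le (H5 tt t tT); lra.
- by move=> x xc; have [h _ _] := H6 tt t tT; apply: (le_trans (h x xc)); lra.
Qed.

Let inT t : 0 < t < T -> 0 <= t <= T.
Proof. by move=> /andP[? ?]; rewrite !ltW. Qed.

Lemma periodic_dtp t : 0 <= t <= T -> Defs.periodic (dtp t).
Proof.
move=> tT i x; apply: dt_ext => [|s Is]; first exact: TI0.
by have [[per _ _ _] _ _ _ _] := NS; have [pp _ _] := per s Is; exact: pp.
Qed.

Lemma mean_dtp t : 0 < t < T -> torus_int (dtp t) = 0.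
Proof.
move=> tT; have [_ _ _ mp _] := NS.
have d := torus_int_dtime (St_contK (SI0 1 sp)) (St_contK (SI0 1 (smooth_dt sp)))
  (Ck_dtime TI0 (sp 1)) tT.
have d0 : is_derive t (1 : R) (fun t => torus_int (p t)) 0.
  apply: near_eq_is_derive (is_derive_cst_fun 0 t 1).
  have := interior_nbhs TI0 tT; apply: filterS => s Is; exact: (esym (mp s Is)).
by have [_ <-] := d0; have [_ <-] := d.
Qed.

Variables (eps del : R) (pi0 : X -> R) (ui0 : X -> X) (Ui0 : X -> 'M[R]_3)
  (T1 : \bar R) (pr : R -> X -> R) (ur : R -> X -> X) (Ur : R -> X -> 'M[R]_3).
Hypotheses (eps_gt0 : 0 < eps) (del_gt0 : 0 < del) (T_lt_T1 : (T%:E < T1)%E).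
Hypothesis RS : relaxation_solution eps del pi0 ui0 Ui0 T1 pr ur Ur.

Let I1 := time_before T1.
Let TI1 t : 0 <= t <= T -> I1 t.
Proof. by move=> /andP[t0 tT]; split => //; apply: le_lt_trans T_lt_T1; rewrite lee_fin. Qed.

Let spr : smooth I1 pr. Proof. by have [[]] := RS. Qed.
Let sur i : smooth I1 (coord ur i). Proof. by have [[_ _ h _] _ _ _ _] := RS; exact: (h i). Qed.
Let sUr i j : smooth I1 (entry Ur i j). Proof. by have [[_ _ _ h] _ _ _ _] := RS; exact: (h i j). Qed.

Let SI1 n F : smooth I1 F -> St T n F.
Proof. by move=> sF; exact: (Ck_St T_gt0 TI1 (sF n)). Qed.

Definition dvel i t x := coord ur i t x - coord u i t x.
Definition dpres t x := pr t x - p t x.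
Definition dflux i j t x := entry Ur i j t x - entry U i j t x.

Let pdB' j (f g : X -> R) x : pdable f -> pdable g ->
  pd j (fun x => f x - g x) x = pd j f x - pd j g x.
Proof. by move=> df dg; rewrite (pdB j df dg). Qed.

(** In terms of U, the Navier-Stokes equation reads d_t u + div U + grad p =
    0. *)
Let momentum i t x : 0 < t < T ->
  dt I1 (coord ur i ^~ x) t - dt I0 (coord u i ^~ x) t =
  0 - \sum_j pd j (dflux i j t) x - pd i (dpres t) x.
Proof.
move=> /inT tT.
have lin (a b c o l s v dr d g : R) : dr + a + b = 0 -> d + o = - c + l ->
    s = o - l -> v = a - s -> g = b - c -> dr - d = 0 - v - g by move=> ? ? ? ? ?; lra.
have [_ _ _ Emom _] := RS; have [_ _ Nmom _ NU] := NS.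
have Er := Emom t x i (TI1 tT); have En := Nmom t x i (TI0 tT).
rewrite !mxE in Er En.
have dU j := Cs_pdable (St_Cs (SI0 1 (sU i j)) tT).
have dUr j := Cs_pdable (St_Cs (SI1 1 (sUr i j)) tT).
have dp := Cs_pdable (St_Cs (SI0 1 sp) tT).
have dpr := Cs_pdable (St_Cs (SI1 1 spr) tT).
have du j := Cs_pdable (St_Cs (SI0 2 (su j)) tT).
have d2u j := Cs_pdable (Cs_pd j (St_Cs (SI0 2 (su i)) tT)).
have E1 : \sum_j pd j (entry U i j t) x =
    \sum_j pd j (fun y => outer (u t y) (u t y) i j) x - \sum_j pd j (pd j (coord u i t)) x.
  rewrite -sumrB; apply: eq_bigr => j _.
  have -> : entry U i j t = (fun y => coord u i t y * coord u j t y - pd j (coord u i t) y).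
    by apply/funext => y; rewrite /entry (NU t y (TI0 tT)) !mxE.
  rewrite (pdB' j x (pdableM (du i) (du j)) (d2u j)); congr (pd j _ x - _).
  by apply/funext => y; rewrite mxE.
have E2 : \sum_j pd j (dflux i j t) x =
    \sum_j pd j (entry Ur i j t) x - \sum_j pd j (entry U i j t) x.
  by rewrite -sumrB; apply: eq_bigr => j _; exact: pdB' (dUr j) (dU j).
exact: (lin _ _ _ _ _ _ _ _ _ _ Er En E1 E2 (pdB' i x dpr dp)).
Qed.

(** The reference solution satisfies the relaxation system with eps = delta =
    0; inserted into the one with positive eps and delta it leaves the
    residuals eps d_t p and delta d_t U. *)
Lemma solutions_perturbation (B : R) :
  (forall t, 0 <= t <= T ->
    [/\ forall i, C2_bounded B (coord u i t),
        forall i j, C2_bounded B (entry U i j t) /\ C2_bounded B (dtU i j t),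
        C2_bounded B (p t), C2_bounded B (dtp t)
      & forall x, in_cell x -> dttp t x ^+ 2 <= B]) ->
  perturbation T eps del B dvel dpres dflux (coord u) dtU dtp dttp.
Proof.
move=> HB.
have [[per _ _ _] Ndiv _ _ NU] := NS.
have [[perr _ _ _] _ Ediv _ Eflux] := RS.
have Sw n i : St T n (dvel i) := StB T_gt0 (SI1 n (sur i)) (SI0 n (su i)).
split.
- split.
  + by move=> i; exact: Sw.
  + exact: (StB T_gt0 (SI1 3 spr) (SI0 3 sp)).
  + by move=> i j; exact: (StB T_gt0 (SI1 3 (sUr i j)) (SI0 3 (sU i j))).
  + move=> i t tT j x; have [_ pu _] := per t (TI0 tT); have [_ pur _] := perr t (TI1 tT).
    by rewrite /dvel /coord pu pur.
  + move=> t tT j x; have [pp _ _] := per t (TI0 tT); have [ppr _ _] := perr t (TI1 tT).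
    by rewrite /dpres pp ppr.
  + move=> i j t tT k x; have [_ _ pU] := per t (TI0 tT); have [_ _ pUr] := perr t (TI1 tT).
    by rewrite /dflux /entry pU pUr.
  + exact: (StZ T_gt0 (- eps) (SI0 2 (smooth_dt sp))).
  + by move=> i; exact: (St_cst T_gt0 2 0).
  + move=> i j; have Su n k := SI0 n (su k).
    exact: (StB T_gt0 (StD T_gt0 (StD T_gt0 (StM T_gt0 (Sw 2 i) (Sw 2 j))
      (StM T_gt0 (Su 2 i) (Sw 2 j))) (StM T_gt0 (Sw 2 i) (Su 2 j)))
      (StZ T_gt0 del (SI0 2 (smooth_dt (sU i j))))).
  + move=> i t x tT.
    apply: (is_derive_eq (is_deriveD_fun (Ck_dtime TI1 (sur i 1) x tT)
      (is_deriveN_fun (Ck_dtime TI0 (su i 1) x tT)))).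
    exact: momentum.
  + move=> t x tT; have tT' := inT tT.
    apply: (is_derive_eq (is_deriveD_fun (Ck_dtime TI1 (spr 1) x tT)
      (is_deriveN_fun (Ck_dtime TI0 (sp 1) x tT)))).
    have lin (d d0 s sr s0 : R) : eps * d + sr = 0 -> s0 = 0 -> s = sr - s0 ->
        d - d0 = eps^-1 * (- eps * d0 - s).
      move=> h -> ->; have -> : sr = - (eps * d) by apply/eqP; rewrite -addr_eq0 addrC h.
      by field; rewrite gt_eqF.
    have Es : \sum_j pd j (dvel j t) x = divv (ur t) x - divv (u t) x.
      rewrite /divv -sumrB; apply: eq_bigr => j _.
      exact: pdB' (Cs_pdable (St_Cs (SI1 1 (sur j)) tT')) (Cs_pdable (St_Cs (SI0 1 (su j)) tT')).
    exact: (lin _ _ _ _ _ (Ediv t x (TI1 tT')) (Ndiv t x (TI0 tT')) Es).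
  + move=> i j t x tT; have tT' := inT tT.
    apply: (is_derive_eq (is_deriveD_fun (Ck_dtime TI1 (sUr i j 1) x tT)
      (is_deriveN_fun (Ck_dtime TI0 (sU i j 1) x tT)))).
    have lin (d d0 a b ai bi g g0 Y Y0 v : R) : del * d + g = a * b - Y ->
        Y0 = ai * bi - g0 -> v = g - g0 ->
        d - d0 = del^-1 * ((a - ai) * (b - bi) + ai * (b - bi) + (a - ai) * bi - del * d0
                           - (Y - Y0) - v).
      move=> h -> ->; have -> : g = a * b - Y - del * d by rewrite -h; ring.
      by field; rewrite gt_eqF.
    have E1 := Eflux t x i j (TI1 tT'). have E2 := NU t x (TI0 tT').
    have {}E2 : U t x i j = u t x 0 i * u t x 0 j - pd j (coord u i t) x.
      by rewrite E2 !mxE.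
    rewrite !mxE in E1.
    apply: (lin _ _ _ _ _ _ _ _ _ _ _ E1 E2).
    exact: pdB' (Cs_pdable (St_Cs (SI1 1 (sur i)) tT')) (Cs_pdable (St_Cs (SI0 1 (su i)) tT')).
- by move=> i; exact: SI0.
- by move=> i j; exact: SI0 (smooth_dt (sU i j)).
- exact: SI0 (smooth_dt sp).
- exact: SI0 (smooth_dt (smooth_dt sp)).
- exact: (Ck_dtime TI0 (smooth_dt sp 1)).
- exact: periodic_dtp.
- exact: mean_dtp.
- by move=> t i tT; have [h _ _ _ _] := HB t tT; exact: (h i).
- by move=> t i j tT; have [_ h _ _ _] := HB t tT; exact: (h i j).2.
- by move=> t tT; have [_ _ _ h _] := HB t tT; exact: h.
- by move=> t x tT; have [_ _ _ _ h] := HB t tT; exact: h.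
Qed.

End solutions_to_perturbation.

(** * The initial data *)

Lemma ler_of_sqr_le (R : realFieldType) (h K s : R) : 0 <= K -> 0 <= s ->
  h ^+ 2 <= K * s ^+ 2 -> h <= (K + 1) * s.
Proof.
move=> K0 s0 H; have Ks : 0 <= (K + 1) * s by rewrite mulr_ge0//; lra.
have [h0|h0] := ltP h 0; first exact: (le_trans (ltW h0) Ks).
rewrite -ler_sqr ?nnegrE// exprMn; apply: (le_trans H).
by rewrite ler_wpM2r ?sqr_ge0//; nra.
Qed.

Section data.
Variable R : realType.
Local Notation X := 'rV[R]_3.

Let sqr_sum3 (x y z c : R) : 0 <= x -> 0 <= y -> 0 <= z -> x + y + z <= c ->
  x ^+ 2 + y ^+ 2 + z ^+ 2 <= c ^+ 2.
Proof. by move=> x0 y0 z0 h; nra. Qed.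

Lemma H1norm_tvecB_sqr (v v' : X -> X) : H1norm (tvec (fun x => v x - v' x)) ^+ 2 =
  l2v (fun i x => v x 0 i - v' x 0 i) + d1v (fun i x => v x 0 i - v' x 0 i).
Proof.
rewrite H1norm_tvec_sqr.
have -> : (fun i x => (v x - v' x) 0 i) = (fun i x => v x 0 i - v' x 0 i).
  by apply/funext => i; apply/funext => x; rewrite !mxE.
by [].
Qed.

Lemma H1norm_tmatB_ge (M M' : X -> 'M[R]_3) :
  \sum_i \sum_j d1sq (fun x => M x i j - M' x i j) <=
  H1norm (tmat (fun x => M x - M' x)) ^+ 2.
Proof.
have -> : (fun x => M x - M' x) = (fun x => \matrix_(i, j) (M x i j - M' x i j)).
  by apply/funext => x; apply/matrixP => i j; rewrite !mxE.
apply: le_trans (H1norm_tmat_ge _); rewrite le_eqVlt; apply/orP; left; apply/eqP.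
apply: eq_bigr => i _; apply: eq_bigr => j _; congr d1sq.
by apply/funext => x; rewrite mxE.
Qed.

Lemma H1_data (eps del c : R) (v v' : X -> X) (f : X -> R) (M M' : X -> 'M[R]_3) :
  0 <= eps -> 0 <= del ->
  H1norm (tvec (fun x => v x - v' x)) + Num.sqrt eps * H1norm (tscal f)
    + Num.sqrt del * H1norm (tmat (fun x => M x - M' x)) <= c ->
  l2v (fun i x => v x 0 i - v' x 0 i) + d1v (fun i x => v x 0 i - v' x 0 i)
  + eps * (l2sq f + d1sq f)
  + del * \sum_i \sum_j d1sq (fun x => M x i j - M' x i j) <= c ^+ 2.
Proof.
move=> e0 d0 /(sqr_sum3 (H1norm_ge0 _) (mulr_ge0 (sqrtr_ge0 _) (H1norm_ge0 _))
  (mulr_ge0 (sqrtr_ge0 _) (H1norm_ge0 _))); apply: le_trans.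
rewrite !exprMn (sqr_sqrtr e0) (sqr_sqrtr d0) H1norm_tvecB_sqr H1norm_tscal_sqr lerD2l.
exact (ler_wpM2l d0 (H1norm_tmatB_ge M M')).
Qed.

(** The Hessians of the reference data are bounded, and the 13 scalar
    components account for 234 = 13 * 18. *)
Lemma H2_data (eps del c B : R) (v v' : X -> X) (f f' : X -> R) (M M' : X -> 'M[R]_3) :
  0 <= eps -> eps <= 1 -> 0 <= del -> del <= 1 -> 0 <= B ->
  Cs 2 f -> Cs 2 f' -> (forall i, Cs 2 (fun x => v x 0 i)) ->
  (forall i, Cs 2 (fun x => v' x 0 i)) ->
  (forall i j, Cs 2 (fun x => M x i j)) -> (forall i j, Cs 2 (fun x => M' x i j)) ->
  C2_bounded B f' -> (forall i, C2_bounded B (fun x => v' x 0 i)) ->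
  (forall i j, C2_bounded B (fun x => M' x i j)) ->
  L2norm (tgrad (tgrad (tpair (tvec v) (tpair (tscal (fun x => Num.sqrt eps * f x))
    (tmat (fun x => Num.sqrt del *: M x)))))) <= c ->
  d2v (fun i x => v x 0 i - v' x 0 i) + eps * d2sq (fun x => f x - f' x)
  + del * \sum_i \sum_j d2sq (fun x => M x i j - M' x i j) <= 2 * c ^+ 2 + 234 * B.
Proof.
move=> e0 e1 d0 d1 B0 Cf Cf' Cv Cv' CM CM' f'B v'B M'B Hc.
have fin (f1 f0 v1 v0 m1 m0 c2 : R) : f1 <= 2 * f0 + 18 * B ->
    v1 <= 2 * v0 + 3 * (18 * B) -> m1 <= 2 * m0 + 3 * (3 * (18 * B)) ->
    v0 + eps * f0 + del * m0 <= c2 -> v1 + eps * f1 + del * m1 <= 2 * c2 + 234 * B.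
  move=> Hf Hv HM H.
  have h1 := ler_wpM2l e0 Hf; have h2 := ler_wpM2l d0 HM.
  have h3 : eps * (18 * B) <= 18 * B by rewrite ler_piMl// mulr_ge0.
  have h4 : del * (3 * (3 * (18 * B))) <= 3 * (3 * (18 * B)).
    by rewrite ler_piMl// !mulr_ge0.
  rewrite !mulrDr in h1 h2.
  have -> : 2 * c2 + 234 * B = 2 * c2 + (3 * (18 * B) + 18 * B + 3 * (3 * (18 * B))) by ring.
  apply: (@le_trans _ _ (2 * (v0 + eps * f0 + del * m0)
    + (3 * (18 * B) + 18 * B + 3 * (3 * (18 * B))))); last by rewrite lerD2r ler_pM2l.
  have -> : 2 * (v0 + eps * f0 + del * m0) = 2 * v0 + eps * (2 * f0) + del * (2 * m0) by ring.
  lra.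
have L0 : 0 <= L2norm (tgrad (tgrad (tpair (tvec v) (tpair
    (tscal (fun x => Num.sqrt eps * f x)) (tmat (fun x => Num.sqrt del *: M x)))))).
  exact: sqrtr_ge0.
have Hd : d2v (fun i x => v x 0 i) + eps * d2sq f
    + del * \sum_i \sum_j d2sq (fun x => M x i j) <= c ^+ 2.
  rewrite -hessian_norm_sqr// ler_sqr ?nnegrE//; exact: le_trans L0 Hc.
have Hv : d2v (fun i x => v x 0 i - v' x 0 i) <= 2 * d2v (fun i x => v x 0 i) + 3 * (18 * B).
  rewrite /d2v mulr_sumr -lerBlDl -sumrB; apply: sum3_le => i; rewrite lerBlDl.
  exact (d2sqB_le (Cv i) (Cv' i) (v'B i)).
have HM : \sum_i \sum_j d2sq (fun x => M x i j - M' x i j) <=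
    2 * (\sum_i \sum_j d2sq (fun x => M x i j)) + 3 * (3 * (18 * B)).
  rewrite mulr_sumr -lerBlDl -sumrB; apply: sum3_le => i; rewrite mulr_sumr -sumrB.
  apply: sum3_le => j; rewrite lerBlDl; exact (d2sqB_le (CM i j) (CM' i j) (M'B i j)).
have Hf := d2sqB_le Cf Cf' f'B.
exact (fin _ _ _ _ _ _ _ Hf Hv HM Hd).
Qed.

End data.

(** * Convergence of the relaxation *)

(** The sum eps + delta, divided by the factor sqrt eps of the pressure, is
    sqrt eps + delta / sqrt eps. In particular delta tends to 0 although the
    filter only constrains eps. *)
Lemma sigma_over_sqrt_cvg0 (R : realType) (E E' : set (R * R)) : E' `<=` E ->
  z.2 / Num.sqrt z.1 @[z --> eps_to0 E] --> (0 : R) ->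
  (fun z => Num.sqrt z.1 + z.2 / Num.sqrt z.1) z @[z --> eps_to0 E'] --> (0 : R) /\
  (fun z => z.1 + z.2) z @[z --> eps_to0 E'] --> (0 : R).
Proof.
move=> E'E cE.
pose G : set_system (R * R) := filter_prod (0 : R)^'+ (globally [set: R]).
have FG : Filter G by exact: filter_prod_filter.
have c1 : z.1 @[z --> eps_to0 E'] --> (0 : R).
  apply: cvg_within_filter; apply: cvg_trans (@cvg_fst R R (0 : R)^'+ (globally [set: R]) _) _.
  exact: cvg_within.
have cs : Num.sqrt z.1 @[z --> eps_to0 E'] --> (0 : R).
  rewrite -[X in _ --> X]sqrtr0.
  exact: (@cvg_comp _ _ _ (fun z : R * R => z.1) Num.sqrt _ _ _ c1 (@sqrt_continuous R 0)).
have cq : z.2 / Num.sqrt z.1 @[z --> eps_to0 E'] --> (0 : R).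
  apply: cvg_trans cE; apply: cvg_fmap2; exact: within_subset.
have c2 : z.2 @[z --> eps_to0 E'] --> (0 : R).
  have : (z.2 / Num.sqrt z.1 * Num.sqrt z.1) @[z --> eps_to0 E'] --> (0 * 0 : R).
    exact: cvgM cq cs.
  rewrite mulr0; apply: cvg_trans; apply: near_eq_cvg.
  rewrite /eps_to0; apply: cvg_within; exists ([set x : R | 0 < x], setT) => //=.
    by split => //; exact: nbhs_right_gt.
  by move=> [x y] /= [x0 _]; rewrite divfK// gt_eqF// sqrtr_gt0.
split.
- rewrite -[X in _ --> X]addr0; exact: cvgD cs cq.
- rewrite -[X in _ --> X]addr0; exact: cvgD c1 c2.
Qed.

Theorem theorem2p5 (R : realType) (T0 : \bar R)
    (p : R -> 'rV[R]_3 -> R) (u : R -> 'rV[R]_3 -> 'rV[R]_3)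
    (U : R -> 'rV[R]_3 -> 'M[R]_3)
    (T0_gt0 : (0 < T0)%E) (NS : navier_stokes T0 p u U)
    (a C0 T : R) (a_ge0 : 0 <= a) (a_lt1 : a < 1) (C0_gt0 : 0 < C0)
    (T_gt0 : 0 < T) (T_le_T0 : (T%:E <= T0)%E) :
  exists CT eta : R, [/\ 0 < CT, 0 < eta &
    forall (E : set (R * R))
      (pi0 : R -> R -> 'rV[R]_3 -> R)
      (ui0 : R -> R -> 'rV[R]_3 -> 'rV[R]_3)
      (Ui0 : R -> R -> 'rV[R]_3 -> 'M[R]_3)
      (Tlife : R -> R -> \bar R)
      (pr : R -> R -> R -> 'rV[R]_3 -> R)
      (ur : R -> R -> R -> 'rV[R]_3 -> 'rV[R]_3)
      (Ur : R -> R -> R -> 'rV[R]_3 -> 'M[R]_3),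
    (forall eps delta : R, E (eps, delta) ->
      [/\ 0 < eps /\ 0 < delta,
          [/\ (0 < Tlife eps delta)%E,
              relaxation_solution eps delta
                (pi0 eps delta) (ui0 eps delta) (Ui0 eps delta) (Tlife eps delta)
                (pr eps delta) (ur eps delta) (Ur eps delta)
            & relaxation_lifespan eps delta
                (pi0 eps delta) (ui0 eps delta) (Ui0 eps delta)
                (Tlife eps delta)]
        & [/\ delta <= C0 * Num.sqrt eps,
              H1norm (tvec (fun x => ui0 eps delta x - u 0 x))
                + Num.sqrt eps * H1norm (tscal (fun x => pi0 eps delta x - p 0 x))
                + Num.sqrt delta * H1norm (tmat (fun x => Ui0 eps delta x - U 0 x))
              <= C0 * (eps + delta),
              L2norm (tvec (grad (divv (ui0 eps delta))))
                + delta * (L2norm (tgrad (tgrad (tscal (pi0 eps delta))))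
                           + L2norm (tmat (jac (divm (Ui0 eps delta)))))
              <= C0 * (eps + delta)
            & L2norm (tgrad (tgrad
                (tpair (tvec (ui0 eps delta))
                  (tpair (tscal (fun x => Num.sqrt eps * pi0 eps delta x))
                    (tmat (fun x => Num.sqrt delta *: Ui0 eps delta x))))))
              <= C0 * (eps + delta) `^ (- a)]]) ->
    (forall eps delta : R, E (eps, delta) -> (T%:E < Tlife eps delta)%E ->
      eps + delta < eta ->
      (ereal_sup [set (H1norm (tvec (fun x => ur eps delta t x - u t x))
                       + Num.sqrt eps
                         * H1norm (tscal (fun x => pr eps delta t x - p t x)))%:E
                 | t in `[0%R, T]]
       <= (CT * (eps + delta))%:E)%E) /\
    (z.2 / Num.sqrt z.1 @[z --> eps_to0 E] --> (0 : R) ->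
     ereal_sup [set (H1norm (tscal (fun x => pr z.1 z.2 t x - p t x)))%:E
               | t in `[0%R, T]]
       @[z --> eps_to0 (E `&` [set z | (T%:E < Tlife z.1 z.2)%E])] --> 0%E)].
Proof.
have [B B0 HB] := reference_bounded T_gt0 T_le_T0 NS.
have D0 : 0 <= 2 * C0 ^+ 2 + 234 * B by have := sqr_ge0 C0; lra.
have [K [eta [K0 eta0 HK]]] := H1_estimate B0 (sqr_ge0 C0) D0 a_ge0 a_lt1 T_gt0.
have I0 t : 0 <= t <= T -> time_upto T0 t.
  by move=> /andP[t0 tT]; split => //; apply: le_trans T_le_T0; rewrite lee_fin.
have O : 0 <= (0 : R) <= T by rewrite lexx ltW.
exists (2 * (K + 1)), (Num.min eta 1); split; [lra|by rewrite lt_min eta0 ltr01|].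
move=> E pi0 ui0 Ui0 Tlife pr ur Ur HE.
have main eps delta t : E (eps, delta) -> (T%:E < Tlife eps delta)%E ->
    eps + delta < Num.min eta 1 -> 0 <= t <= T ->
    H1norm (tvec (fun x => ur eps delta t x - u t x))
    + Num.sqrt eps * H1norm (tscal (fun x => pr eps delta t x - p t x))
    <= 2 * (K + 1) * (eps + delta).
  move=> Eed Tl; rewrite lt_min => /andP[sig_eta sig1] tT.
  have [[eps0 del0] [_ RS _] [_ Hdata _ Hhess]] := HE _ _ Eed.
  have [[_ spr sur sUr] [pE uE UE] _ _ _] := RS.
  have [[_ sp su sU] _ _ _ _] := NS.
  have I1 t' : 0 <= t' <= T -> time_before (Tlife eps delta) t'.
    by move=> /andP[t0 tT']; split => //; apply: le_lt_trans Tl; rewrite lee_fin.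
  have pt := solutions_perturbation T_gt0 T_le_T0 NS eps0 del0 Tl RS HB.
  rewrite -pE -uE -UE in Hdata Hhess.
  have C_ n f : smooth (time_upto T0) f -> Cs n (f 0).
    by move=> sf; exact: (St_Cs (Ck_St T_gt0 I0 (sf n)) O).
  have C1 n f : smooth (time_before (Tlife eps delta)) f -> Cs n (f 0).
    by move=> sf; exact: (St_Cs (Ck_St T_gt0 I1 (sf n)) O).
  have [uB UB pB _ _] := HB 0 O.
  have sig0 : 0 < eps + delta by rewrite addr_gt0.
  have e1 : eps <= 1 by apply: ltW; apply: le_lt_trans sig1; rewrite lerDl ltW.
  have d1 : delta <= 1 by apply: ltW; apply: le_lt_trans sig1; rewrite lerDr ltW.
  have init1 := H1_data (ltW eps0) (ltW del0) Hdata.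
  rewrite exprMn in init1.
  have init2 := H2_data (ltW eps0) e1 (ltW del0) d1 B0 (C1 2 _ spr) (C_ 2 _ sp)
    (fun i => C1 2 _ (sur i)) (fun i => C_ 2 _ (su i)) (fun i j => C1 2 _ (sUr i j))
    (fun i j => C_ 2 _ (sU i j)) pB uB (fun i j => (UB i j).1) Hhess.
  have init2' : 2 * (C0 * (eps + delta) `^ (- a)) ^+ 2 + 234 * B <=
      (2 * C0 ^+ 2 + 234 * B) * ((eps + delta) `^ (- a)) ^+ 2.
    have r1 : 1 <= ((eps + delta) `^ (- a)) ^+ 2.
      rewrite exprn_ege1// powRN invf_ge1 ?powR_gt0//.
      have E1 : 1 = 1 `^ a :> R by rewrite powR1.
      rewrite [leRHS]E1; apply: ge0_ler_powR; rewrite ?nnegrE ?(ltW sig0)//.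
      exact: ltW.
    have BB : 0 <= 234 * B := mulr_ge0 (ler0n _ _) B0.
    move: (ler_wpM2l BB r1); rewrite mulr1 exprMn.
    by move: ((_ `^ _) ^+ 2) (C0 ^+ 2) (234 * B) => x y b h; rewrite [leRHS]mulrDl mulrA lerD2l.
  have [Hw Hq] := HK eps delta _ _ _ _ _ _ _ eps0 del0 sig_eta pt init1 (le_trans init2 init2') t tT.
  have Nw : H1norm (tvec (fun x => ur eps delta t x - u t x)) <= (K + 1) * (eps + delta).
    apply: (ler_of_sqr_le K0 (ltW sig0)); rewrite H1norm_tvecB_sqr; exact: Hw.
  have Nq : Num.sqrt eps * H1norm (tscal (fun x => pr eps delta t x - p t x)) <=
      (K + 1) * (eps + delta).
    apply: (ler_of_sqr_le K0 (ltW sig0)).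
    rewrite exprMn (sqr_sqrtr (ltW eps0)) H1norm_tscal_sqr; exact: Hq.
  have -> : 2 * (K + 1) * (eps + delta) = (K + 1) * (eps + delta) + (K + 1) * (eps + delta).
    by ring.
  exact: lerD Nw Nq.
split.
  move=> eps delta Eed Tl sig; apply: ge_ereal_sup => _ /= [t + <-].
  by rewrite in_itv /= => tT; rewrite lee_fin; exact: main.
move=> cE.
set E' := E `&` _.
have E'E : E' `<=` E by move=> z [].
have [cb cs] := sigma_over_sqrt_cvg0 E'E cE.
have FE : Filter (eps_to0 E') by exact: within_filter.
have cub : (2 * (K + 1) * (Num.sqrt z.1 + z.2 / Num.sqrt z.1))%:E @[z --> eps_to0 E'] --> 0%E.
  apply: cvg_EFin; first exact: nearW.
  rewrite -[X in _ --> X](mulr0 (2 * (K + 1))).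
  exact: cvgM (cvg_cst _) cb.
apply: (squeeze_cvge _ (cvg_cst 0%E) cub).
have small : \forall z \near eps_to0 E', z.1 + z.2 < Num.min eta 1.
  have m0 : 0 < Num.min eta 1 by rewrite lt_min eta0 ltr01.
  have near0 : eps_to0 E' [set z | `|0 - (z.1 + z.2)| < Num.min eta 1].
    exact: ((cvgrPdist_lt _ _).1 cs _ m0).
  apply: filterS near0 => z; rewrite /= sub0r normrN.
  by move=> h; exact: (le_lt_trans (ler_norm _) h).
have inE' : \forall z \near eps_to0 E', E' z by exact: withinT.
apply: filterS2 small inE' => -[eps delta] /= sig [Eed Tl].
have [[eps0 del0] _ _] := HE _ _ Eed.
have q0 : 0 < Num.sqrt eps by rewrite sqrtr_gt0.
apply/andP; split.
- apply: le_ereal_sup_tmp.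
  exists (H1norm (tscal (fun x => pr eps delta 0 x - p 0 x)))%:E.
    by exists 0 => //=; rewrite in_itv /=.
  by rewrite lee_fin; exact: H1norm_ge0.
- apply: ge_ereal_sup => _ /= [t + <-]; rewrite in_itv /= => tT; rewrite lee_fin.
  have M := main _ _ _ Eed Tl sig tT.
  have : Num.sqrt eps * H1norm (tscal (fun x => pr eps delta t x - p t x)) <=
      2 * (K + 1) * (eps + delta).
    by apply: le_trans M; rewrite lerDr; exact: H1norm_ge0.
  rewrite mulrC -ler_pdivlMr// => /le_trans; apply.
  rewrite -[leLHS]mulrA; apply: ler_wpM2l; first by rewrite mulr_ge0 ?addr_ge0.
  by rewrite mulrDl -{1}(sqr_sqrtr (ltW eps0)) expr2 mulfK// gt_eqF.
Qed.
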